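(* Let $p\in(0,1)$, and let $\Lambda,V$ satisfy Assumption A (see context), in the partial matching model in dimension $d=1$. For $K>0$, $L\ge 1$, let $\widehat P_1,\dots,\widehat P_{N_X}$ be the local posterior approximations (see context) computed with locality parameter $M=KL$, and let $P_1,\dots,P_{N_X}$ be the true posterior marginals. Then there exists a constant $C>0$, depending on $\Lambda(\cdot),V(\cdot)$ (and the fixed model parameter $p$) but not on $K,L$, such that for any $\kappa>1$ there is $n_0(\kappa,K,L)$ such that for all $n\ge n_0(\kappa,K,L)$, with probability at least $1-\exp(-(\log n)^\kappa)$ over $(X,Y)$, $$\frac{1}{N_X}\sum_{i=1}^{N_X}\mathrm{TV}(P_i,\widehat P_i)\le C L^{-\delta/2}+C\left(1-e^{-CL\log L}\right)^{K/3}.$$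
   Context: Assumption A (dimension $d=1$). (i) $\Lambda$ is a continuous probability density on $[0,1]$ with $0<\Lambda_{\min}\le\Lambda(x)\le\Lambda_{\max}$ for all $x\in[0,1]$. (ii) $V:\mathbb R\to\mathbb R$ satisfies $V(\varepsilon)=V(-\varepsilon)$, $\int_{\mathbb R}e^{-V(\varepsilon)}\,d\varepsilon=1$, and there are constants $C_0,c_0,\delta>0$, $V_{\min}\in\mathbb R$ and non-decreasing $f,g:[0,\infty)\to\mathbb R$ with $C_0(1+|\varepsilon|^{C_0})\ge g(|\varepsilon|)\ge V(\varepsilon)-V_{\min}\ge f(|\varepsilon|)\ge c_0|\varepsilon|^{1+\delta}$ for all $\varepsilon\in\mathbb R$. Both $\Lambda$ and $V$ do not depend on $n$. Density. For $n\ge1$, $p_n(x,y)=\mathcal Z_n^{-1}\sqrt{\Lambda(x)\Lambda(y)}\,e^{-V(n(x-y))}$ on $[0,1]^2$, with $\mathcal Z_n$ the normalizing constant; $p_n(x)=\int_0^1p_n(x,y)\,dy$ is its marginal. Partial matching model. Draw $N\sim\mathrm{Poisson}((1-p)^{-2}\mathcal Z_n^{-1})$, and given $N$ draw i.i.d. pairs $(\bar X_i,\bar Y_i)\sim p_n(x,y)$, $i\in[N]$. Each value $\bar X_i$ and each value $\bar Y_i$ is independently observed with probability $p$. Let $N_X$ (resp. $N_Y$) be the number of observed $\bar X$ (resp. $\bar Y$) values. The observed $\bar X$ values are listed in uniformly random order as $X=(X_1,\dots,X_{N_X})$ and, independently, the observed $\bar Y$ values in uniformly random order as $Y=(Y_1,\dots,Y_{N_Y})$.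 The latent partial bijection $\pi^*$ from $[N_X]$ to $[N_Y]$ has $\pi^*(i)=j$ if $X_i$ and $Y_j$ come from the same pair, and $\pi^*(i)=\varnothing$ if the partner of $X_i$ is unobserved. Posterior. A partial bijection $\pi$ from a finite set $S$ to a finite set $T$ is a bijection from a subset $\mathrm{dom}(\pi)\subseteq S$ to a subset $\mathrm{range}(\pi)\subseteq T$; write $\pi(i)=\varnothing$ if $i\notin\mathrm{dom}(\pi)$ and $\pi^{-1}(j)=\varnothing$ if $j\notin\mathrm{range}(\pi)$. With $U_n(x)=\log\frac{p_n(x)}{\sqrt{\Lambda(x)}}$, for index sets $S\subseteq[N_X]$, $T\subseteq[N_Y]$ and a partial bijection $\pi$ from $S$ to $T$ let $$H_n^{S,T}(\pi)=\sum_{i\in S:\pi(i)\ne\varnothing}V(n(X_i-Y_{\pi(i)}))-\sum_{i\in S:\pi(i)=\varnothing}U_n(X_i)-\sum_{j\in T:\pi^{-1}(j)=\varnothing}U_n(Y_j).$$ The posterior law of $\pi^*$ given $(X,Y)$ is $P(\pi\mid X,Y)\propto\exp(-H_n^{[N_X],[N_Y]}(\pi))$ over partial bijections from $[N_X]$ to $[N_Y]$. Set $P_i(j)=P(\pi(i)=j\mid X,Y)$ for $i\in[N_X]$, $j\in\{\varnothing\}\cup[N_Y]$. Local approximation with parameter $M>0$. For each $i\in[N_X]$ let $x_-^{(i)}=\max(0,\frac{\lfloor nX_i\rfloor-M}{n})$, $x_+^{(i)}=\min(1,\frac{\lfloor nX_i\rfloor+M}{n})$, $S^{(i)}_X=\{j:X_j\in[x_-^{(i)},x_+^{(i)}]\}$,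 $S^{(i)}_Y=\{j:Y_j\in[x_-^{(i)},x_+^{(i)}]\}$. Let $P^{(i)}(\pi)\propto\exp(-H_n^{S_X^{(i)},S_Y^{(i)}}(\pi))$ over partial bijections $\pi$ from $S_X^{(i)}$ to $S_Y^{(i)}$. Set $\widehat P_i(j)=P^{(i)}(\pi(i)=j)$ for $j\in S_Y^{(i)}\cup\{\varnothing\}$ and $\widehat P_i(j)=0$ otherwise. $\mathrm{TV}(P,P')=\frac12\sum_j|P(j)-P'(j)|$. *)

(* Defs.v *)
From HB Require Import structures.
From mathcomp Require Import all_boot all_order all_algebra all_fingroup.
From mathcomp Require Import all_classical all_reals all_analysis.
Set Implicit Arguments.
Unset Strict Implicit.
Unset Printing Implicit Defensive.
Import Order.TTheory GRing.Theory Num.Theory.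
Import numFieldNormedType.Exports.
Local Open Scope classical_set_scope.
Local Open Scope ring_scope.

Section Density.
Context {R : realType}.
Variables (Lam V : R -> R).
Local Notation mu := (@lebesgue_measure R).

(* Lam only matters on [0, 1]; f and g only matter on [0, +oo[.
   Measurability of V is implicit in the normalisation of exp(-V). *)
Definition assumptionA (delta : R) : Prop :=
  [/\ {within `[0, 1], continuous Lam},
      (\int[mu]_(x in `[0%R, 1%R]) (Lam x)%:E = 1)%E &
      exists Lmin Lmax : R, 0 < Lmin /\
        forall x, 0 <= x <= 1 -> Lmin <= Lam x <= Lmax]
  /\
  [/\ measurable_fun [set: R] V,
      forall e, V e = V (- e),
      (\int[mu]_e (expR (- V e))%:E = 1)%E &
      exists (C0 c0 Vmin : R) (f g : R -> R),
        [/\ [/\ 0 < C0, 0 < c0 & 0 < delta],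
            (forall x y, 0 <= x -> x <= y -> f x <= f y),
            (forall x y, 0 <= x -> x <= y -> g x <= g y) &
            forall e, [/\ g `|e| <= C0 * (1 + `|e| `^ C0),
                          V e - Vmin <= g `|e|,
                          f `|e| <= V e - Vmin &
                          c0 * `|e| `^ (1 + delta) <= f `|e|]]].

Definition square : set (R * R) := `[0, 1] `*` `[0, 1].

Variable n : nat.

Definition weight (x y : R) : R :=
  Num.sqrt (Lam x * Lam y) * expR (- V (n%:R * (x - y))).

Definition Zn : R :=
  \int[(mu \x mu)%E]_(z in square) weight z.1 z.2.

Definition pn (x y : R) : R := Zn^-1 * weight x y.

Definition pn1 (x : R) : R := \int[mu]_(y in `[0, 1]) pn x y.

Definition Un (x : R) : R := ln (pn1 x / Num.sqrt (Lam x)).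

End Density.

Section Independence.
Context {d : measure_display} {T : measurableType d} {R : realType}.
Variable P : probability T R.

Definition mutually_independent (I : eqType) (F : I -> set (set T)) : Prop :=
  forall (J : seq I) (A : I -> set T), uniq J ->
    (forall i, i \in J -> F i (A i)) ->
    P (\bigcap_(i in [set` J]) A i) = (\prod_(i <- J) P (A i))%E.

End Independence.

Inductive source : Type :=
  | Count
  | Pair of nat
  | ObsX of nat
  | ObsY of nat
  | OrdX of nat
  | OrdY of nat.

HB.instance Definition _ := gen_eqMixin source.

(* The numbers attached to ObsX, ObsY and Pair index the pairs: infinitely many
   pairs are drawn and the first [npairs] of them are kept.  The number m
   attached to OrdX and OrdY is the size of the list to be shuffled: an
   independent uniform permutation is available for each m, and only those whose
   sizes are the numbers of observed values are used, so that, conditionally on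
   everything else, the two lists are shuffled uniformly and independently. *)
Record partial_matching {d : measure_display} {T : measurableType d}
    {R : realType} (P : probability T R) (Lam V : R -> R) (p : R) (n : nat) := {
  npairs : {RV P >-> nat};
  pairs : nat -> {RV P >-> (R * R)%type};
  obsX : nat -> {RV P >-> bool};
  obsY : nat -> {RV P >-> bool};
  ordX : forall m, T -> 'S_m;
  ordY : forall m, T -> 'S_m;
  npairs_law : forall k, P (npairs @^-1` [set k]) =
    (poisson_pmf ((1 - p) ^- 2 * (Zn Lam V n)^-1) k)%:E;
  pairs_law : forall i (A : set (R * R)), measurable A ->
    P (pairs i @^-1` A) =
    (\int[lebesgue_measure \x lebesgue_measure]_(z in A `&` square)
      (pn Lam V n z.1 z.2)%:E)%E;
  obsX_law : forall i, P (obsX i @^-1` [set true]) = p%:E;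
  obsY_law : forall i, P (obsY i @^-1` [set true]) = p%:E;
  ordX_meas : forall m s, measurable (ordX m @^-1` [set s]);
  ordY_meas : forall m s, measurable (ordY m @^-1` [set s]);
  ordX_law : forall m s, P (ordX m @^-1` [set s]) = ((m`!)%:R^-1)%:E;
  ordY_law : forall m s, P (ordY m @^-1` [set s]) = ((m`!)%:R^-1)%:E;
  sources_indep : mutually_independent P (fun s : source =>
    match s with
    | Count => preimage_set_system setT npairs measurable
    | Pair i => preimage_set_system setT (pairs i) measurable
    | ObsX i => preimage_set_system setT (obsX i) measurable
    | ObsY i => preimage_set_system setT (obsY i) measurable
    | OrdX m => preimage_set_system setT (ordX m) setT
    | OrdY m => preimage_set_system setT (ordY m) setT
    end)
}.

Section Observation.
Context {d : measure_display} {T : measurableType d} {R : realType}.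
Context {P : probability T R} {Lam V : R -> R} {p : R} {n : nat}.
Variables (W : partial_matching P Lam V p n) (w : T).

Definition observedX : seq nat := [seq k <- iota 0 (npairs W w) | obsX W k w].
Definition observedY : seq nat := [seq k <- iota 0 (npairs W w) | obsY W k w].

Definition NX : nat := size observedX.
Definition NY : nat := size observedY.

(* Index of the pair from which the i-th listed value comes. *)
Definition labelX (i : 'I_NX) : nat := nth 0%N observedX (ordX W NX w i).
Definition labelY (j : 'I_NY) : nat := nth 0%N observedY (ordY W NY w j).

Definition sampleX (i : 'I_NX) : R := (pairs W (labelX i) w).1.
Definition sampleY (j : 'I_NY) : R := (pairs W (labelY j) w).2.

Definition latent_matching : {ffun 'I_NX -> option 'I_NY} :=
  [ffun i => [pick j | labelY j == labelX i]].

End Observation.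

Arguments sampleX {d T R P Lam V p n} W w i.
Arguments sampleY {d T R P Lam V p n} W w j.

Section Posterior.
Context {R : realType}.
Variables (Lam V : R -> R) (n a b : nat) (x : 'I_a -> R) (y : 'I_b -> R).

(* Partial bijections from S to T are functions into an option type, with value
   None outside their domain (in particular outside S). *)
Definition partial_bijections (S : {set 'I_a}) (T : {set 'I_b}) :
    {set {ffun 'I_a -> option 'I_b}} :=
  [set pi : {ffun 'I_a -> option 'I_b} |
     [forall i, forall j, (pi i == Some j) ==> (i \in S) && (j \in T)] &&
     [forall i, forall i', (pi i != None) && (pi i == pi i') ==> (i == i')]]%SET.

Definition energy (S : {set 'I_a}) (T : {set 'I_b})
    (pi : {ffun 'I_a -> option 'I_b}) : R :=
  \sum_(i in S) oapp (fun j => V (n%:R * (x i - y j))) 0 (pi i)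
  - \sum_(i in S | pi i == None) Un Lam V n (x i)
  - \sum_(j in T | [forall i, pi i != Some j]) Un Lam V n (y j).

Definition gibbs (S : {set 'I_a}) (T : {set 'I_b})
    (pi : {ffun 'I_a -> option 'I_b}) : R :=
  expR (- energy S T pi) /
  \sum_(pi' in partial_bijections S T) expR (- energy S T pi').

Definition gibbs_marginal (S : {set 'I_a}) (T : {set 'I_b})
    (i : 'I_a) (o : option 'I_b) : R :=
  \sum_(pi in partial_bijections S T | pi i == o) gibbs S T pi.

(* With a = NX, b = NY and x, y the samples, gibbs on the full index sets is the
   posterior law of [latent_matching] given the two samples. *)
Definition posterior (i : 'I_a) (o : option 'I_b) : R :=
  gibbs_marginal [set: 'I_a]%SET [set: 'I_b]%SET i o.

Variable M : R.

Definition xminus (i : 'I_a) : R :=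
  Num.max 0 (((Num.floor (n%:R * x i))%:~R - M) / n%:R).
Definition xplus (i : 'I_a) : R :=
  Num.min 1 (((Num.floor (n%:R * x i))%:~R + M) / n%:R).

Definition localX (i : 'I_a) : {set 'I_a} :=
  [set j | xminus i <= x j <= xplus i]%SET.
Definition localY (i : 'I_a) : {set 'I_b} :=
  [set j | xminus i <= y j <= xplus i]%SET.

Definition local_posterior (i : 'I_a) (o : option 'I_b) : R :=
  if (if o is Some j then j \in localY i else true)
  then gibbs_marginal (localX i) (localY i) i o else 0.

End Posterior.

Definition TV {R : realType} {I : finType} (P Q : I -> R) : R :=
  2^-1 * \sum_o `|P o - Q o|.

(* Main.v *)
(* Dividing the Gibbs weight of a partial matching by the weight of the empty
   one turns the posterior into a monomer-dimer model on the points, with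
   activity exp(-V - U - U) <= c exp(-distance) on each edge.  For such a model
   the probability p(v, H) that v is unmatched in H satisfies
     1 / p(v, H) = 1 + sum_u lam(v, u) p(u, H \ v),
   and this recursion contracts in ln p by B / (1 + B), where B is the total
   activity at v.  Hence cutting the configuration at distance q ^ 4 changes the
   marginals at a point by O(1 / q), as soon as the point is not surrounded by
   too many others; no randomness is used here.

   It remains to count the crowded points.  Scanning the independent pairs in
   order, the conditional probability that the next point is crowded by the
   previous ones is O(1 / q), whatever they are; an exponential moment bound, and
   the same scan in the reverse order, show that all but a fraction O(1 / q) of
   the points are uncrowded, except with probability exp(-c n).

   Finally, unless K > exp(C L ln L) the right-hand side is at least 1, and
   otherwise q can be taken of order exp(C L ln L / 8), which makes 1 / q much
   smaller than L ^ (-delta / 2). *)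

Require Import Defs.
From HB Require Import structures.
From mathcomp Require Import all_boot all_order all_algebra all_fingroup.
From mathcomp Require Import all_classical all_reals all_analysis.
From mathcomp Require Import measurable_realfun.
From mathcomp Require Import zify ring lra.
Set Implicit Arguments.
Unset Strict Implicit.
Unset Printing Implicit Defensive.
Import Order.TTheory GRing.Theory Num.Theory.
Import numFieldNormedType.Exports.
Local Open Scope classical_set_scope.
Local Open Scope ring_scope.

(** * Matchings: recursion and contraction *)

(** The obstacle is that points may accumulate, so the activity [B] met by the recursion has no
    uniform bound and a fixed contraction rate is out of reach. Crowding is therefore measured by
    one number, the sum of [exp(- distance / q^4)] around a point. Its typical order is [q^4], and
    [q^5] is allowed: the slack [q] is what Markov's inequality turns into a fraction [O(1 / q)] of
    crowded points. The ball of radius [q^4] is cut into about [q^3] shells of width [q], which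
    together hold [O(q^5)] points, hence [O(q^2)] per shell on average. The product of the factors
    [B / (1 + B)] over the shells is then about [exp(- q^3 / q^2) = exp(- q)], which beats every
    polynomial loss in [q].

    On the random side, positions are rounded to blocks of length [1 / n], so that the law of
    finitely many pairs is a finite product and exponential moments are finite sums. The Poisson
    number of pairs is never conditioned on: crowding is counted among a deterministic number [m1]
    of pairs, and the observed values form a sub-collection of them. *)

Lemma contraction_ln (R : realType) (B D : R) : 0 <= B -> 0 <= D ->
  (1 + B) / (1 + expR (- D) * B) <= expR (B / (1 + B) * D).
Proof.
move=> B0 D0.
have e1 := expR_gt0 (- D).
have B1 : 0 < 1 + B by lra.
have eB : 0 <= expR (- D) * B by rewrite mulr_ge0 // ltW.
rewrite ler_pdivrMr; last by lra.
set y := B / (1 + B) * D.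
have y0 : 0 <= y by rewrite /y mulr_ge0 // divr_ge0 // ltW.
have ey : expR (- y) * expR y = 1 by rewrite -expRD addNr expR0.
have ey0 := expR_gt0 y.
have emy0 := expR_gt0 (- y).
(* the tangent line of exp at -y, taken at 0 and at -D *)
have t0 : expR (- y) * (1 + y) <= 1.
  by rewrite (le_trans (ler_wpM2l (ltW emy0) (expR_ge1Dx y))) // ey.
have tD : expR (- y) * (1 + (y - D)) <= expR (- D).
  have -> : expR (- D) = expR (- y) * expR (y - D).
    by rewrite -expRD; congr expR; ring.
  by rewrite ler_pM2l // expR_ge1Dx.
(* Jensen's inequality for exp with weights [1 / (1 + B)] and [B / (1 + B)]: [- y] is the mean of
   [0] and [- D], so the linear terms of the two tangent bounds cancel. *)
have key : expR (- y) * (1 + B) <= 1 + expR (- D) * B.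
  have h := lerD t0 (ler_wpM2r B0 tD); apply: le_trans h.
  have -> : expR (- y) * (1 + y) + expR (- y) * (1 + (y - D)) * B =
    expR (- y) * ((1 + B) + ((1 + B) * y - B * D)) by ring.
  have -> : (1 + B) * y - B * D = 0 by rewrite /y; field; rewrite gt_eqF.
  by rewrite addr0.
have := ler_wpM2l (ltW ey0) key.
by rewrite mulrA [expR y * _]mulrC ey mul1r.
Qed.

Lemma ln1D_le (R : realType) (x : R) : 0 <= x -> ln (1 + x) <= x.
Proof.
move=> x0; rewrite -[leRHS]expRK ler_ln ?posrE ?expR_gt0 ?expR_ge1Dx //; lra.
Qed.

Lemma ln_diff_le (R : realType) (x x' e : R) : 0 <= x -> 0 <= x' -> 0 <= e ->
  x <= x' + e -> ln (1 + x) - ln (1 + x') <= e.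
Proof.
move=> x0 x'0 e0 le_x.
rewrite -ln_div ?posrE; try lra.
rewrite -[leRHS]expRK ler_ln ?posrE ?expR_gt0 ?divr_gt0 //; try lra.
rewrite ler_pdivrMr; last lra.
apply: (@le_trans _ _ (1 + x' + e)); first lra.
have h := expR_ge1Dx e.
have : (1 + e) * (1 + x') <= expR e * (1 + x') by rewrite ler_wpM2r //; lra.
have : 0 <= e * x' by rewrite mulr_ge0.
lra.
Qed.

Section Matching.
Context {R : realType} {V : finType}.
Variables (lam : V -> V -> R) (Z : {set V} -> R).
Hypothesis lam_ge0 : forall u v, 0 <= lam u v.
Hypothesis Z_gt0 : forall H, 0 < Z H.
Hypothesis Z_rec : forall (H : {set V}) v, v \in H ->
  Z H = Z (H :\ v) + \sum_(u in H :\ v) lam v u * Z (H :\ v :\ u).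

Definition unmatched (H : {set V}) v : R := Z (H :\ v) / Z H.

Lemma unmatched_gt0 H v : 0 < unmatched H v.
Proof. by rewrite divr_gt0. Qed.

Lemma unmatchedE (H : {set V}) v : v \in H ->
  unmatched H v = (1 + \sum_(u in H :\ v) lam v u * unmatched (H :\ v) u)^-1.
Proof.
move=> vH; rewrite /unmatched.
have -> : 1 + \sum_(u in H :\ v) lam v u * (Z (H :\ v :\ u) / Z (H :\ v)) =
  Z H / Z (H :\ v).
  rewrite (Z_rec vH) mulrDl divff ?gt_eqF // mulr_suml.
  by congr (_ + _); apply: eq_bigr => u _; rewrite mulrA.
by rewrite invf_div.
Qed.

Lemma sum_unmatched_ge0 (H H' : {set V}) (p : pred V) v :
  0 <= \sum_(u in H | p u) lam v u * unmatched H' u.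
Proof. by apply: sumr_ge0 => u _; rewrite mulr_ge0 // ltW // unmatched_gt0. Qed.

Lemma unmatched_le1 (H : {set V}) v : v \in H -> unmatched H v <= 1.
Proof.
move=> vH; rewrite unmatchedE // invf_le1; last first.
  by rewrite ltr_pwDl ?sumr_ge0 // => u _; rewrite mulr_ge0 // ltW // unmatched_gt0.
by rewrite lerDl sumr_ge0 // => u _; rewrite mulr_ge0 // ltW // unmatched_gt0.
Qed.

Lemma ln_unmatched_le0 (H : {set V}) v : v \in H -> ln (unmatched H v) <= 0.
Proof. by move=> vH; rewrite ln_le0 // unmatched_le1. Qed.

Lemma ln_unmatched_ge (H : {set V}) v b : v \in H ->
  \sum_u lam v u <= b -> - b <= ln (unmatched H v).
Proof.
move=> vH hb.
have s0 : 0 <= \sum_(u in H :\ v) lam v u * unmatched (H :\ v) u.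
  by rewrite sumr_ge0 // => u _; rewrite mulr_ge0 // ltW // unmatched_gt0.
rewrite unmatchedE // lnV ?posrE; last by lra.
rewrite lerN2 (le_trans (ln1D_le s0)) // (le_trans _ hb) //.
rewrite [leRHS](bigID (mem (H :\ v))) /= -[leLHS]addr0 lerD //.
  by apply: ler_sum => u uH; rewrite ler_piMr // unmatched_le1.
by rewrite sumr_ge0.
Qed.

Section Decay.
Variables (W : {set V}) (near : rel V).

Definition discrepancy (H : {set V}) v : R :=
  `|ln (unmatched H v) - ln (unmatched (H :&: W) v)|.

(** Near neighbours of [v] lie in [W], so the two recursions sum over the same near vertices and the
    contraction applies to them. Dropping the far terms costs at most [e] in each of the two
    logarithms, whence [2 * e]. *)
Lemma discrepancy_step (H : {set V}) v (B D e : R) : v \in H -> v \in W ->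
  (forall u, near v u -> u \in W) ->
  \sum_(u | near v u) lam v u <= B ->
  \sum_(u | ~~ near v u) lam v u <= e ->
  0 <= D ->
  (forall u, u \in H :\ v -> near v u -> discrepancy (H :\ v) u <= D) ->
  discrepancy H v <= B / (1 + B) * D + 2 * e.
Proof.
move=> vH vW nearW leB lee D0 hD.
have vHW : v \in H :&: W by rewrite inE vH.
have B0 : 0 <= B by apply: le_trans leB; rewrite sumr_ge0.
have e0 : 0 <= e by apply: le_trans lee; rewrite sumr_ge0.
have HWv : (H :&: W) :\ v = (H :\ v) :&: W by rewrite finset.setIDAC.
pose S (K : {set V}) := \sum_(u in K) lam v u * unmatched K u.
pose N (K : {set V}) := \sum_(u in K | near v u) lam v u * unmatched K u.
have N0 K : 0 <= N K by apply: sum_unmatched_ge0.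
have S0 K : 0 <= S K.
  by rewrite sumr_ge0 // => u _; rewrite mulr_ge0 // ltW // unmatched_gt0.
have NS K : N K <= S K.
  by rewrite /S (bigID (near v)) /= lerDl sum_unmatched_ge0.
have SN K : S K <= N K + e.
  rewrite /S (bigID (near v)) /= lerD2l (le_trans _ lee) //.
  rewrite [leRHS](bigID (mem K)) /= -[leLHS]addr0 lerD ?sumr_ge0 //.
  rewrite [leLHS](eq_bigl (fun u => ~~ near v u && (u \in K))); last first.
    by move=> u; rewrite andbC.
  by apply: ler_sum => u /andP[_ uK]; rewrite ler_piMr // unmatched_le1.
have NB K : N K <= B.
  apply: le_trans leB; rewrite [leRHS](bigID (mem K)) /= -[leLHS]addr0 lerD ?sumr_ge0 //.
  rewrite [leLHS](eq_bigl (fun u => near v u && (u \in K))); last first.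
    by move=> u; rewrite andbC.
  by apply: ler_sum => u /andP[_ uK]; rewrite ler_piMr // unmatched_le1.
(* The contraction is applied with the actual near sum [a]; as [t / (1 + t)] increases with [t], the
   rate at [a] is at most the rate at [B]. *)
have mono (a b : R) : 0 <= a -> a <= B -> expR (- D) * a <= b ->
    ln (1 + a) - ln (1 + b) <= B / (1 + B) * D.
  move=> a0 aB ab.
  have ea0 : 0 <= expR (- D) * a by rewrite mulr_ge0 // ltW // expR_gt0.
  have b0 : 0 <= b by apply: le_trans ab.
  have h := contraction_ln a0 D0.
  rewrite -ln_div ?posrE; try lra.
  apply: (@le_trans _ _ (a / (1 + a) * D)).
    rewrite -[leRHS]expRK ler_ln ?posrE ?expR_gt0 ?divr_gt0 //; try lra.
    apply: le_trans h; rewrite ler_wpM2l //; first by lra.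
    by rewrite lef_pV2 ?posrE; lra.
  rewrite ler_wpM2r // ler_pdivrMr; last by lra.
  rewrite mulrAC ler_pdivlMr; lra.
have dW u : u \in H :\ v -> near v u ->
    (expR (- D) * unmatched (H :\ v) u <= unmatched ((H :\ v) :&: W) u) /\
    (expR (- D) * unmatched ((H :\ v) :&: W) u <= unmatched (H :\ v) u).
  move=> uH nu; have := hD _ uH nu; rewrite /discrepancy ler_norml => /andP[h1 h2].
  have lnE K : unmatched K u = expR (ln (unmatched K u)).
    by rewrite lnK // posrE unmatched_gt0.
  rewrite (lnE (H :\ v)) (lnE ((H :\ v) :&: W)) -!expRD !ler_expR; split; lra.
have NW : N ((H :\ v) :&: W) =
    \sum_(u in H :\ v | near v u) lam v u * unmatched ((H :\ v) :&: W) u.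
  apply: eq_bigl => u; rewrite finset.in_setI.
  by case nu : (near v u); rewrite ?andbF // (nearW _ nu) andbT.
have dN1 : expR (- D) * N (H :\ v) <= N ((H :\ v) :&: W).
  rewrite NW /N mulr_sumr; apply: ler_sum => u /andP[uH nu].
  by rewrite mulrCA ler_wpM2l // (dW u uH nu).1.
have dN2 : expR (- D) * N ((H :\ v) :&: W) <= N (H :\ v).
  rewrite NW /N mulr_sumr; apply: ler_sum => u /andP[uH nu].
  by rewrite mulrCA ler_wpM2l // (dW u uH nu).2.
have m1 := mono _ _ (N0 _) (NB _) dN1.
have m2 := mono _ _ (N0 _) (NB _) dN2.
have l1 K : ln (1 + S K) - ln (1 + N K) <= e by apply: ln_diff_le.
have l2 K : 0 <= ln (1 + S K) - ln (1 + N K).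
  rewrite subr_ge0 ler_ln ?posrE; have := NS K; have := N0 K; lra.
have l11 := l1 (H :\ v); have l12 := l1 ((H :\ v) :&: W).
have l21 := l2 (H :\ v); have l22 := l2 ((H :\ v) :&: W).
have c0 : 0 <= B / (1 + B) * D by rewrite mulr_ge0 // divr_ge0 //; lra.
rewrite /discrepancy !unmatchedE // HWv.
rewrite -/(S (H :\ v)) -/(S ((H :\ v) :&: W)).
have S1 := S0 (H :\ v); have S2 := S0 ((H :\ v) :&: W).
rewrite !lnV ?posrE; try lra.
rewrite ler_norml; apply/andP; split; lra.
Qed.

End Decay.
End Matching.

(** * Decay of correlations across shells *)

(** The distance of [k] and [l]: by truncated subtraction one of the summands vanishes. *)
Definition ndist (k l : nat) : nat := (k - l) + (l - k).

Section Shells.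
Context {R : realType} {V : finType}.
Variables (lam : V -> V -> R) (Z : {set V} -> R).
Hypothesis lam_ge0 : forall u v, 0 <= lam u v.
Hypothesis Z_gt0 : forall H, 0 < Z H.
Hypothesis Z_rec : forall (H : {set V}) v, v \in H ->
  Z H = Z (H :\ v) + \sum_(u in H :\ v) lam v u * Z (H :\ v :\ u).
Variables (pos : V -> nat) (c : R).
Hypothesis lam_le : forall u v,
  lam u v <= c * expR (- (ndist (pos u) (pos v))%:R).
Variables (q : nat) (v0 : V).
Hypothesis q_ge2 : (2 <= q)%N.
Hypothesis crowd_le :
  \sum_v expR (- ((ndist (pos v0) (pos v))%:R / (q ^ 4)%:R)) <= q%:R ^+ 5 :> R.
Variable W : {set V}.
Hypothesis ball_W : forall v, (ndist (pos v0) (pos v) <= q ^ 4)%N -> v \in W.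

Let d u v := ndist (pos u) (pos v).
Let near : rel V := fun u v => (d u v <= q)%N.
Let shell v := (d v0 v %/ q)%N.
(** The outermost shell used. The [- 2] leaves a margin: a vertex of shell at most [J] and all its
    near neighbours are within [q^4] of [v0], hence in [W]. *)
Let J := (q ^ 3 - 2)%N.
Let T : R := q%:R ^+ 5.

Let c_ge0 : 0 <= c.
Proof.
have := le_trans (lam_ge0 v0 v0) (lam_le v0 v0).
by rewrite pmulr_lge0 // expR_gt0.
Qed.

Let m_gt0 : 0 < (q ^ 4)%:R :> R.
Proof. by rewrite ltr0n expn_gt0; lia. Qed.

(** Moving the centre by at most [q^4] changes each exponent by at most 1, by the triangle
    inequality. *)
Lemma crowd_shift u : (d v0 u <= q ^ 4)%N ->
  \sum_v expR (- ((d u v)%:R / (q ^ 4)%:R)) <= expR 1 * T.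
Proof.
move=> hu; apply: (le_trans _ (ler_wpM2l (expR_ge0 1) crowd_le)).
rewrite mulr_sumr; apply: ler_sum => v _; rewrite -expRD ler_expR.
have : (d v0 v)%:R / (q ^ 4)%:R <= 1 + (d u v)%:R / (q ^ 4)%:R :> R.
  rewrite -[X in X + _](divff (lt0r_neq0 m_gt0)) -mulrDl ler_wpM2r ?invr_ge0 //.
  by rewrite -natrD ler_nat; move: hu; rewrite /d /ndist; lia.
by rewrite /d; lra.
Qed.

Lemma shell_ball v : (shell v <= J)%N -> (d v0 v + q <= q ^ 4)%N.
Proof.
rewrite /shell /J => h.
have q0 : (0 < q)%N by lia.
have e4 : (q ^ 4 = q ^ 3 * q)%N by rewrite -expnSr.
have q3 : (2 <= q ^ 3)%N by rewrite (leq_trans q_ge2) // -{1}(expn1 q) leq_pexp2l.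
have := ltn_ceil (d v0 v) q0; move: h q3; rewrite e4.
by move: (d v0 v %/ q)%N (q ^ 3)%N => s t; nia.
Qed.

Lemma shell_ballW v : (shell v <= J)%N -> (d v0 v <= q ^ 4)%N.
Proof. by move/shell_ball; apply: leq_trans; rewrite leq_addr. Qed.

Lemma activity_le u : (d v0 u <= q ^ 4)%N ->
  \sum_v lam u v <= c * (expR 1 * T).
Proof.
move=> hu; apply: (le_trans _ (ler_wpM2l c_ge0 (crowd_shift hu))).
rewrite mulr_sumr; apply: ler_sum => v _; apply: le_trans (lam_le u v) _.
rewrite ler_wpM2l // ler_expR lerN2 ler_pdivrMr // ler_peMr // ler1n expn_gt0.
by lia.
Qed.

Let far_bound : R := c * (expR 1 * T) * expR (- (q%:R / 2)).

(** Half of the distance, more than [q / 2], pays for the small factor; the other half is compared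
    with the crowding kernel, as [q^4] is at least 2. *)
Lemma far_activity_le u : (d v0 u <= q ^ 4)%N ->
  \sum_(v | ~~ near u v) lam u v <= far_bound.
Proof.
move=> hu; rewrite /far_bound mulrAC.
have ce : 0 <= c * expR (- (q%:R / 2)) by rewrite mulr_ge0 // expR_ge0.
apply: (le_trans _ (ler_wpM2l ce (crowd_shift hu))).
rewrite mulr_sumr [leRHS](bigID (near u)) /= -[leLHS]add0r lerD //.
  by rewrite sumr_ge0 // => v _; rewrite mulr_ge0 // expR_ge0.
apply: ler_sum => v; rewrite /near -ltnNge => far; apply: le_trans (lam_le u v) _.
rewrite -mulrA ler_wpM2l // -expRD ler_expR -/(d u v).
have h2 : (2 <= q ^ 4)%N.
  by apply: leq_trans q_ge2 _; rewrite -{1}(expn1 q) leq_pexp2l //; lia.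
have h3 : (d u v)%:R / (q ^ 4)%:R <= (d u v)%:R / 2 :> R.
  by rewrite ler_wpM2l // lef_pV2 ?posrE ?ltr0n // ?ler_nat //; lia.
have h4 : q%:R <= (d u v)%:R :> R by rewrite ler_nat ltnW.
by lra.
Qed.

(** Counts the shells [s - 1], [s] and [s + 1], which contain all near neighbours of a vertex of
    shell [s]. *)
Let crowd s : nat := #|[pred v | (s <= (shell v).+1)%N && (shell v <= s.+1)%N]|.
Let B s : R := c * (crowd s)%:R.
(** The contraction accumulated between shell [s] and shell [J]. *)
Let Psi s : R := \prod_(s <= t < J) (B t / (1 + B t)).

Let B_ge0 s : 0 <= B s. Proof. by rewrite mulr_ge0. Qed.

Lemma near_shell u v : near u v -> (shell v <= (shell u).+1)%N.
Proof.
rewrite /near /shell => h.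
have q0 : (0 < q)%N by lia.
have -> : ((d v0 u %/ q).+1 = (d v0 u + q) %/ q)%N.
  by rewrite divnDr ?dvdnn // divnn q0 addn1.
apply: leq_div2r.
by move: h; rewrite /d /ndist; lia.
Qed.

Lemma near_activity_le u : \sum_(v | near u v) lam u v <= B (shell u).
Proof.
apply: (@le_trans _ _ (\sum_(v | near u v) c)).
  apply: ler_sum => v _; apply: le_trans (lam_le u v) _.
  by rewrite ler_piMr // -expR0 ler_expR oppr_le0.
rewrite sumr_const -mulr_natr ler_wpM2l // ler_nat.
apply: subset_leq_card; apply/fintype.subsetP => v nuv; rewrite !inE.
apply/andP; split; last exact: near_shell.
by apply: near_shell; move: nuv; rewrite /near /d /ndist; lia.
Qed.

Lemma Psi_le s t : (s <= t)%N -> Psi s <= Psi t.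
Proof.
move=> st; rewrite /Psi; case: (leqP t J) => tJ; last first.
  rewrite [leRHS]big_geq ?(ltnW tJ) // prodr_ile1 // => i.
  have := B_ge0 i => b0; rewrite divr_ge0 ?addr_ge0 //= ler_pdivrMr; lra.
rewrite (big_cat_nat (n := t)) //= ler_piMl //.
  by rewrite prodr_ge0 // => i _; rewrite divr_ge0 ?addr_ge0.
rewrite prodr_ile1 // => i.
have := B_ge0 i => b0; rewrite divr_ge0 ?addr_ge0 //= ler_pdivrMr; lra.
Qed.

Lemma Psi_step s : (s < J)%N -> Psi s = B s / (1 + B s) * Psi s.+1.
Proof. by move=> sJ; rewrite /Psi big_ltn. Qed.

Lemma Psi_ge0 s : 0 <= Psi s.
Proof. by rewrite prodr_ge0 // => i _; rewrite divr_ge0 ?addr_ge0. Qed.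

Let core : {set V} := [set v | (shell v < J)%N].

Lemma far_bound_ge0 : 0 <= far_bound.
Proof. by rewrite !mulr_ge0 ?expR_ge0 // exprn_ge0. Qed.

(* Each step of the recursion removes a vertex, so the far activities it
   collects add up to at most one far_bound per core vertex. *)
Lemma discrepancy_shell (H : {set V}) v : v \in H -> (shell v <= J)%N ->
  discrepancy Z W H v <=
    c * (expR 1 * T) * Psi (shell v) + 2 * far_bound *+ #|H :&: core|.
Proof.
have [N] := ubnP #|H|; elim: N H v => // N IH H v cardH vH.
have act0 : 0 <= c * (expR 1 * T) by rewrite !mulr_ge0 ?expR_ge0 // exprn_ge0.
have far0 := far_bound_ge0.
(* In shell [J] the recursion stops: both logarithms lie between minus the total activity and 0, so
   their difference is at most that activity, and [Psi J = 1]. *)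
rewrite leq_eqVlt => /orP[/eqP sJ|sJ].
  have vb : (d v0 v <= q ^ 4)%N by apply: shell_ballW; rewrite sJ.
  have vW := ball_W vb.
  have act := activity_le vb.
  have vHW : v \in H :&: W by rewrite finset.in_setI vH.
  have b1 := ln_unmatched_ge lam_ge0 Z_gt0 Z_rec vH act.
  have b2 := ln_unmatched_ge lam_ge0 Z_gt0 Z_rec vHW act.
  have b3 := ln_unmatched_le0 lam_ge0 Z_gt0 Z_rec vH.
  have b4 := ln_unmatched_le0 lam_ge0 Z_gt0 Z_rec vHW.
  have p1 : Psi (shell v) = 1 by rewrite /Psi sJ big_geq.
  have s0 : 0 <= 2 * far_bound *+ #|H :&: core| by rewrite mulrn_wge0 // mulr_ge0.
  by rewrite p1 mulr1 /discrepancy ler_norml; apply/andP; split; lra.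
have vb := shell_ballW (ltnW sJ).
have vcore : v \in core by rewrite inE.
have cardE : #|H :&: core| = #|(H :\ v) :&: core|.+1.
  rewrite (cardsD1 v (H :&: core)) finset.in_setI vH vcore add1n; congr (_.+1).
  by congr #|pred_of_set _|; rewrite finset.setIDAC.
set e := 2 * far_bound *+ #|(H :\ v) :&: core|.
have e0 : 0 <= e by rewrite mulrn_wge0 // mulr_ge0.
set D := c * (expR 1 * T) * Psi (shell v).+1 + e.
have D0 : 0 <= D by rewrite addr_ge0 // mulr_ge0 // Psi_ge0.
have st : discrepancy Z W H v <=
    B (shell v) / (1 + B (shell v)) * D + 2 * far_bound.
  apply: (@discrepancy_step _ _ _ _ lam_ge0 Z_gt0 Z_rec W near _ _ _ _ _ vH
    (ball_W vb) _ _ _ D0) => [u nu|||u uH nu].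
  - apply: ball_W; apply: leq_trans (shell_ball (ltnW sJ)).
    by move: nu; rewrite /near /d /ndist; lia.
  - exact: near_activity_le.
  - exact: far_activity_le.
  apply: (@le_trans _ _ (c * (expR 1 * T) * Psi (shell u) + e)).
    apply: IH => //; last by apply: leq_trans (near_shell nu) _.
    by rewrite (cardsD1 v H) vH in cardH.
  (* A near neighbour may also lie further in; as [Psi] is non-decreasing, the next shell outwards
     is the worst case. *)
  by rewrite lerD2r ler_wpM2l // Psi_le // near_shell.
apply: le_trans st _; rewrite cardE (mulrSr (2 * far_bound)) Psi_step // -/e.
have b0 := B_ge0 (shell v).
have k1 : B (shell v) / (1 + B (shell v)) <= 1 by rewrite ler_pdivrMr; lra.
have := ler_wpM2r e0 k1; rewrite mul1r /D.
clear D D0; move: e e0 (Psi _.+1) (B _ / _) k1 => {}e e0 P k k1 ke.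
have -> : k * (c * (expR 1 * T) * P + e) = c * (expR 1 * T) * (k * P) + k * e by ring.
lra.
Qed.

Lemma ball_card : (#|[pred v | (d v0 v <= q ^ 4)%N]|)%:R <= expR 1 * T :> R.
Proof.
apply: (le_trans _ (ler_wpM2l (expR_ge0 1) crowd_le)).
rewrite mulr_sumr -sum1_card natr_sum big_mkcond /=.
apply: ler_sum => v _; rewrite inE; case: ifP => h; last first.
  by rewrite mulr_ge0 ?expR_ge0.
rewrite -expRD; apply: le_trans (expR_ge1Dx _); rewrite lerDl subr_ge0.
by rewrite ler_pdivrMr // mul1r ler_nat.
Qed.

Lemma sum_eq_le1 (n s : nat) : (\sum_(t < n) (t == s :> nat) <= 1)%N.
Proof.
rewrite -(big_mkord xpredT (fun t => (t == s : nat))).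
rewrite -big_mkcond /= sum1_count -/(count_mem s _) count_uniq_mem ?iota_uniq //.
by case: (_ \in _).
Qed.

(** A vertex is counted only for its own shell and the two adjacent ones, and for [t < J] this
    forces its shell to be at most [J], which puts it in the ball. *)
Lemma sum_crowd_le : (\sum_(t < J) crowd t <= 3 * #|[pred v | (d v0 v <= q ^ 4)%N]|)%N.
Proof.
have crE t : crowd t = (\sum_v ((t <= (shell v).+1)%N && (shell v <= t.+1)%N : nat))%N.
  rewrite /crowd -sum1_card big_mkcond /=; apply: eq_bigr => v _.
  by rewrite inE; case: (_ && _).
under eq_bigr do rewrite crE.
rewrite exchange_big /= -sum1_card big_distrr /= [leqRHS]big_mkcond /=.
apply: leq_sum => v _; rewrite inE; case: ifP => h.
  apply: (@leq_trans (\sum_(t < J) ((t == shell v :> nat) +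
    (t == (shell v).+1 :> nat) + (t == (shell v).-1 :> nat)))%N).
    apply: leq_sum => t _; move: (shell v) => s.
    case: andP => // -[h1 h2].
    case: eqVneq => [_|n1]; first by [].
    case: eqVneq => [_|n2]; first by [].
    by case: eqVneq => [_|n3] //; lia.
  rewrite !big_split /=.
  have h1 := sum_eq_le1 J (shell v); have h2 := sum_eq_le1 J (shell v).+1.
  have h3 := sum_eq_le1 J (shell v).-1.
  by rewrite muln1; move: h1 h2 h3; do 3![move: (\sum_(_ < _) _)%N => ?]; lia.
rewrite big1 // => t _.
have h' : ~ (shell v <= J)%N by move=> /shell_ballW; rewrite h.
by have := ltn_ord t; move: h'; move: (shell v) => s; lia.
Qed.

Let rate : R := (2 * (1 + 6 * c * expR 1))^-1.

(** Only the sum of the [crowd t] is controlled. Since [B / (1 + B) <= exp(- 1 / (1 + B))], it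
    suffices to bound the sum of the [1 / (1 + B t)] from below. The mean of the [1 + B t] is at
    most [mu], of order [q^2], so convexity of the inverse gives a sum of order [q^3 / q^2]. *)
Lemma Psi1_le : Psi 1 <= expR (- (rate * q%:R)).
Proof.
have e1 : 0 < expR 1 :> R by apply: expR_gt0.
have ce : 0 <= c * expR 1 by rewrite mulr_ge0 // ltW.
have q2 : 2 <= q%:R :> R by rewrite ler_nat.
(* Here [J - 2 = q^3 - 4], and [q^3 >= 8] makes this at least [q^3 / 2]. *)
have J_ge : q%:R ^+ 3 / 2 <= J%:R - 2 :> R.
  have q8 : (8 <= q ^ 3)%N by rewrite -[8%N]/(2 ^ 3)%N leq_exp2r.
  have : 8 <= (q ^ 3)%:R :> R by rewrite ler_nat.
  rewrite /J natrB; last by lia.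
  by rewrite natrX; lra.
have q3 : 0 < q%:R ^+ 3 :> R by rewrite exprn_gt0; lra.
have J0 : 0 < J%:R :> R by lra.
have Jpos : (0 < J)%N by rewrite -(ltr_nat R).
set mu : R := (1 + 6 * c * expR 1) * q%:R ^+ 2.
have mu0 : 0 < mu by rewrite mulr_gt0 ?exprn_gt0 //; lra.
have sumB : \sum_(t < J) (1 + B t) <= J%:R * mu.
  rewrite big_split /= sumr_const card_ord -mulr_sumr -natr_sum.
  have h : (\sum_(t < J) crowd t)%:R <= 3 * (expR 1 * T).
    apply: le_trans (_ : (3 * #|[pred v | (d v0 v <= q ^ 4)%N]|)%:R <= _).
      by rewrite ler_nat sum_crowd_le.
    by rewrite natrM ler_wpM2l // ball_card.
  have {}h := ler_wpM2l c_ge0 h; rewrite /mu mulrDl mul1r mulrDr.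
  apply: lerD.
    by rewrite ler_peMr // exprn_ege1 //; lra.
  apply: le_trans h _; rewrite /T.
  have -> : c * (3 * (expR 1 * q%:R ^+ 5)) =
    q%:R ^+ 3 / 2 * (6 * c * expR 1 * q%:R ^+ 2) by field.
  have : 0 <= 6 * c * expR 1 * q%:R ^+ 2 by rewrite !mulr_ge0 ?exprn_ge0 ?expR_ge0.
  by move=> /ler_wpM2r; apply; lra.
(* 1/x lies above its tangent at mu, hence the mean of 1/x is at least 1/mu *)
have sum_inv : (J%:R - 2) / mu <= \sum_(1 <= t < J) (1 + B t)^-1.
  have tang t : 2 / mu - (1 + B t) / mu ^+ 2 <= (1 + B t)^-1.
    have b1 : 0 < 1 + B t by have := B_ge0 t; lra.
    rewrite -subr_ge0.
    have -> : (1 + B t)^-1 - (2 / mu - (1 + B t) / mu ^+ 2) =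
      (1 + B t)^-1 * (1 - (1 + B t) / mu) ^+ 2.
      by field; rewrite !gt_eqF.
    by rewrite mulr_ge0 ?sqr_ge0 // invr_ge0 ltW.
  apply: le_trans (_ : \sum_(1 <= t < J) (2 / mu - (1 + B t) / mu ^+ 2) <= _); last first.
    by apply: ler_sum.
  rewrite big_split /= sumr_const_nat sumrN -mulr_suml.
  have : (\sum_(1 <= t < J) (1 + B t)) / mu ^+ 2 <= J%:R / mu.
    rewrite ler_pdivrMr ?exprn_gt0 //.
    have -> : J%:R / mu * mu ^+ 2 = J%:R * mu by field; rewrite gt_eqF.
    apply: le_trans sumB; rewrite -[leRHS](big_mkord xpredT (fun t => 1 + B t)).
    rewrite [leRHS]big_ltn //.
    by rewrite lerDr addr_ge0.
  have J1 : (J - 1)%:R = J%:R - 1 :> R by rewrite natrB.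
  rewrite -[_ *+ (J - 1)]mulr_natr J1.
  have mui : 0 < mu^-1 by rewrite invr_gt0.
  rewrite [2 / mu * _]mulrBr mulr1 mulrBl [2 / mu * _]mulrAC -[2 * _ / _]mulrA; lra.
have Jmu : rate * q%:R <= (J%:R - 2) / mu.
  rewrite ler_pdivlMr // /rate /mu.
  have -> : (2 * (1 + 6 * c * expR 1))^-1 * q%:R *
    ((1 + 6 * c * expR 1) * q%:R ^+ 2) = q%:R ^+ 3 / 2.
    by field; rewrite gt_eqF //; lra.
  done.
apply: le_trans (_ : expR (- \sum_(1 <= t < J) (1 + B t)^-1) <= _); last first.
  by rewrite ler_expR lerN2; lra.
rewrite /Psi -sumrN expR_sum; apply: ler_prod => t _.
have b0 := B_ge0 t; rewrite divr_ge0 //=; last by lra.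
have -> : B t / (1 + B t) = 1 + - (1 + B t)^-1 by field; rewrite gt_eqF; lra.
exact: expR_ge1Dx.
Qed.

(** The bound of [discrepancy_shell] in shell at most 1, with [Psi 1] replaced by its exponential
    bound and the number of core vertices by the bound [expR 1 * T] on the size of the ball. *)
Definition discrepancy_bound : R :=
  c * (expR 1 * T) * expR (- (rate * q%:R)) + 2 * far_bound * (expR 1 * T).

(** Not restricted to [v = v0]: the probability that [v0] is matched to a near vertex also involves
    the unmatched probability of that vertex. *)
Lemma discrepancy_near (H : {set V}) v : v \in H ->
  (ndist (pos v0) (pos v) <= q)%N -> discrepancy Z W H v <= discrepancy_bound.
Proof.
move=> vH vnear.
have s1 : (shell v <= 1)%N.
  by rewrite /shell -ltnS ltn_divLR; move: vnear; rewrite /d; lia.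
have J1 : (1 <= J)%N.
  have : (2 ^ 3 <= q ^ 3)%N by rewrite leq_exp2r.
  by rewrite /J; lia.
have act0 : 0 <= c * (expR 1 * T) by rewrite !mulr_ge0 ?expR_ge0 // exprn_ge0.
apply: le_trans (discrepancy_shell vH (leq_trans s1 J1)) _; apply: lerD.
  by rewrite ler_wpM2l // (le_trans (Psi_le s1)) // Psi1_le.
rewrite -mulr_natr ler_wpM2l ?mulr_ge0 ?far_bound_ge0 //.
apply: le_trans ball_card; rewrite ler_nat; apply: subset_leq_card.
apply/fintype.subsetP => u; rewrite !inE => /andP[_ uJ].
by apply: shell_ballW; exact: ltnW.
Qed.

End Shells.

(** * Partial bijections and the posterior *)

Section PartialBijections.
Context {R : realType} {a b : nat}.
Variable act : 'I_a -> 'I_b -> R.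

Definition matching_weight (pi : {ffun 'I_a -> option 'I_b}) : R :=
  \prod_i oapp (act i) 1 (pi i).

Definition matching_sum (S : {set 'I_a}) (T : {set 'I_b}) : R :=
  \sum_(pi in partial_bijections S T) matching_weight pi.

Lemma partial_bijectionsP (S : {set 'I_a}) (T : {set 'I_b})
    (pi : {ffun 'I_a -> option 'I_b}) :
  reflect ((forall i j, pi i = Some j -> i \in S /\ j \in T) /\
           (forall i i' j, pi i = Some j -> pi i' = Some j -> i = i'))
    (pi \in partial_bijections S T).
Proof.
rewrite inE; apply: (iffP andP) => -[h1 h2]; split.
- move=> i j ij; move/forallP: h1 => /(_ i) /forallP /(_ j).
  by rewrite ij eqxx /= => /andP.
- move=> i i' j ij i'j; move/forallP: h2 => /(_ i) /forallP /(_ i').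
  by rewrite ij i'j eqxx /= => /eqP.
- apply/forallP => i; apply/forallP => j; apply/implyP => /eqP ij.
  by apply/andP; apply: h1.
apply/forallP => i; apply/forallP => i'; apply/implyP => /andP[].
case ij : (pi i) => [j|//] _ /eqP /esym i'j; apply/eqP; exact: h2 ij i'j.
Qed.

Let unset (i : 'I_a) (pi : {ffun 'I_a -> option 'I_b}) :
    {ffun 'I_a -> option 'I_b} := [ffun k => if k == i then None else pi k].
Let set_to (i : 'I_a) (j : 'I_b) (pi : {ffun 'I_a -> option 'I_b}) :
    {ffun 'I_a -> option 'I_b} := [ffun k => if k == i then Some j else pi k].

Lemma matching_sum_None (S : {set 'I_a}) (T : {set 'I_b}) i : i \in S ->
  \sum_(pi in partial_bijections S T | pi i == None) matching_weight pi =
  matching_sum (S :\ i) T.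
Proof.
move=> iS; apply: eq_bigl => pi; apply/andP/partial_bijectionsP.
  move=> [/partial_bijectionsP[h1 h2] /eqP iN]; split=> // k j kj.
  have [kS jT] := h1 _ _ kj; split=> //; rewrite !inE kS andbT.
  by apply/eqP => ki; rewrite ki iN in kj.
move=> [h1 h2]; split.
  apply/partial_bijectionsP; split=> // k j kj.
  by have [] := h1 _ _ kj; rewrite !inE => /andP[].
case ij : (pi i) => [j|//].
by have [] := h1 _ _ ij; rewrite !inE eqxx.
Qed.

Lemma matching_sum_Some (S : {set 'I_a}) (T : {set 'I_b}) i j :
  i \in S -> j \in T ->
  \sum_(pi in partial_bijections S T | pi i == Some j) matching_weight pi =
  act i j * matching_sum (S :\ i) (T :\ j).
Proof.
move=> iS jT; rewrite (reindex_onto (set_to i j) (unset i)); last first.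
  move=> pi /andP[_ /eqP ij]; apply/ffunP => k; rewrite !ffunE.
  by case: eqP => // ->.
rewrite /matching_sum mulr_sumr; apply: eq_big => [pi|pi].
  apply/andP/partial_bijectionsP.
    move=> [/andP[/partial_bijectionsP[h1 h2] _] /eqP piE].
    have piN : pi i = None by rewrite -piE !ffunE eqxx.
    have ne k l : pi k = Some l -> k != i.
      by move=> kl; apply/eqP => ki; rewrite ki piN in kl.
    have up k l : pi k = Some l -> set_to i j pi k = Some l.
      by move=> kl; rewrite ffunE (negbTE (ne _ _ kl)).
    have upi : set_to i j pi i = Some j by rewrite ffunE eqxx.
    split=> [k l kl|k k' l kl k'l]; last exact: h2 (up _ _ kl) (up _ _ k'l).
    have [kS lT] := h1 _ _ (up _ _ kl); rewrite !inE kS lT (ne _ _ kl); split=> //.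
    rewrite andbT; apply/eqP => lj; rewrite {}lj in kl.
    by have := ne _ _ kl; rewrite (h2 _ _ _ (up _ _ kl) upi) eqxx.
  move=> [h1 h2].
  have piN : pi i = None.
    case il : (pi i) => [l|//].
    by have [] := h1 _ _ il; rewrite !inE eqxx.
  split; last first.
    by apply/eqP/ffunP => k; rewrite !ffunE; case: eqP => [->|//].
  rewrite ffunE !eqxx andbT; apply/partial_bijectionsP; split.
    move=> k l; rewrite ffunE; case: eqP => [-> [<-] //|_ kl].
    by have [] := h1 _ _ kl; rewrite !inE => /andP[_ ->] /andP[_ ->].
  move=> k k' l; rewrite !ffunE.
  case: eqP => [->|_]; case: eqP => [->|_] //; last exact: h2.
    by move=> [<-] /h1[_]; rewrite !inE eqxx.
  by move=> + [lj]; rewrite -lj => /h1[_]; rewrite !inE eqxx.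
move=> /andP[_ /eqP piE].
have piN : pi i = None by rewrite -piE !ffunE eqxx.
rewrite /matching_weight (bigD1 i) //= [in RHS](bigD1 i) //= piN mul1r ffunE eqxx /=.
by congr (_ * _); apply: eq_bigr => k ki; rewrite ffunE (negbTE ki).
Qed.

Lemma matching_sum_notin (S : {set 'I_a}) (T : {set 'I_b}) i j (F : _ -> R) :
  j \notin T -> \sum_(pi in partial_bijections S T | pi i == Some j) F pi = 0.
Proof.
move=> jT; rewrite big_pred0 // => pi; apply/negP.
move=> /andP[/partial_bijectionsP[h1 _] /eqP ij].
by have [_] := h1 _ _ ij; rewrite (negbTE jT).
Qed.

Lemma matching_sum_recX (S : {set 'I_a}) (T : {set 'I_b}) i : i \in S ->
  matching_sum S T = matching_sum (S :\ i) T +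
    \sum_(j in T) act i j * matching_sum (S :\ i) (T :\ j).
Proof.
move=> iS; rewrite {1}/matching_sum.
rewrite (partition_big (fun pi : {ffun 'I_a -> option 'I_b} => pi i) xpredT) //=.
rewrite (bigID (fun o => o == None)) /= big_pred1_eq matching_sum_None //.
congr (_ + _); rewrite (reindex_omap Some id); last by case.
rewrite [LHS](bigID (mem T)) /= [X in _ + X]big1 ?addr0; last first.
  by move=> j /andP[_ jT]; exact: matching_sum_notin.
by apply: eq_big => [j|j /andP[_ jT]]; rewrite ?eqxx // matching_sum_Some.
Qed.

Lemma matching_sum_set0 (T : {set 'I_b}) : matching_sum finset.set0 T = 1.
Proof.
rewrite /matching_sum (big_pred1 [ffun=> None]); last first.
  move=> pi; apply/partial_bijectionsP/eqP => [[h1 _]|->].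
    apply/ffunP => i; rewrite ffunE; case ij : (pi i) => [j|//].
    by have [] := h1 _ _ ij; rewrite inE.
  by split=> [i j|i i' j]; rewrite !ffunE.
by rewrite /matching_weight big1 // => i _; rewrite ffunE.
Qed.

(** Matchings are encoded as functions on the left side, so a right vertex cannot be conditioned on
    directly. Induction on [#|S|] instead: both sides are expanded at a left vertex [i], and the
    double sums over two disjoint edges at [i] and [j] agree. *)
Lemma matching_sum_recY (S : {set 'I_a}) (T : {set 'I_b}) j : j \in T ->
  matching_sum S T = matching_sum S (T :\ j) +
    \sum_(i in S) act i j * matching_sum (S :\ i) (T :\ j).
Proof.
have [N] := ubnP #|S|; elim: N S T j => // N IH S T j cS jT.
have [->|[i iS]] := set_0Vmem S.
  by rewrite !matching_sum_set0 big1 ?addr0 // => i; rewrite inE.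
have cSi : (#|S :\ i| < N)%N by rewrite (cardsD1 i S) iS in cS.
have jTne j' : j' \in T :\ j -> j \in T :\ j' by rewrite !inE jT andbT eq_sym => /andP[].
have comD (U : finType) (A : {set U}) x y : A :\ x :\ y = A :\ y :\ x.
  by rewrite !finset.setDDl [_ :|: _]finset.setUC.
rewrite (matching_sum_recX _ iS) (IH _ _ _ cSi jT) (big_setD1 j) //=.
rewrite (eq_bigr (fun j' => act i j' * matching_sum (S :\ i) (T :\ j :\ j') +
   \sum_(i' in S :\ i) act i' j * (act i j' * matching_sum (S :\ i :\ i') (T :\ j :\ j'))));
  last first.
  move=> j' j'T; rewrite (IH _ _ _ cSi (jTne _ j'T)) mulrDr (comD _ T j' j) mulr_sumr.
  by congr (_ + _); apply: eq_bigr => i' _; rewrite mulrCA.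
rewrite big_split /= (matching_sum_recX _ iS) [in RHS](big_setD1 i) //=.
rewrite [in RHS](eq_bigr (fun i' => act i' j * matching_sum (S :\ i :\ i') (T :\ j) +
   \sum_(j' in T :\ j) act i' j * (act i j' * matching_sum (S :\ i :\ i') (T :\ j :\ j'))));
  last first.
  move=> i' i'S; rewrite (@matching_sum_recX _ _ i); last first.
    by move: i'S; rewrite !inE eq_sym iS => /andP[-> _].
  by rewrite mulrDr mulr_sumr (comD _ S i' i).
rewrite big_split /= [in RHS]exchange_big /=; ring.
Qed.

Hypothesis act_ge0 : forall i j, 0 <= act i j.

Lemma matching_weight_ge0 pi : 0 <= matching_weight pi.
Proof. by apply: prodr_ge0 => i _; case: (pi i) => [j|] /=. Qed.

Lemma matching_sum_gt0 S T : 0 < matching_sum S T.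
Proof.
have N0 : [ffun=> None] \in partial_bijections S T.
  by apply/partial_bijectionsP; split=> [i j|i i' j]; rewrite !ffunE.
rewrite /matching_sum (bigD1 _ N0) /= ltr_pwDl //.
  by rewrite /matching_weight big1 // => i _; rewrite ffunE.
by apply: sumr_ge0 => pi _; exact: matching_weight_ge0.
Qed.

(** The bipartite structure becomes a vanishing activity between points of the same side, so that
    the recursion on a single vertex set applies. *)
Definition activity (u v : 'I_a + 'I_b) : R :=
  match u, v with
  | inl i, inr j | inr j, inl i => act i j
  | _, _ => 0
  end.

Definition leftset (H : {set 'I_a + 'I_b}) : {set 'I_a} := [set i | inl i \in H]%SET.
Definition rightset (H : {set 'I_a + 'I_b}) : {set 'I_b} := [set j | inr j \in H]%SET.
Definition vertex_sum (H : {set 'I_a + 'I_b}) : R :=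
  matching_sum (leftset H) (rightset H).

Lemma leftset_l H i : leftset (H :\ inl i) = leftset H :\ i.
Proof. by apply/finset.setP => k; rewrite !inE. Qed.
Lemma rightset_l H i : rightset (H :\ inl i) = rightset H.
Proof. by apply/finset.setP => k; rewrite !inE. Qed.
Lemma leftset_r H j : leftset (H :\ inr j) = leftset H.
Proof. by apply/finset.setP => k; rewrite !inE. Qed.
Lemma rightset_r H j : rightset (H :\ inr j) = rightset H :\ j.
Proof. by apply/finset.setP => k; rewrite !inE. Qed.
Definition side_setE := (leftset_l, rightset_l, leftset_r, rightset_r).

Lemma activity_ge0 u v : 0 <= activity u v.
Proof. by case: u v => [i|j] [k|l] /=. Qed.

Lemma vertex_sum_gt0 H : 0 < vertex_sum H.
Proof. exact: matching_sum_gt0. Qed.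

Lemma vertex_sum_rec (H : {set 'I_a + 'I_b}) v : v \in H ->
  vertex_sum H = vertex_sum (H :\ v) +
    \sum_(u in H :\ v) activity v u * vertex_sum (H :\ v :\ u).
Proof.
case: v => [i|j] vH; rewrite /vertex_sum !side_setE big_sumType /=.
  rewrite [X in _ + (X + _)]big1 ?add0r; last by move=> k _; rewrite mul0r.
  rewrite (@matching_sum_recX _ _ i) ?inE //; congr (_ + _).
  by apply: eq_big => [j|j _]; rewrite ?inE ?side_setE.
rewrite [X in _ + (_ + X)]big1 ?addr0; last by move=> k _; rewrite mul0r.
rewrite (@matching_sum_recY _ _ j) ?inE //; congr (_ + _).
by apply: eq_big => [i|i _]; rewrite ?inE ?side_setE.
Qed.

End PartialBijections.

(** * Comparison of the full marginal with the marginal in a window *)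

Lemma ln_dist_diff (R : realType) (u u' D : R) : 0 < u -> 0 < u' ->
  `|ln u - ln u'| <= D -> `|u - u'| <= (expR D - 1) * u'.
Proof.
move=> u0 u'0; rewrite !ler_norml => /andP[h1 h2].
have e0 := expR_gt0 D.
have ub : u <= expR D * u'.
  rewrite -[u]lnK ?posrE // -[u' in leRHS]lnK ?posrE // -expRD ler_expR; lra.
have lb : expR (- D) * u' <= u.
  rewrite -[u]lnK ?posrE // -[u' in leLHS]lnK ?posrE // -expRD ler_expR; lra.
apply/andP; split; last by lra.
(* The lower bound reduces to [2 - t <= 1 / t] at [t = exp D]. *)
suff : (2 - expR D) * u' <= expR (- D) * u' by lra.
rewrite (ler_wpM2r (ltW u'0)) // expRN -subr_ge0.
have -> : (expR D)^-1 - (2 - expR D) = (expR D - 1) ^+ 2 / expR D.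
  by field; rewrite gt_eqF.
by rewrite divr_ge0 ?sqr_ge0 // ltW.
Qed.

Lemma TV_le1 (R : realType) (I : finType) (P Q : I -> R) :
  (forall o, 0 <= P o) -> (forall o, 0 <= Q o) ->
  \sum_o P o <= 1 -> \sum_o Q o <= 1 -> TV P Q <= 1.
Proof.
move=> P0 Q0 P1 Q1; rewrite /TV.
suff : \sum_o `|P o - Q o| <= \sum_o P o + \sum_o Q o by lra.
rewrite -big_split /=; apply: ler_sum => o _.
by apply: le_trans (ler_normB _ _) _; rewrite !ger0_norm.
Qed.

Section Local.
Context {R : realType}.
Variables (Lam V : R -> R) (n a b : nat) (x : 'I_a -> R) (y : 'I_b -> R).

Let U := Un Lam V n.

Definition edge_weight (i : 'I_a) (j : 'I_b) : R :=
  expR (- V (n%:R * (x i - y j)) - U (x i) - U (y j)).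

Lemma edge_weight_ge0 i j : 0 <= edge_weight i j.
Proof. exact: expR_ge0. Qed.

(** The prefactor charges [U] to every point, matched or not; each edge refunds the charges of its
    two ends through [edge_weight]. Injectivity of [pi] ensures that a matched [j] is refunded
    exactly once. *)
Lemma expR_energy (S : {set 'I_a}) (T : {set 'I_b}) pi :
  pi \in partial_bijections S T ->
  expR (- energy Lam V n x y S T pi) =
  expR (\sum_(i in S) U (x i) + \sum_(j in T) U (y j)) *
    matching_weight edge_weight pi.
Proof.
move=> /partial_bijectionsP[h1 h2].
have -> : matching_weight edge_weight pi = expR (\sum_(i in S)
    oapp (fun j => - V (n%:R * (x i - y j)) - U (x i) - U (y j)) 0 (pi i)).
  rewrite expR_sum /matching_weight [LHS](bigID (mem S)) /=.
  rewrite [X in _ * X]big1 ?mulr1; last first.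
    by move=> i; case ij : (pi i) => [j|//]; rewrite (h1 _ _ ij).1.
  by apply: eq_bigr => i _; case: (pi i) => [j|] //=; rewrite expR0.
rewrite -expRD; congr expR; rewrite /energy.
have hX : \sum_(i in S) U (x i) = \sum_(i in S | pi i == None) U (x i) +
    \sum_(i in S) oapp (fun=> U (x i)) 0 (pi i).
  rewrite [X in _ = _ + X](bigID (fun i => pi i == None)) /=.
  rewrite [X in _ = _ + (X + _)]big1 ?add0r; last by move=> i /andP[_ /eqP ->].
  rewrite [LHS](bigID (fun i => pi i == None)) /=; congr (_ + _).
  by apply: eq_bigr => i /andP[_]; case: (pi i).
have hY : \sum_(j in T) U (y j) = \sum_(j in T | [forall i, pi i != Some j]) U (y j) +
    \sum_(i in S) oapp (fun j => U (y j)) 0 (pi i).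
  have -> : \sum_(i in S) oapp (fun j => U (y j)) 0 (pi i) =
      \sum_(i in S) \sum_(j in T) if pi i == Some j then U (y j) else 0.
    apply: eq_bigr => i _; case ij : (pi i) => [j|]; last first.
      by rewrite big1.
    have [_ jT] := h1 _ _ ij; rewrite (bigD1 j) //= eqxx big1 ?addr0 //.
    move=> k /andP[_ kj]; case: eqP => // -[jk].
    by rewrite jk eqxx in kj.
  rewrite exchange_big /= [LHS](bigID (fun j => [forall i, pi i != Some j])) /=.
  congr (_ + _); rewrite [RHS](bigID (fun j => [forall i, pi i != Some j])) /=.
  rewrite [X in _ = X + _]big1 ?add0r; last first.
    move=> j /andP[_ /forallP hj]; apply: big1 => i _.
    by rewrite (negbTE (hj i)).
  apply: eq_bigr => j /andP[_]; rewrite negb_forall => /existsP[i].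
  rewrite negbK => /eqP ij; have [iS _] := h1 _ _ ij.
  rewrite (bigD1 i) //= ij eqxx big1 ?addr0 //.
  move=> k /andP[_ ki]; case: eqP => // kj.
  by rewrite (h2 _ _ _ ij kj) eqxx in ki.
have hV : \sum_(i in S) oapp (fun j => - V (n%:R * (x i - y j)) - U (x i) - U (y j)) 0 (pi i) =
    - \sum_(i in S) oapp (fun j => V (n%:R * (x i - y j))) 0 (pi i) -
    \sum_(i in S) oapp (fun=> U (x i)) 0 (pi i) -
    \sum_(i in S) oapp (fun j => U (y j)) 0 (pi i).
  rewrite -!sumrN -!big_split /=; apply: eq_bigr => i _.
  by case: (pi i) => [j|] //=; rewrite oppr0 !addr0.
by rewrite hX hY hV; ring.
Qed.

Lemma gibbs_marginalE (S : {set 'I_a}) (T : {set 'I_b}) i o :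
  gibbs_marginal Lam V n x y S T i o =
  (\sum_(pi in partial_bijections S T | pi i == o) matching_weight edge_weight pi)
    / matching_sum edge_weight S T.
Proof.
rewrite /gibbs_marginal mulr_suml; apply: eq_bigr => pi /andP[piPB _].
rewrite /gibbs expR_energy // (eq_bigr _ (@expR_energy S T)) -mulr_sumr.
by rewrite -mulf_div divff ?gt_eqF ?expR_gt0 // mul1r.
Qed.

Lemma gibbs_marginal_ge0 S T i o : 0 <= gibbs_marginal Lam V n x y S T i o.
Proof.
rewrite gibbs_marginalE; apply: divr_ge0; last first.
  by apply/ltW/matching_sum_gt0; exact: edge_weight_ge0.
by apply: sumr_ge0 => pi _; apply: matching_weight_ge0; exact: edge_weight_ge0.
Qed.

Lemma gibbs_marginal_sum S T i : \sum_o gibbs_marginal Lam V n x y S T i o = 1.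
Proof.
under eq_bigr do rewrite gibbs_marginalE.
rewrite -mulr_suml -(partition_big (fun pi : {ffun 'I_a -> option 'I_b} => pi i) xpredT) //=.
by rewrite divff // gt_eqF // matching_sum_gt0 //; exact: edge_weight_ge0.
Qed.

Lemma TV_local_posterior_le1 M i :
  TV (posterior Lam V n x y i) (local_posterior Lam V n x y M i) <= 1.
Proof.
apply: TV_le1 => [j|j| |].
- exact: gibbs_marginal_ge0.
- by rewrite /local_posterior; case: ifP => // _; exact: gibbs_marginal_ge0.
- by rewrite /posterior gibbs_marginal_sum.
rewrite -(gibbs_marginal_sum (localX n x M i) (localY n x y M i) i).
apply: ler_sum => o _; rewrite /local_posterior; case: ifP => // _.
exact: gibbs_marginal_ge0.
Qed.

Variables (posX : 'I_a -> nat) (posY : 'I_b -> nat) (c : R) (q : nat).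
Hypothesis edge_weight_le : forall i j,
  edge_weight i j <= c * expR (- (ndist (posX i) (posY j))%:R).
Hypothesis c_ge0 : 0 <= c.
Hypothesis q_ge2 : (2 <= q)%N.

Let pos (v : 'I_a + 'I_b) : nat :=
  match v with inl i => posX i | inr j => posY j end.

Let act_le u v :
  activity edge_weight u v <= c * expR (- (ndist (pos u) (pos v))%:R).
Proof.
case: u v => [i|j] [k|l] /=; rewrite ?mulr_ge0 ?expR_ge0 //.
by rewrite {1}/ndist addnC; exact: edge_weight_le.
Qed.

(** The probability of an edge is its weight times two unmatched probabilities. For a near partner
    the two discrepancies add up, whence [2 * discrepancy_bound], and the resulting relative error
    is summed against [Q], of total mass 1. For a far partner both probabilities are at most the
    edge weight, and these weights have a small sum. *)
Lemma TV_window_le (S : {set 'I_a}) (T : {set 'I_b}) (i : 'I_a) :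
  \sum_k expR (- ((ndist (posX i) (posX k))%:R / (q ^ 4)%:R)) +
  \sum_j expR (- ((ndist (posX i) (posY j))%:R / (q ^ 4)%:R)) <= q%:R ^+ 5 :> R ->
  (forall k, (ndist (posX i) (posX k) <= q ^ 4)%N -> k \in S) ->
  (forall j, (ndist (posX i) (posY j) <= q ^ 4)%N -> j \in T) ->
  TV (gibbs_marginal Lam V n x y [set: 'I_a]%SET [set: 'I_b]%SET i)
     (fun o => if (if o is Some j then j \in T else true)
               then gibbs_marginal Lam V n x y S T i o else 0) <=
  (expR (2 * discrepancy_bound c q) - 1) +
  c * (expR 1 * q%:R ^+ 5) * expR (- (q%:R / 2)).
Proof.
move=> crowd ballS ballT.
have w0 := edge_weight_ge0.
have act0 := activity_ge0 w0.
have Z0 := vertex_sum_gt0 w0.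
have Zrec := vertex_sum_rec edge_weight.
set Z := vertex_sum edge_weight in Z0 Zrec.
pose W : {set 'I_a + 'I_b} :=
  [set v | match v with inl k => k \in S | inr j => j \in T end]%SET.
have ballW v : (ndist (pos (inl i)) (pos v) <= q ^ 4)%N -> v \in W.
  by case: v => [k|j] h; rewrite inE; [exact: ballS|exact: ballT].
have crowdV : \sum_v expR (- ((ndist (pos (inl i)) (pos v))%:R / (q ^ 4)%:R)) <=
    q%:R ^+ 5 :> R.
  by rewrite big_sumType.
have disc := discrepancy_near act0 Z0 Zrec act_le q_ge2 crowdV ballW.
set D := discrepancy_bound c q in disc *.
have iS : i \in S by apply: ballS; rewrite /ndist subnn.
have iT : (@inl _ 'I_b i) \in [set: 'I_a + 'I_b]%SET by rewrite inE.
have lT : leftset [set: 'I_a + 'I_b]%SET = [set: 'I_a]%SET.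
  by apply/finset.setP => k; rewrite !inE.
have rT : rightset [set: 'I_a + 'I_b]%SET = [set: 'I_b]%SET.
  by apply/finset.setP => k; rewrite !inE.
have lW : leftset W = S by apply/finset.setP => k; rewrite !inE.
have rW : rightset W = T by apply/finset.setP => k; rewrite !inE.
have margN (H : {set 'I_a + 'I_b}) : inl i \in H ->
    gibbs_marginal Lam V n x y (leftset H) (rightset H) i None = unmatched Z H (inl i).
  move=> iH; rewrite gibbs_marginalE matching_sum_None ?inE //.
  by rewrite /unmatched /Z /vertex_sum !side_setE.
have margS (H : {set 'I_a + 'I_b}) j : inl i \in H -> inr j \in H ->
    gibbs_marginal Lam V n x y (leftset H) (rightset H) i (Some j) =
    edge_weight i j * (unmatched Z (H :\ inl i) (inr j) * unmatched Z H (inl i)).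
  move=> iH jH; rewrite gibbs_marginalE matching_sum_Some ?inE // -mulrA; congr (_ * _).
  rewrite /unmatched mulrA divfK ?gt_eqF //.
  by rewrite /Z /vertex_sum !side_setE.
have margfar (H : {set 'I_a + 'I_b}) j : inl i \in H -> inr j \in H ->
    gibbs_marginal Lam V n x y (leftset H) (rightset H) i (Some j) <= edge_weight i j.
  move=> iH jH; rewrite margS // ler_piMr //.
  have u0 K v : 0 <= unmatched Z K v by rewrite ltW // unmatched_gt0.
  by rewrite mulr_ile1 // (unmatched_le1 act0 Z0 Zrec) // !inE.
have iW : inl i \in W by rewrite inE.
have TW : [set: 'I_a + 'I_b]%SET :&: W = W by rewrite finset.setTI.
have TiW : ([set: 'I_a + 'I_b]%SET :\ inl i) :&: W = W :\ inl i.
  by apply/finset.setP => k; rewrite !inE andbT.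
have di := disc [set: _]%SET (inl i) iT.
have {}di : `|ln (unmatched Z [set: _]%SET (inl i)) - ln (unmatched Z W (inl i))| <= D.
  by rewrite -[in X in _ - X]TW; apply: di; rewrite /ndist subnn.
have dj j : (ndist (posX i) (posY j) <= q)%N ->
    `|ln (unmatched Z ([set: _]%SET :\ inl i) (inr j)) -
      ln (unmatched Z (W :\ inl i) (inr j))| <= D.
  by move=> nj; rewrite -[in X in _ - X]TiW; apply: disc => //; rewrite !inE.
have u0 := unmatched_gt0 Z0.
have D0 : 0 <= D by apply: le_trans di; exact: normr_ge0.
have e2D : 0 <= expR (2 * D) - 1 by rewrite subr_ge0 -expR0 ler_expR mulr_ge0.
pose P o := gibbs_marginal Lam V n x y [set: 'I_a]%SET [set: 'I_b]%SET i o.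
pose Q o := gibbs_marginal Lam V n x y S T i o.
pose Q' o := if (if o is Some j then j \in T else true) then Q o else 0.
have dN : `|P None - Q' None| <= (expR (2 * D) - 1) * Q None.
  rewrite /P /Q' /Q -lT -rT -lW -rW !margN //.
  by apply: ln_dist_diff => //; apply: le_trans di _; rewrite ler_peMl // ler1n.
have dnear j : (ndist (posX i) (posY j) <= q)%N ->
    `|P (Some j) - Q' (Some j)| <= (expR (2 * D) - 1) * Q (Some j).
  move=> nj; have jT : j \in T.
    by apply: ballT; apply: leq_trans nj _; rewrite -{1}(expn1 q) leq_pexp2l // ltnW.
  rewrite /P /Q' jT /Q -lT -rT -lW -rW !margS ?inE //.
  rewrite -mulrBr normrM (ger0_norm (w0 _ _)) [leRHS]mulrCA ler_wpM2l //.
  apply: ln_dist_diff => [||]; [exact: mulr_gt0 | exact: mulr_gt0 |].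
  have lnMu K K' u v : ln (unmatched Z K u * unmatched Z K' v) =
      ln (unmatched Z K u) + ln (unmatched Z K' v) by rewrite lnM ?posrE ?u0.
  rewrite (lnMu _ [set: _]%SET) lnMu opprD addrACA mulr_natl mulr2n.
  by apply: le_trans (ler_normD _ _) (lerD (dj _ nj) di).
have dfar j : `|P (Some j) - Q' (Some j)| <= edge_weight i j.
  have Pw : P (Some j) <= edge_weight i j by rewrite /P -lT -rT margfar ?inE.
  have P0 : 0 <= P (Some j) by apply: gibbs_marginal_ge0.
  rewrite /Q'; case: ifPn => jT; last by rewrite subr0 ger0_norm.
  have Qw : Q (Some j) <= edge_weight i j by rewrite /Q -lW -rW margfar ?inE.
  have Q0 : 0 <= Q (Some j) by apply: gibbs_marginal_ge0.
  by rewrite ler_norml; apply/andP; split; lra.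
have far : \sum_(j | ~~ (ndist (posX i) (posY j) <= q)%N) edge_weight i j <=
    c * (expR 1 * q%:R ^+ 5) * expR (- (q%:R / 2)).
  have := @far_activity_le _ _ _ act0 _ _ act_le q (inl i) q_ge2 crowdV (inl i).
  rewrite big_sumType /= => h; apply: le_trans (h _); last by rewrite /ndist subnn.
  by rewrite lerDr; apply: sumr_ge0.
have sumQ : \sum_o Q o = 1 by exact: gibbs_marginal_sum.
have tot : \sum_o `|P o - Q' o| <= (expR (2 * D) - 1) +
    \sum_(j | ~~ (ndist (posX i) (posY j) <= q)%N) edge_weight i j.
  have sumE (F : option 'I_b -> R) : \sum_o F o = F None + \sum_j F (Some j).
    rewrite (bigID (fun o => o == None)) /= big_pred1_eq; congr (_ + _).
    by rewrite (reindex_omap Some id) //=; [apply: eq_bigl => j; rewrite eqxx|case].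
  rewrite sumE -[expR (2 * D) - 1]mulr1 -[X in _ * X]sumQ sumE mulrDr -addrA lerD //.
  rewrite [leLHS](bigID (fun j => (ndist (posX i) (posY j) <= q)%N)) /= lerD //.
    rewrite mulr_sumr [leRHS](bigID (fun j => (ndist (posX i) (posY j) <= q)%N)) /=.
    rewrite -[leLHS]addr0 lerD //; first exact: ler_sum.
    by apply: sumr_ge0 => j _; rewrite mulr_ge0 //; exact: gibbs_marginal_ge0.
  exact: ler_sum.
have half : 2^-1 <= 1 :> R by lra.
apply: le_trans (_ : \sum_o `|P o - Q' o| <= _).
  by rewrite /TV ler_piMl //; apply: sumr_ge0.
by apply: le_trans tot _; rewrite lerD2l.
Qed.

End Local.

(** * From exponential decay to an error of order 1 / q *)

Lemma exprn_expRN_bounded (R : realType) (k : nat) (r : R) : 0 < r ->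
  exists2 G : R, 0 <= G & forall x, 0 <= x -> x ^+ k.+1 * expR (- (r * x)) <= G.
Proof.
move=> r0; exists ((k.+1)`!%:R / r ^+ k.+1).
  by rewrite divr_ge0 ?ler0n // exprn_ge0 // ltW.
move=> x x0; rewrite expRN ler_pdivrMr ?expR_gt0 //.
have h := expR_ge1Dxn k (mulr_ge0 (ltW r0) x0).
have f0 : 0 < (k.+1)`!%:R :> R by rewrite ltr0n fact_gt0.
have rk : 0 < r ^+ k.+1 by rewrite exprn_gt0.
rewrite mulrAC ler_pdivlMr // [leRHS]mulrC -ler_pdivrMr //.
rewrite -exprMn [x * r]mulrC; lra.
Qed.

Lemma local_error_le (R : realType) (c : R) : 0 <= c ->
  exists2 C : R, 0 < C & forall (q : nat) (t : R), (2 <= q)%N -> t <= 1 ->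
    t <= (expR (2 * discrepancy_bound c q) - 1) +
      c * (expR 1 * q%:R ^+ 5) * expR (- (q%:R / 2)) -> t <= C / q%:R.
Proof.
move=> c0; have e1 : 0 < expR 1 :> R by exact: expR_gt0.
have ce : 0 <= c * expR 1 by rewrite mulr_ge0 // ltW.
set r : R := (2 * (1 + 6 * c * expR 1))^-1.
have r0 : 0 < r by rewrite invr_gt0; lra.
have h20 : 0 < 2^-1 :> R by rewrite invr_gt0.
(* Powers of [q] after multiplication by [q]: 6 in the terms with one factor [q^5], and 11 in the
   second term of [discrepancy_bound], where [q^5] occurs twice. *)
have [F6 F60 hF] := exprn_expRN_bounded 5 r0.
have [G6 G60 hG] := exprn_expRN_bounded 5 h20.
have [G11 G110 hG'] := exprn_expRN_bounded 10 h20.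
set C1 : R := c * expR 1 * F6 + 2 * (c * expR 1) * expR 1 * G11.
have C10 : 0 <= C1 by rewrite addr_ge0 // !mulr_ge0 // ltW.
exists (2 * expR 1 * C1 + c * expR 1 * G6 + 1).
  by rewrite ltr_wpDl // addr_ge0 ?mulr_ge0 // ltW.
move=> q t q2 t1 ht.
have q0 : 0 < q%:R :> R by rewrite ltr0n (ltn_trans _ q2).
move: {hF hG hG'} (hF _ (ltW q0)) (hG _ (ltW q0)) (hG' _ (ltW q0)) => hF hG hG'.
set x : R := q%:R in q0 hF hG hG' ht *.
set far := c * (expR 1 * x ^+ 5) * expR (- (x / 2)) in ht.
have DE : discrepancy_bound c q * x =
    c * expR 1 * (x ^+ 6 * expR (- (r * x))) +
    2 * (c * expR 1) * expR 1 * (x ^+ 11 * expR (- (2^-1 * x))).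
  by rewrite /discrepancy_bound -/x -/r [2^-1 * x]mulrC; ring.
have Dx : discrepancy_bound c q * x <= C1.
  by rewrite DE lerD // ler_wpM2l // mulr_ge0 ?mulr_ge0 ?expR_ge0.
have D0 : 0 <= discrepancy_bound c q.
  by rewrite /discrepancy_bound addr_ge0 // !mulr_ge0 ?expR_ge0 ?exprn_ge0.
have farx : far * x <= c * expR 1 * G6.
  have -> : far * x = c * expR 1 * (x ^+ 6 * expR (- (2^-1 * x))).
    by rewrite /far [2^-1 * x]mulrC; ring.
  by rewrite ler_wpM2l.
have far0 : 0 <= far by rewrite /far !mulr_ge0 ?expR_ge0 ?exprn_ge0 // ltW.
have tD : t <= 2 * expR 1 * discrepancy_bound c q + far.
  set D := discrepancy_bound c q in D0 Dx ht *.
  (* For [2 * D > 1] the bound [t <= 1] is enough; otherwise [exp(2 D) - 1] is at most [e] times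
     [2 D]. *)
  have [D1|D1] := leP (2 * D) 1; last first.
    have e2 : 1 + 1 <= expR 1 :> R := expR_ge1Dx 1.
    have : 1 * (2 * D) <= expR 1 * (2 * D) by rewrite ler_wpM2r //; lra.
    by rewrite mul1r; lra.
  suff : expR (2 * D) - 1 <= expR 1 * (2 * D) by lra.
  have h : 1 - 2 * D <= expR (- (2 * D)) by apply: expR_ge1Dx.
  have := ler_wpM2l (ltW (expR_gt0 (2 * D))) h; rewrite -expRD subrr expR0 => hh.
  have : expR (2 * D) * (2 * D) <= expR 1 * (2 * D).
    by rewrite ler_wpM2r ?ler_expR //; lra.
  by lra.
rewrite ler_pdivlMr //; apply: le_trans (ler_wpM2r (ltW q0) tD) _.
have : 2 * expR 1 * (discrepancy_bound c q * x) <= 2 * expR 1 * C1.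
  by rewrite ler_wpM2l // mulr_ge0 // ltW.
by lra.
Qed.

(** * Bounds on the density *)

Lemma growth_le (R : realType) (Lam V : R -> R) (delta : R) :
  assumptionA Lam V delta ->
  (exists c1 : R, forall t, - V t <= c1 - `|t|) /\
  (exists v1 : R, forall t, `|t| <= 1 -> V t <= v1).
Proof.
move=> [_ [_ _ _ [C0 [c0 [Vmin [f [g [[C00 c00 d0] _ _ h]]]]]]]].
split; last first.
  exists (Vmin + C0 * 2) => t t1; have [h1 h2 _ _] := h t.
  suff : C0 * (1 + `|t| `^ C0) <= C0 * 2 by lra.
  rewrite ler_pM2l //.
  suff : `|t| `^ C0 <= 1 by lra.
  have := @ge0_ler_powR R C0 (ltW C00) `|t| 1.
  by rewrite powR1; apply; rewrite ?nnegrE.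
(* beyond T the exponent 1 + delta beats the linear growth *)
pose T := c0 `^ (- delta^-1).
have T0 : 0 < T by apply: powR_gt0.
exists (T - Vmin) => t; have [_ _ h3 h4] := h t.
suff : `|t| - T <= c0 * `|t| `^ (1 + delta) by lra.
have [tT|Tt] := leP `|t| T.
  apply: (@le_trans _ _ 0); first by lra.
  by rewrite mulr_ge0 ?powR_ge0 // ltW.
have t0 : 0 < `|t| by apply: lt_trans Tt.
rewrite powRD; last by rewrite (gt_eqF t0) implybT.
rewrite powRr1 // mulrCA.
suff : 1 <= c0 * `|t| `^ delta.
  by move=> h1; have := ler_wpM2l (ltW t0) h1; lra.
have : T `^ delta <= `|t| `^ delta.
  by apply: ge0_ler_powR; rewrite ?nnegrE //; exact: ltW.
have -> : T `^ delta = c0^-1.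
  by rewrite /T -powRrM mulNr mulVf ?gt_eqF // powR_inv1 // ltW.
by move=> h1; have := ler_wpM2l (ltW c00) h1; rewrite divff ?gt_eqF.
Qed.

Lemma continuous_cauchy_kernel (R : realType) (s x : R) :
  continuous (fun y : R => (1 + (s * (y - x)) ^+ 2)^-1).
Proof.
move=> y; apply: (@continuous_comp _ _ _ (fun y => s * (y - x))
  (fun z : R => (1 + z ^+ 2)^-1)); last exact: continuous_oneDsqrV.
by apply: cvgM; [exact: cvg_cst | apply: cvgB; [exact: cvg_id|exact: cvg_cst]].
Qed.

(** The Cauchy kernel serves as an integrable majorant of [exp(- |t|)]: it is smooth, so its
    antiderivative [atan] works on the whole interval without a case split at [y = x]. *)
Lemma integral_cauchy_kernel_le (R : realType) (s x : R) : 0 < s ->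
  (\int[@lebesgue_measure R]_(y in `[0%R, 1%R]) ((1 + (s * (y - x)) ^+ 2)^-1)%:E
    <= (pi / s)%:E)%E.
Proof.
move=> s0.
pose F (y : R) : R := s^-1 * atan (s * (y - x)).
have dF (y : R) : is_derive y 1 F ((1 + (s * (y - x)) ^+ 2)^-1).
  have dg : is_derive y (1 : R) (fun y => s * (y - x)) s.
    by apply: is_derive_eq; rewrite subr0; exact: mulr1.
  have da := @is_derive1_comp _ atan (fun y => s * (y - x)) y _ _ (is_derive1_atan _) dg.
  by apply: is_derive_eq; rewrite /GRing.scale /= mulrC -mulrA divff ?gt_eqF ?mulr1.
have cF : continuous F.
  move=> y; apply: differentiable_continuous; apply/derivable1_diffP.
  exact: (@ex_derive _ _ _ _ _ _ _ (dF y)).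
have -> := @continuous_FTC2 R (fun y => (1 + (s * (y - x)) ^+ 2)^-1) F 0 1 ltr01.
- rewrite -EFinB lee_fin /F -mulrBr mulrC ler_pM2r ?invr_gt0 //.
  have := atan_ltpi2 (s * (1 - x)); have := atan_gtNpi2 (s * (0 - x)); lra.
- by apply: continuous_in_subspaceT => y _; exact: continuous_cauchy_kernel.
- split.
  + by move=> y _; apply: (@ex_derive _ _ _ _ _ _ _ (dF y)).
  + by apply: cvg_at_right_filter; exact: cF.
  + by apply: cvg_at_left_filter; exact: cF.
by move=> y _; rewrite derive1E; apply: (@derive_val _ _ _ _ _ _ _ (dF y)).
Qed.

Section DensityBounds.
Context {R : realType}.
Variables (Lam V : R -> R).
Hypothesis Lam_cont : {within `[0, 1], continuous Lam}.
Hypothesis V_meas : measurable_fun [set: R] V.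
Variables (Lmin Lmax c1 v1 : R).
Hypothesis Lmin_gt0 : 0 < Lmin.
Hypothesis Lam_bounds : forall x : R, 0 <= x <= 1 -> Lmin <= Lam x <= Lmax.
Hypothesis V_ge : forall t, - V t <= c1 - `|t|.
Hypothesis V_le : forall t, `|t| <= 1 -> V t <= v1.
Variable n : nat.
Hypothesis n_gt0 : (0 < n)%N.

Local Notation mu := (@lebesgue_measure R).

Let n0 : 0 < n%:R :> R. Proof. by rewrite ltr0n. Qed.

Let Lmin_le : Lmin <= Lmax.
Proof.
have /andP[h1 h2] := @Lam_bounds 0 (ltac:(by rewrite lexx ler01)).
exact: le_trans h2.
Qed.

Let Lmax_gt0 : 0 < Lmax. Proof. exact: lt_le_trans Lmin_le. Qed.

(** Extension of the weight by 0 off the square: restricting [Lam] puts a zero under the root. It is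
    measurable on the whole plane, so integrals over the line and Tonelli's theorem apply. *)
Definition weight0 (z : R * R) : R :=
  Num.sqrt ((Lam \_ `[0, 1]) z.1 * (Lam \_ `[0, 1]) z.2) *
    expR (- V (n%:R * (z.1 - z.2))).

Lemma weight0_ge0 z : 0 <= weight0 z.
Proof. by rewrite mulr_ge0 ?sqrtr_ge0 ?expR_ge0. Qed.

Lemma in_square (z : R * R) : square z <-> 0 <= z.1 <= 1 /\ 0 <= z.2 <= 1.
Proof. by rewrite /square /= !in_itv. Qed.

Lemma weight0E z : square z -> weight0 z = weight Lam V n z.1 z.2.
Proof.
case=> h1 h2; by rewrite /weight0 /weight !patchE (mem_set h1) (mem_set h2).
Qed.

Lemma weight0_out z : ~ square z -> weight0 z = 0.
Proof.
move=> h; rewrite /weight0 !patchE.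
case: ifPn => h1; last by rewrite mul0r sqrtr0 mul0r.
case: ifPn => h2; last by rewrite mulr0 sqrtr0 mul0r.
by exfalso; apply: h; split; [move: h1|move: h2]; rewrite inE.
Qed.

Lemma measurable_weight0 : measurable_fun [set: R * R] weight0.
Proof.
have mL : measurable_fun [set: R] (Lam \_ `[0, 1]).
  apply/(measurable_restrictT _ (measurable_itv _)).
  by apply: subspace_continuous_measurable_fun; [exact: measurable_itv|exact: Lam_cont].
apply: measurable_funM.
  have ms : measurable_fun [set: R] (@Num.sqrt R).
    by apply: continuous_measurable_fun; exact: sqrt_continuous.
  apply: (measurableT_comp ms); apply: measurable_funM.
    exact: (measurableT_comp mL measurable_fst).
  exact: (measurableT_comp mL measurable_snd).
apply: (measurableT_comp (@measurable_expR R)); apply: measurable_funN.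
apply: (measurableT_comp V_meas); apply: measurable_funM => //.
by apply: measurable_funB; [exact: measurable_fst|exact: measurable_snd].
Qed.

Let mW : measurable_fun [set: R * R] (fun z => (weight0 z)%:E).
Proof. by apply/measurable_EFinP; exact: measurable_weight0. Qed.

Lemma square_measurable : measurable (@square R).
Proof. by apply: measurableX; exact: measurable_itv. Qed.

Definition row_mass (x : R) : \bar R := (\int[mu]_y (weight0 (x, y))%:E)%E.

Lemma row_mass_ge0 x : (0 <= row_mass x)%E.
Proof. by apply: integral_ge0 => y _; rewrite lee_fin weight0_ge0. Qed.

Lemma measurable_row_mass : measurable_fun [set: R] row_mass.
Proof.
apply: (@measurable_fun_fubini_tonelli_F _ _ _ _ R mu (fun z => (weight0 z)%:E)) => //.
by move=> z; rewrite lee_fin weight0_ge0.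
Qed.

Let mWx x : measurable_fun [set: R] (fun y => (weight0 (x, y))%:E).
Proof. exact: (measurableT_comp mW (pair1_measurable x)). Qed.

Lemma row_mass_le x : (row_mass x <= (2 * Lmax * expR c1 * pi / n%:R)%:E)%E.
Proof.
set k := 2 * Lmax * expR c1.
have k0 : 0 <= k by rewrite !mulr_ge0 ?expR_ge0 // ltW.
have hk : (row_mass x <= \int[mu]_(y in `[0%R, 1%R])
    (k%:E * ((1 + (n%:R * (y - x)) ^+ 2)^-1)%:E))%E.
  rewrite /row_mass [leRHS]integral_mkcond.
  apply: ge0_le_integral => //.
  - by move=> y _; rewrite lee_fin weight0_ge0.
  - exact: mWx.
  - apply/(measurable_restrictT _ (measurable_itv _)).
    apply: (measurable_funS measurableT) => //.
    apply/measurable_EFinP; apply: measurable_funM => //.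
    apply: continuous_measurable_fun.
    exact: continuous_cauchy_kernel.
  move=> y _; rewrite patchE; case: ifPn => hy; last first.
    rewrite weight0_out // => -[_ /= hy']; move: hy; rewrite notin_setE; exact.
  rewrite inE in hy; rewrite -EFinM lee_fin.
  have [hx|hx] := pselect (0 <= x <= 1); last first.
    rewrite weight0_out; last by move/in_square => -[].
    by rewrite mulr_ge0 // invr_ge0 addr_ge0 ?sqr_ge0.
  have {}hy : 0 <= y <= 1 by move: hy; rewrite /= in_itv.
  rewrite weight0E; last by apply/in_square.
  rewrite /weight /=.
  have /andP[lx1 lx2] := Lam_bounds hx; have /andP[ly1 ly2] := Lam_bounds hy.
  have s1 : Num.sqrt (Lam x * Lam y) <= Lmax.
    rewrite -[leRHS](ger0_norm (ltW Lmax_gt0)) -sqrtr_sqr ler_sqrt ?sqr_ge0 // expr2.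
    by apply: ler_pM => //; apply: (le_trans (ltW Lmin_gt0)).
  set t := n%:R * (x - y).
  have -> : (n%:R * (y - x)) ^+ 2 = t ^+ 2 by rewrite /t; ring.
  have e1 : expR (- V t) <= expR c1 * expR (- `|t|) by rewrite -expRD ler_expR.
  (* From [1 + s^2 / 2 <= exp s] at [s = |t|]. *)
  have e2 : expR (- `|t|) <= 2 * (1 + t ^+ 2)^-1.
    have h2 := expR_ge1Dxn 1 (normr_ge0 t).
    have tt : `|t| ^+ 2 = t ^+ 2 by rewrite real_normK ?num_real.
    rewrite expRN ler_pdivlMr; last by have := sqr_ge0 t; lra.
    rewrite mulrC ler_pdivrMr ?expR_gt0 //.
    have e1' : 1 <= expR `|t| by apply: le_trans h2; rewrite lerDl divr_ge0 // ?exprn_ge0.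
    by rewrite -tt; move: h2; rewrite -[2`!]/2%N; lra.
  have -> : k * (1 + t ^+ 2)^-1 = Lmax * (expR c1 * (2 * (1 + t ^+ 2)^-1)).
    by rewrite /k; ring.
  apply: ler_pM => //; rewrite ?sqrtr_ge0 ?expR_ge0 //.
  by apply: le_trans e1 _; rewrite ler_wpM2l // expR_ge0.
apply: le_trans hk _; rewrite ge0_integralZl //; last first.
- by move=> y _; rewrite lee_fin invr_ge0 addr_ge0 ?sqr_ge0.
- apply: (measurable_funS measurableT) => //.
  apply/measurable_EFinP; apply: continuous_measurable_fun.
  exact: continuous_cauchy_kernel.
have -> : ((k * pi / n%:R)%:E = k%:E * (pi / n%:R)%:E)%E by rewrite -EFinM mulrA.
by rewrite lee_wpmul2l ?lee_fin // integral_cauchy_kernel_le.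
Qed.

Lemma row_mass_ge (x : R) : 0 <= x <= 1 ->
  ((Lmin * expR (- v1) / (2 * n%:R))%:E <= row_mass x)%E.
Proof.
move=> hx; set k := Lmin * expR (- v1).
have k0 : 0 <= k by rewrite mulr_ge0 ?expR_ge0 // ltW.
have n1 : 1 <= n%:R :> R by rewrite ler1n.
(* The interval of length [1 / (2 n)] with [x] as one end, on the side that stays in [[0, 1]]; on it
   [|n (x - y)| <= 1/2], where [V <= v1]. *)
pose a : R := if x <= 2^-1 then x else x - (2 * n%:R)^-1.
have h2n : 0 < (2 * n%:R)^-1 :> R by rewrite invr_gt0 mulr_gt0.
have h2n' : (2 * n%:R)^-1 <= 2^-1 :> R.
  by rewrite lef_pV2 ?posrE ?mulr_gt0 // ler_peMr.
have a01 : 0 <= a /\ a + (2 * n%:R)^-1 <= 1 by rewrite /a; case: ifPn; lra.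
pose A : set R := `[a, a + (2 * n%:R)^-1]%classic.
have mA : measurable A by exact: measurable_itv.
have muA : mu A = ((2 * n%:R)^-1)%:E.
  rewrite /A lebesgue_measure_itv /= lte_fin ltrDl h2n -EFinB; congr EFin; ring.
apply: (@le_trans _ _ (\int[mu]_(y in A) (cst k%:E y))%E).
  by rewrite integral_cst // [X in (_ * X)%E](_ : _ = ((2 * n%:R)^-1)%:E) // -EFinM.
apply: (@le_trans _ _ (\int[mu]_(y in A) (weight0 (x, y))%:E)%E).
  apply: ge0_le_integral => //.
  - exact: (measurable_funS measurableT _ (mWx x)).
  move=> y; rewrite /A /= in_itv /= => /andP[y1 y2].
  have hy : 0 <= y <= 1 by lra.
  rewrite lee_fin weight0E; last by apply/in_square.
  rewrite /weight /=.
  have /andP[lx1 lx2] := Lam_bounds hx; have /andP[ly1 ly2] := Lam_bounds hy.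
  have s1 : Lmin <= Num.sqrt (Lam x * Lam y).
    rewrite -[leLHS](ger0_norm (ltW Lmin_gt0)) -sqrtr_sqr ler_sqrt; last first.
      by apply: mulr_ge0; apply: (le_trans (ltW Lmin_gt0)).
    by rewrite expr2; apply: ler_pM => //; exact: ltW.
  apply: ler_pM; rewrite ?expR_ge0 ?(ltW Lmin_gt0) // ler_expR lerN2.
  apply: V_le; rewrite normrM (ger0_norm (ltW n0)).
  have dxy : `|x - y| <= (2 * n%:R)^-1.
    by rewrite ler_norml; move: y1 y2; rewrite /a; case: ifPn => _; lra.
  apply: (le_trans (ler_wpM2l (ltW n0) dxy)).
  by rewrite invfM mulrCA divff ?gt_eqF // mulr1; lra.
apply: ge0_subset_integral => //; first exact: mWx.
by move=> y _; rewrite lee_fin weight0_ge0.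
Qed.

Let klow : R := Lmin * expR (- v1) / 2.
Let khigh : R := 2 * Lmax * expR c1 * pi.

Let klow_gt0 : 0 < klow.
Proof. by rewrite divr_gt0 // mulr_gt0 // expR_gt0. Qed.

Let khigh_gt0 : 0 < khigh.
Proof. by rewrite !mulr_gt0 ?expR_gt0 // pi_gt0. Qed.

Lemma strip_integralE (A : set R) (c : R) : measurable A -> 0 <= c ->
  (\int[mu \x mu]_(z in (A `*` setT) `&` @square R) (c * weight Lam V n z.1 z.2)%:E =
   c%:E * \int[mu]_(x in A) row_mass x)%E.
Proof.
move=> mA c0; rewrite integral_mkcond.
have mAT : measurable (A `*` [set: R]) by apply: measurableX.
transitivity (\int[mu \x mu]_z (c%:E * ((fun z => (weight0 z)%:E) \_ (A `*` setT)) z))%E.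
  apply: eq_integral => z _; rewrite !patchE; case: ifPn => [|hz].
    rewrite inE => -[zA zs]; rewrite mem_set //= EFinM weight0E //.
  case: ifPn => zA; last by rewrite mule0.
  rewrite weight0_out ?mule0 // => zs; move: hz; rewrite notin_setE; apply.
  by split=> //; rewrite inE in zA.
have f0 z : (0 <= ((fun z => (weight0 z)%:E) \_ (A `*` setT)) z)%E.
  by rewrite patchE; case: ifP => // _; rewrite lee_fin weight0_ge0.
have mf : measurable_fun setT ((fun z => (weight0 z)%:E) \_ (A `*` setT)).
  by apply/(measurable_restrictT _ mAT); apply: (measurable_funS measurableT).
rewrite ge0_integralZl //; congr (_ * _)%E.
rewrite fubini_tonelli1 // [RHS]integral_mkcond; apply: eq_integral => x _.
rewrite /fubini_F patchE; case: ifPn => xA.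
  apply: eq_integral => y _; rewrite patchE mem_set //; split=> //=.
  by rewrite inE in xA.
rewrite integral0_eq // => y _; rewrite patchE memNset // => -[/= xA' _].
by move: xA; rewrite notin_setE.
Qed.

Lemma row_mass_out (x : R) : ~ 0 <= x <= 1 -> row_mass x = 0%E.
Proof.
move=> hx; rewrite /row_mass integral0_eq // => y _.
by rewrite weight0_out // => /in_square[].
Qed.

Lemma row_mass_strip_le (A : set R) : measurable A ->
  (\int[mu]_(x in A) row_mass x <= (khigh / n%:R)%:E * mu (A `&` `[0%R, 1%R]))%E.
Proof.
move=> mA; have mA1 : measurable (A `&` `[0, 1]) by apply: measurableI.
rewrite -integral_cst // [leLHS]integral_mkcond [leRHS]integral_mkcond.
apply: ge0_le_integral => //.
- by move=> x _; rewrite patchE; case: ifP => // _; exact: row_mass_ge0.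
- apply/(measurable_restrictT _ mA); apply: (measurable_funS measurableT) => //.
  exact: measurable_row_mass.
- by apply/(measurable_restrictT _ mA1).
move=> x _; rewrite !patchE; case: ifPn => xA; last first.
  case: ifP => // _; rewrite lee_fin divr_ge0 // ltW //.
case: ifPn => xA1; first exact: row_mass_le.
rewrite row_mass_out // => hx; move: xA1; rewrite notin_setE; apply.
by split; [rewrite inE in xA|rewrite /= in_itv].
Qed.

Lemma Zn_int : ((Zn Lam V n)%:E = \int[mu]_x row_mass x)%E.
Proof.
have h := @strip_integralE setT 1 measurableT ler01.
have e : (\int[mu \x mu]_(z in @square R) (weight Lam V n z.1 z.2)%:E =
    \int[mu]_x row_mass x)%E.
  rewrite -[RHS]mul1e -h setXTT setTI.
  by apply: eq_integral => z _; rewrite mul1r.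
rewrite /Zn /Rintegral e fineK // ge0_fin_numE.
  apply: (le_lt_trans (row_mass_strip_le measurableT)).
  by rewrite setTI lebesgue_measure_itv /= lte_fin ltr01 -EFinB -EFinM ltry.
by apply: integral_ge0 => x _; exact: row_mass_ge0.
Qed.

Lemma Zn_le : Zn Lam V n <= khigh / n%:R.
Proof.
rewrite -lee_fin Zn_int; apply: (le_trans (row_mass_strip_le measurableT)).
by rewrite setTI lebesgue_measure_itv /= lte_fin ltr01 -EFinB -EFinM lee_fin subr0 mulr1.
Qed.

Lemma Zn_ge : klow / n%:R <= Zn Lam V n.
Proof.
have m01 : measurable (`[0, 1]%classic : set R) by exact: measurable_itv.
rewrite -lee_fin Zn_int.
apply: (@le_trans _ _ (\int[mu]_(x in `[0%R, 1%R]) cst (klow / n%:R)%:E x)%E).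
  rewrite integral_cst // [X in (_ * X)%E](_ : _ = 1%E); first by rewrite mule1.
  have : mu `[0%R, 1%R] = 1%E.
    by rewrite lebesgue_measure_itv /= lte_fin ltr01 -EFinB subr0.
  exact.
apply: (@le_trans _ _ (\int[mu]_(x in `[0%R, 1%R]) row_mass x)%E).
  apply: ge0_le_integral => //.
  - by move=> x _; rewrite lee_fin divr_ge0 // ltW.
  - by apply: (measurable_funS measurableT) => //; exact: measurable_row_mass.
  move=> x; rewrite /= in_itv => hx; apply: le_trans (row_mass_ge hx).
  by rewrite lee_fin /klow -mulrA -invfM.
apply: ge0_subset_integral => //; first exact: measurable_row_mass.
by move=> x _; exact: row_mass_ge0.
Qed.

Lemma Zn_gt0 : 0 < Zn Lam V n.
Proof. by apply: lt_le_trans Zn_ge; rewrite divr_gt0. Qed.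

Lemma pn1E (x : R) : 0 <= x <= 1 ->
  ((pn1 Lam V n x)%:E = ((Zn Lam V n)^-1)%:E * row_mass x)%E.
Proof.
move=> hx; rewrite /pn1 /Rintegral.
have Z0 : 0 <= (Zn Lam V n)^-1 by rewrite invr_ge0 ltW // Zn_gt0.
have -> : (\int[mu]_(y in `[0%R, 1%R]) (pn Lam V n x y)%:E =
    ((Zn Lam V n)^-1)%:E * row_mass x)%E.
  rewrite /row_mass -ge0_integralZl //; last first.
  - by move=> y _; rewrite lee_fin weight0_ge0.
  - exact: mWx.
  rewrite [LHS]integral_mkcond; apply: eq_integral => y _; rewrite patchE.
  case: ifPn => hy.
    rewrite /pn weight0E ?EFinM //; split; first by rewrite /= in_itv.
    by rewrite inE in hy.
  rewrite weight0_out ?mule0 // => -[_ /= hy'].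
  by move: hy; rewrite notin_setE.
rewrite fineK // fin_numM // ge0_fin_numE ?row_mass_ge0 //.
by apply: le_lt_trans (row_mass_le x) _; rewrite ltry.
Qed.

(** The bound is uniform in [n] because the row mass and [Zn] are both of order [1 / n]. *)
Lemma Un_ge (x : R) : 0 <= x <= 1 ->
  ln (klow / khigh / Num.sqrt Lmax) <= Un Lam V n x.
Proof.
move=> hx; rewrite /Un.
have /andP[l1 l2] := Lam_bounds hx.
have l0 : 0 < Lam x by apply: lt_le_trans l1.
have s0 : 0 < Num.sqrt (Lam x) by rewrite sqrtr_gt0.
have sM0 : 0 < Num.sqrt Lmax by rewrite sqrtr_gt0.
have p0 : klow / khigh <= pn1 Lam V n x.
  rewrite -lee_fin (pn1E hx).
  apply: (@le_trans _ _ (((Zn Lam V n)^-1)%:E * (klow / n%:R)%:E)%E); last first.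
    apply: lee_wpmul2l; first by rewrite lee_fin invr_ge0 ltW // Zn_gt0.
    by apply: le_trans (row_mass_ge hx); rewrite lee_fin /klow -mulrA -invfM.
  rewrite -EFinM lee_fin.
  have -> : klow / khigh = (khigh / n%:R)^-1 * (klow / n%:R).
    by field; rewrite !gt_eqF.
  rewrite (ler_wpM2r (divr_ge0 (ltW klow_gt0) (ltW n0))) //.
  by rewrite lef_pV2 ?Zn_le // posrE ?Zn_gt0 // (divr_gt0 khigh_gt0 n0).
have k0 : 0 < klow / khigh by rewrite divr_gt0.
have pp : 0 < pn1 Lam V n x by apply: lt_le_trans p0.
rewrite ler_ln ?posrE ?(divr_gt0 k0 sM0) ?(divr_gt0 pp s0) //.
apply: ler_pM => //; rewrite ?invr_ge0 ?(ltW k0) ?(ltW sM0) //.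
by rewrite lef_pV2 ?posrE // ler_sqrt // ltW.
Qed.

(** Only the first coordinate is localised: crowding of a pair is measured around its [X] value, so
    the bound on this marginal is what the count needs. *)
Lemma strip_prob_le (A : set R) : measurable A ->
  (\int[mu \x mu]_(z in (A `*` setT) `&` @square R) (pn Lam V n z.1 z.2)%:E <=
   (khigh / klow)%:E * mu (A `&` `[0%R, 1%R]))%E.
Proof.
move=> mA; rewrite strip_integralE ?invr_ge0 ?(ltW Zn_gt0) //.
apply: (@le_trans _ _ (((Zn Lam V n)^-1)%:E *
    ((khigh / n%:R)%:E * mu (A `&` `[0%R, 1%R])))%E).
  apply: lee_wpmul2l; first by rewrite lee_fin invr_ge0 ltW // Zn_gt0.
  exact: row_mass_strip_le.
rewrite muleA -EFinM; apply: lee_wpmul2r => //; rewrite lee_fin.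
have -> : khigh / klow = (klow / n%:R)^-1 * (khigh / n%:R).
  by field; rewrite !gt_eqF.
rewrite (ler_wpM2r (divr_ge0 (ltW khigh_gt0) (ltW n0))) //.
by rewrite lef_pV2 ?Zn_ge // posrE ?Zn_gt0 // (divr_gt0 klow_gt0 n0).
Qed.

Lemma square_prob :
  (\int[mu \x mu]_(z in @square R) (pn Lam V n z.1 z.2)%:E = 1)%E.
Proof.
have h := @strip_integralE setT (Zn Lam V n)^-1 measurableT.
rewrite setXTT setTI in h; rewrite h ?invr_ge0 ?(ltW Zn_gt0) //.
by rewrite -Zn_int -EFinM mulVf // gt_eqF // Zn_gt0.
Qed.

End DensityBounds.

(** * Counting crowded points *)

Section TupleSums.
Context {R : realType} {F : finType}.
Variable q : F -> R.
Hypothesis q_ge0 : forall x, 0 <= q x.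

Lemma sum_tuple_cons m (G : seq F -> R) :
  \sum_(v : m.+1.-tuple F) G v = \sum_(s : m.-tuple F) \sum_x G (x :: s).
Proof.
rewrite pair_big /=.
rewrite (reindex (fun p : m.-tuple F * F => [tuple of p.2 :: p.1])) //=.
exists (fun v : m.+1.-tuple F => ([tuple of behead v], thead v)) => [[s x] _|v _] /=.
  by congr pair; apply: val_inj.
by rewrite [RHS]tuple_eta; apply: val_inj.
Qed.

(** The head of a list is its latest point and the tail is the past: [g x t] weighs a new point [x]
    given the earlier ones [t]. *)
Fixpoint iter_weight (g : F -> seq F -> R) (s : seq F) : R :=
  if s is x :: s' then g x s' * iter_weight g s' else 1.

Lemma iter_weight_ge0 g s : (forall x t, 0 <= g x t) -> 0 <= iter_weight g s.
Proof. by move=> g0; elim: s => //= x s IH; rewrite mulr_ge0. Qed.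

(** Summing out the head at fixed tail costs a factor [K], whatever the tail; this is conditional
    expectation given the past. *)
Lemma sum_iter_weight_le g K m : (forall x t, 0 <= g x t) -> 0 <= K ->
  (forall t, (size t < m)%N -> \sum_x q x * g x t <= K) ->
  \sum_(v : m.-tuple F) (\prod_(x <- v) q x) * iter_weight g v <= K ^+ m.
Proof.
move=> g0 K0; elim: m => [|m IH] hK.
  rewrite expr0 (big_pred1 [tuple]) /= ?big_nil ?mulr1 // => v.
  by apply/esym/eqP/val_inj/size0nil; rewrite size_tuple.
rewrite (sum_tuple_cons m (fun v => (\prod_(x <- v) q x) * iter_weight g v)).
apply: (@le_trans _ _ (\sum_(s : m.-tuple F) (\prod_(x <- s) q x) * iter_weight g s * K)).
  apply: ler_sum => s _.
  have -> : \sum_x (\prod_(y <- x :: s) q y) * iter_weight g (x :: s) =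
      (\prod_(x <- s) q x) * iter_weight g s * \sum_x q x * g x s.
    by rewrite mulr_sumr; apply: eq_bigr => x _; rewrite big_cons /=; ring.
  rewrite ler_wpM2l ?hK ?size_tuple //.
  by rewrite mulr_ge0 ?iter_weight_ge0 ?prodr_ge0.
rewrite -mulr_suml exprSr ler_wpM2r // IH // => t tm.
by apply: hK; apply: ltn_trans tm _.
Qed.

(** Markov's inequality for [iter_weight], with [1 / t] as the level reached on bad tuples. *)
Lemma sum_bad_le g K m (bad : pred (seq F)) (t : R) :
  (forall x s, 0 <= g x s) -> 0 <= K ->
  (forall s, (size s < m)%N -> \sum_x q x * g x s <= K) ->
  (forall v, size v = m -> bad v -> 1 <= t * iter_weight g v) -> 0 <= t ->
  \sum_(v : m.-tuple F | bad v) \prod_(x <- v) q x <= t * K ^+ m.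
Proof.
move=> g0 K0 hK hbad t0.
apply: (le_trans _ (ler_wpM2l t0 (sum_iter_weight_le g0 K0 hK))).
rewrite mulr_sumr big_mkcond /=; apply: ler_sum => v _.
have p0 : 0 <= \prod_(x <- v) q x by rewrite prodr_ge0.
rewrite mulrCA; case: ifP => bv; last by rewrite !mulr_ge0 ?iter_weight_ge0.
by rewrite ler_peMr // hbad ?size_tuple.
Qed.

Lemma sum_tuple_rev m (G : pred (seq F)) :
  \sum_(v : m.-tuple F | G (rev v)) \prod_(x <- v) q x =
  \sum_(v : m.-tuple F | G v) \prod_(x <- v) q x.
Proof.
rewrite [RHS](reindex_inj (h := fun v : m.-tuple F => [tuple of rev v])) /=.
  apply: eq_bigr => v _; apply/perm_big; rewrite perm_sym.
  exact/permPl/perm_rev.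
move=> v w /(congr1 val) /= vw; apply: val_inj.
by rewrite /= -[LHS]revK vw revK.
Qed.

Fixpoint event_count (D : F -> seq F -> bool) (s : seq F) : nat :=
  if s is x :: s' then D x s' + event_count D s' else 0.

Lemma event_countE D x0 s : event_count D s =
  (\sum_(l < size s) D (nth x0 s l) (drop l.+1 s))%N.
Proof.
elim: s => [|x s IH] /=; first by rewrite big_ord0.
by rewrite big_ord_recl /= drop0 IH.
Qed.

Lemma event_count_rev D x0 s :
  (forall x t t', perm_eq t t' -> D x t = D x t') ->
  event_count D (rev s) =
  (\sum_(l < size s) D (nth x0 s l) (take l s))%N.
Proof.
move=> hD; rewrite (event_countE _ x0) size_rev (reindex_inj rev_ord_inj) /=.
apply: eq_bigr => l _; have ls := ltn_ord l.
congr (nat_of_bool _); rewrite nth_rev; last by rewrite -subSn // subSS leq_subr.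
have -> : (size s - (size s - l.+1).+1)%N = l by lia.
apply: hD; rewrite drop_rev.
have -> : (size s - (size s - l.+1).+1)%N = l by lia.
exact/permPl/perm_rev.
Qed.

Lemma iter_weight_count (D : F -> seq F -> bool) s :
  iter_weight (fun x t => expR (D x t)%:R) s = expR (event_count D s)%:R.
Proof.
by elim: s => [|x s IH] /=; rewrite ?expR0 // IH -expRD -natrD.
Qed.

(** Chernoff's bound with parameter 1: the moment of [exp(count)] is at most [(1 + (e - 1) eta)^m <=
    exp((e - 1) eta m)], and [exp(- t)] with [t >= e eta m] leaves [exp(- eta m)]. *)
Lemma sum_event_count_le (D : F -> seq F -> bool) eta (t : R) m :
  0 <= eta -> \sum_x q x <= 1 ->
  (forall s, (size s < m)%N -> \sum_(x | D x s) q x <= eta) ->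
  expR 1 * eta * m%:R <= t ->
  \sum_(v : m.-tuple F | t <= (event_count D v)%:R) \prod_(x <- v) q x <=
    expR (- (eta * m%:R)).
Proof.
move=> eta0 q1 hD ht.
have e1 : 1 <= expR 1 :> R by apply: le_trans (expR_ge1Dx 1); rewrite lerDl.
have ee : 0 <= expR 1 - 1 :> R by rewrite subr_ge0.
set K := 1 + (expR 1 - 1) * eta.
have K0 : 0 <= K by rewrite addr_ge0 // mulr_ge0.
apply: le_trans (_ : expR (- t) * K ^+ m <= _).
  apply: (@sum_bad_le (fun x s => expR (D x s)%:R) K m
    (fun v => t <= (event_count D v)%:R)) => //.
  - move=> s sm; apply: (@le_trans _ _ (\sum_x q x + (expR 1 - 1) * \sum_(x | D x s) q x)).
      rewrite mulr_sumr [X in _ <= _ + X]big_mkcond -big_split /=.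
      apply: ler_sum => x _; case: (D x s); last by rewrite expR0 mulr1 addr0.
      by rewrite mulrBl mul1r addrCA subrr addr0 mulrC.
    by rewrite /K lerD // ler_wpM2l // hD.
  - move=> v _ tv; rewrite iter_weight_count -expRD -[leLHS]expR0 ler_expR.
    by rewrite addrC subr_ge0.
have KE : K <= expR ((expR 1 - 1) * eta) by exact: expR_ge1Dx.
have Km : K ^+ m <= expR ((expR 1 - 1) * eta * m%:R).
  by rewrite [X in expR X]mulrC expRM_natl lerXn2r ?nnegrE ?expR_ge0.
apply: le_trans (ler_wpM2l (expR_ge0 _) Km) _.
rewrite -expRD ler_expR; lra.
Qed.

Section Crowding.
Variables (psi : F -> F -> R) (A : R).
Hypothesis psi_ge0 : forall x y, 0 <= psi x y.

Definition crowded (x : F) (s : seq F) : bool := A <= \sum_(y <- s) psi x y.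

(* A crowded entry is crowded by its predecessors or by its successors. *)
Lemma crowded_count_le (B : R) (x0 : F) (s : seq F) :
  (forall x, 2 * A + psi x x <= B) ->
  (\sum_(l < size s) (B < \sum_(y <- s) psi (nth x0 s l) y)%R <=
   event_count crowded s + event_count crowded (rev s))%N.
Proof.
move=> hB; rewrite (event_countE _ x0) (event_count_rev x0); last first.
  by move=> x t t' tt'; rewrite /crowded (perm_big _ tt').
rewrite -big_split /=; apply: leq_sum => l _.
have ls := ltn_ord l; set x := nth x0 s l.
case: ltP => // hx.
suff : crowded x (take l s) || crowded x (drop l.+1 s).
  by do 2!case: (crowded _ _).
have sE : \sum_(y <- s) psi x y =
    \sum_(y <- take l s) psi x y + psi x x + \sum_(y <- drop l.+1 s) psi x y.
  by rewrite -{1}(cat_take_drop l s) big_cat /= (drop_nth x0 ls) big_cons addrA.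
apply/negPn; rewrite negb_or; apply/negP; rewrite /crowded -!ltNge => /andP[h1 h2].
have := hB x; move: hx; rewrite sE; lra.
Qed.

Lemma sum_crowded_le (c : R) (s : seq F) : 0 < A ->
  (forall y, \sum_x q x * psi x y <= c) ->
  \sum_(x | crowded x s) q x <= (size s)%:R * c / A.
Proof.
move=> A0 hc; rewrite ler_pdivlMr // mulr_suml.
apply: (@le_trans _ _ (\sum_x \sum_(y <- s) q x * psi x y)).
  rewrite [leLHS]big_mkcond; apply: ler_sum => x _; rewrite -mulr_sumr.
  case: ifP => h; last by rewrite mulr_ge0 // sumr_ge0.
  by rewrite ler_wpM2l.
rewrite exchange_big /=.
have -> : (size s)%:R * c = \sum_(y <- s) c.
  by rewrite big_const_seq count_predT iter_addr_0 mulr_natl.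
by apply: ler_sum => y _.
Qed.

End Crowding.
End TupleSums.

Section CrowdingTail.
Context {R : realType} {F : finType}.
Variables (q : F -> R) (psi : F -> F -> R) (A B c eta : R) (m : nat) (x0 : F).
Hypothesis q_ge0 : forall x, 0 <= q x.
Hypothesis q_le1 : \sum_x q x <= 1.
Hypothesis psi_ge0 : forall x y, 0 <= psi x y.
Hypothesis A_gt0 : 0 < A.
Hypothesis B_ge : forall x, 2 * A + psi x x <= B.
Hypothesis psi_sum : forall y, \sum_x q x * psi x y <= c.
Hypothesis eta_ge : m%:R * c / A <= eta.

Definition crowd_number (v : seq F) : nat :=
  (\sum_(l < size v) (B < \sum_(y <- v) psi (nth x0 v l) y)%R)%N.

(** More than [2 t] crowded entries force at least [t] events in one of the two scans, and reversing
    a tuple does not change its weight. *)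
Lemma crowd_number_tail :
  \sum_(v : m.-tuple F | 2 * (expR 1 * eta * m%:R) < (crowd_number v)%:R)
    \prod_(x <- v) q x <= 2 * expR (- (eta * m%:R)).
Proof.
have c0 : 0 <= c.
  by apply: le_trans (psi_sum x0); apply: sumr_ge0 => x _; rewrite mulr_ge0.
have eta0 : 0 <= eta.
  by apply: le_trans eta_ge; rewrite divr_ge0 ?mulr_ge0 // ltW.
set t := expR 1 * eta * m%:R.
have hD s : (size s < m)%N -> \sum_(x | crowded psi A x s) q x <= eta.
  move=> sm; apply: le_trans (sum_crowded_le q_ge0 psi_ge0 s A_gt0 psi_sum) _.
  apply: le_trans eta_ge; rewrite ler_pM2r ?invr_gt0 // ler_wpM2r // ler_nat.
  exact: ltnW.
have h := sum_event_count_le q_ge0 eta0 q_le1 hD (lexx t).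
have hr : \sum_(v : m.-tuple F | t <= (event_count (crowded psi A) (rev v))%:R)
    \prod_(x <- v) q x <= expR (- (eta * m%:R)).
  have := sum_tuple_rev q m (fun s => t <= (event_count (crowded psi A) s)%:R).
  by move=> /= ->.
have -> : 2 * expR (- (eta * m%:R)) = expR (- (eta * m%:R)) + expR (- (eta * m%:R)).
  by ring.
apply: le_trans (lerD h hr); rewrite big_mkcond [X in _ <= X + _]big_mkcond.
rewrite [X in _ <= _ + X]big_mkcond -big_split /=; apply: ler_sum => v _.
have p0 : 0 <= \prod_(x <- v) q x by rewrite prodr_ge0.
have hB := crowded_count_le x0 v B_ge.
case: ifP => [big|_]; last by do 2!case: ifP => _; rewrite ?addr0 ?add0r ?addr_ge0.
have : 2 * t < (event_count (crowded psi A) v)%:R + (event_count (crowded psi A) (rev v))%:R.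
  by apply: lt_le_trans big _; rewrite -natrD ler_nat.
case: ifP => h1; first by rewrite lerDl; case: ifP.
case: ifP => h2; first by rewrite add0r.
by move: h1 h2 => /negbT + /negbT; rewrite -!ltNge => h1 h2 h3; lra.
Qed.

End CrowdingTail.

(** * Chernoff bounds for Bernoulli and Poisson counts *)

Lemma bernoulli_tail (R : realType) (p : R) (m : nat) : 0 <= p <= 1 ->
  \sum_(v : m.-tuple bool | ((count id v)%:R < p * (1 - expR (- 1)) / 2 * m%:R)%R)
    \prod_(x <- v) (if x then p else 1 - p) <=
    expR (- (p * (1 - expR (- 1)) / 2 * m%:R)).
Proof.
move=> /andP[p0 p1]; set r := p * (1 - expR (- 1)).
have e1 : expR (- 1) <= 1 :> R by rewrite expR_le1; lra.
have e0 := expR_gt0 (- 1 : R).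
have q0 b : 0 <= (if b then p else 1 - p) by case: b => //; lra.
have r1 : 0 <= 1 - r.
  have : p * (1 - expR (- 1)) <= 1 * 1 by rewrite ler_pM //; lra.
  by rewrite /r; lra.
have wE (s : seq bool) :
    iter_weight (fun (b : bool) _ => expR (- b%:R)) s = expR (- (count id s)%:R) :> R.
  elim: s => [|b s IH] /=; first by rewrite oppr0 expR0.
  by rewrite IH -expRD natrD opprD.
(* One observation contributes the mean of [exp(- b)], which is [1 - r]; the threshold is half of
   the exponent [r m] gained in this way. *)
apply: le_trans (_ : expR (r / 2 * m%:R) * (1 - r) ^+ m <= _).
  apply: (@sum_bad_le R bool (fun b => if b then p else 1 - p) q0
    (fun (b : bool) _ => expR (- b%:R)) (1 - r) m
    (fun v => (count id v)%:R < r / 2 * m%:R)) => //.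
  - move=> s _; rewrite big_bool /= oppr0 expR0 /r; lra.
  - move=> v _ h; rewrite wE -expRD -[leLHS]expR0 ler_expR; lra.
have rE : (1 - r) ^+ m <= expR (- (r * m%:R)).
  have -> : - (r * m%:R) = m%:R * (- r) by ring.
  by rewrite expRM_natl lerXn2r ?nnegrE ?expR_ge0 // expR_ge1Dx.
apply: le_trans (ler_wpM2l (expR_ge0 _) rE) _.
by rewrite -expRD ler_expR; lra.
Qed.

Section PoissonTails.
Context {R : realType}.

Lemma sum_exp_coeff_le (x : R) (n : nat) : 0 <= x ->
  \sum_(0 <= k < n) x ^+ k / k`!%:R <= expR x.
Proof.
move=> x0; rewrite /expR.
have nd : {homo series (exp_coeff x) : m m' / (m <= m')%N >-> m <= m'}.
  by move=> m m' mm'; apply: nondecreasing_series mm' => k _ _; rewrite divr_ge0 // exprn_ge0.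
exact: (nondecreasing_cvgn_le nd (is_cvg_series_exp_coeff x) n).
Qed.

(** For [k < n] the factor [exp(n - k)] is at least 1, and the tilted weights are terms of the
    exponential series at [r / e]. *)
Lemma poisson_lower_tail (r : R) (n : nat) : 0 < r ->
  \sum_(0 <= k < n) poisson_pmf r k <= expR (n%:R - (1 - expR (- 1)) * r).
Proof.
move=> r0.
have -> : expR (n%:R - (1 - expR (- 1)) * r) =
    expR (n%:R - r) * expR (expR (- 1) * r) by rewrite -expRD; congr expR; ring.
have er0 : 0 <= expR (- 1) * r by rewrite mulr_ge0 ?expR_ge0 // ltW.
apply: le_trans (ler_wpM2l (expR_ge0 _) (sum_exp_coeff_le n er0)).
rewrite mulr_sumr !big_nat; apply: ler_sum => k /andP[_ kn].
rewrite /poisson_pmf r0 exprMn -expRM_natl.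
have -> : r ^+ k / k`!%:R * expR (- r) = expR (- r) * (r ^+ k / k`!%:R) by ring.
have -> : expR (n%:R - r) * (expR (k%:R * -1) * r ^+ k / k`!%:R) =
   expR (n%:R - r) * expR (k%:R * -1) * (r ^+ k / k`!%:R) by ring.
apply: ler_wpM2r; first by rewrite divr_ge0 // exprn_ge0 // ltW.
rewrite -expRD ler_expR; suff : k%:R <= n%:R :> R by lra.
by rewrite ler_nat ltnW.
Qed.

(** Phrased through the complementary partial sum, which is a finite sum and the form in which the
    law of [npairs] is used. The terms with [k >= n] are tilted by [exp(k - n)]. *)
Lemma poisson_upper_tail (r : R) (n : nat) : 0 < r ->
  1 - expR ((expR 1 - 1) * r - n%:R) <= \sum_(0 <= k < n) poisson_pmf r k.
Proof.
move=> r0.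
have -> : \sum_(0 <= k < n) poisson_pmf r k =
    expR (- r) * \sum_(0 <= k < n) r ^+ k / k`!%:R.
  by rewrite mulr_sumr; apply: eq_bigr => k _; rewrite /poisson_pmf r0 mulrC.
have tail : expR r <= \sum_(0 <= k < n) r ^+ k / k`!%:R + expR (expR 1 * r - n%:R).
  rewrite {1}/expR; apply: limr_le; first exact: is_cvg_series_exp_coeff.
  near=> N; have nN : (n <= N)%N by near: N; exact: nbhs_infty_ge.
  rewrite seriesEnat /= (big_cat_nat (n := n)) //= lerD2l.
  have er0 : 0 <= expR 1 * r by rewrite mulr_ge0 ?expR_ge0 // ltW.
  rewrite addrC expRD; apply: le_trans (ler_wpM2l (expR_ge0 _) (sum_exp_coeff_le N er0)).
  rewrite mulr_sumr [leRHS](big_cat_nat (n := n)) //= -[leLHS]add0r lerD //.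
    by apply: sumr_ge0 => k _; rewrite mulr_ge0 ?expR_ge0 // divr_ge0 // exprn_ge0.
  rewrite big_nat [leRHS]big_nat; apply: ler_sum => k /andP[nk _].
  rewrite /exp_coeff exprMn -expRM_natl mulr1.
  have -> : expR (- n%:R) * (expR k%:R * r ^+ k / k`!%:R) =
      expR (k%:R - n%:R) * (r ^+ k / k`!%:R) by rewrite expRD; ring.
  rewrite ler_peMl ?divr_ge0 ?exprn_ge0 ?(ltW r0) //.
  by apply: le_trans (expR_ge1Dx _); rewrite lerDl subr_ge0 ler_nat.
have := ler_wpM2l (expR_ge0 (- r)) tail.
rewrite -expRD addNr expR0 mulrDr -expRD.
have -> : - r + (expR 1 * r - n%:R) = (expR 1 - 1) * r - n%:R by ring.
lra.
Unshelve. all: by end_near.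
Qed.

End PoissonTails.

(** * The good event *)

Lemma bigsetU_sup (T : Type) (I : finType) (p : pred I) (F : I -> set T) (i : I) :
  p i -> F i `<=` \big[setU/set0]_(j | p j) F j.
Proof. by move=> pi; rewrite (bigD1 i) //=; exact: subsetUl. Qed.

Section Independent.
Context {d : measure_display} {T : measurableType d} {R : realType}.
Variable P : probability T R.

(** Extracts one sequence of sources, such as the pairs, from the joint independence: [S] embeds its
    indices among all sources and [g] recovers them. *)
Lemma independent_prod (I : eqType) (Fam : I -> set (set T)) (S : nat -> I)
    (g : I -> nat) (B : nat -> set T) (m : nat) :
  mutually_independent P Fam -> cancel S g -> (forall i, Fam (S i) (B i)) ->
  P [set w | forall i, (i < m)%N -> B i w] = (\prod_(0 <= i < m) P (B i))%E.
Proof.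
move=> ind gS hB.
have := ind (map S (iota 0 m)) (fun j => B (g j)).
rewrite map_inj_uniq ?iota_uniq; last exact: can_inj gS.
move=> /(_ isT) h.
rewrite /index_iota subn0 -[RHS](eq_bigr _ (fun i _ => erefl (P (B i)))).
under [RHS]eq_bigr do rewrite -{1}[X in B X]gS.
rewrite -(big_map S xpredT (fun j => P (B (g j)))) -h; last first.
  by move=> _ /mapP[i _ ->]; rewrite gS.
congr (P _); apply/seteqP; split => [w hw j /= /mapP[i im ->]|w hw i im].
  by rewrite gS; apply: hw; rewrite mem_iota in im.
have := hw (S i); rewrite gS; apply; rewrite /=.
by apply: map_f; rewrite mem_iota.
Qed.

Lemma probability_bigsetU_le (I : finType) (p : pred I) (F : I -> set T) :
  (forall i, measurable (F i)) ->
  (P (\big[setU/set0]_(i | p i) F i) <= \sum_(i | p i) P (F i))%E.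
Proof.
move=> mF.
suff [] : measurable (\big[setU/set0]_(i | p i) F i) /\
    (P (\big[setU/set0]_(i | p i) F i) <= \sum_(i | p i) P (F i))%E by [].
elim/big_ind2: _ => [|A x B y [mA hA] [mB hB]|i _]; split => //.
- by rewrite measure0.
- exact: measurableU.
by apply: le_trans (measureU2 _ mA mB) _; exact: leeD.
Qed.

Lemma sum_probability_le (F : nat -> set T) (B : set T) (n : nat) :
  (forall i, measurable (F i)) -> trivIset setT F -> measurable B ->
  (forall i, F i `<=` B) -> (\sum_(i < n) P (F i) <= P B)%E.
Proof.
move=> mF tF mB FB; rewrite -measure_bigsetU //.
apply: le_measure; rewrite ?inE //; first exact: bigsetU_measurable.
by move=> w; rewrite -bigcup_mkord => -[i _]; exact: FB.
Qed.

(** Carries a bound on finite sums over label words to the probability space. The event is the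
    union, over bad words, of the sets where the points carry that word; measurability is thus
    required of the sets [Ev i x] and not of a labelling. *)
Lemma bad_labels_event (F : finType) (Ev : nat -> F -> set T) (q : F -> R)
    (m : nat) (bad : pred (seq F)) (x0 : F) :
  (forall i x, measurable (Ev i x)) ->
  (forall v : seq F, size v = m ->
    P [set w | forall i, (i < m)%N -> Ev i (nth x0 v i) w] =
      (\prod_(x <- v) q x)%:E) ->
  exists B : set T, [/\ measurable B,
    (P B <= (\sum_(v : m.-tuple F | bad v) \prod_(x <- v) q x)%:E)%E &
    forall (f : nat -> F) w, (forall i, (i < m)%N -> Ev i (f i) w) -> ~ B w ->
      ~~ bad (mkseq f m)].
Proof.
move=> mEv hP.
pose C (v : m.-tuple F) := [set w | forall i, (i < m)%N -> Ev i (nth x0 v i) w].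
have mC v : measurable (C v).
  have -> : C v = \bigcap_(i in [set i | (i < m)%N]) Ev i (nth x0 v i).
    by apply/seteqP; split.
  by apply: fin_bigcap_measurable => //; exact: finite_II.
exists (\big[setU/set0]_(v : m.-tuple F | bad v) C v); split.
- by apply: bigsetU_measurable => v _.
- apply: le_trans (probability_bigsetU_le _ mC) _.
  by rewrite -sumEFin; apply: lee_sum => v _; rewrite hP ?size_tuple.
move=> f w hf hB; apply/negP => bf; apply: hB.
have sz : size (mkseq f m) == m by rewrite size_mkseq.
apply: (@bigsetU_sup T _ (fun v : m.-tuple F => bad v) C (Tuple sz)) => //.
by move=> i im /=; rewrite nth_mkseq //; exact: hf.
Qed.

End Independent.

Lemma sum_kernel_le (R : realType) (N l : nat) (m : R) : 0 < m ->
  \sum_(k < N) expR (- ((ndist k l)%:R / m)) <= 2 * (m + 1).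
Proof.
move=> m0; set g := expR (- m^-1).
have g0 : 0 < g by exact: expR_gt0.
have mi : 0 < m^-1 by rewrite invr_gt0.
have g1 : g * (1 + m^-1) <= 1.
  have := ler_wpM2l (ltW g0) (expR_ge1Dx m^-1).
  by rewrite /g -expRD addNr expR0.
have gle1 : g <= 1 by rewrite /g expR_le1; lra.
have -> : \sum_(k < N) expR (- ((ndist k l)%:R / m)) = \sum_(k < N) g ^+ ndist k l.
  by apply: eq_bigr => k _; rewrite -expRM_natl mulrN.
suff h : (1 - g) * \sum_(k < N) g ^+ ndist k l <= 2.
  have S0 : 0 <= \sum_(k < N) g ^+ ndist k l.
    by apply: sumr_ge0 => k _; rewrite exprn_ge0 // ltW.
  have mg : 1 <= (m + 1) * (1 - g).
    have : m * (g * (1 + m^-1)) <= m * 1 by rewrite ler_wpM2l // ltW.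
    have -> : m * (g * (1 + m^-1)) = m * g + g by field; rewrite gt_eqF.
    lra.
  have m1 : 0 <= m + 1 by lra.
  have := ler_wpM2l m1 h; rewrite mulrA.
  have := ler_wpM2r S0 mg; lra.
(* The telescoped value of [1 - g] times the partial sum up to [M], without its negative term
   [- g^(l + 1)]. *)
pose h M : R := if (M <= l)%N then g ^+ (l.+1 - M) else 1 + g - g ^+ (M - l).
suff hN : (1 - g) * \sum_(k < N) g ^+ ndist k l <= h N.
  apply: le_trans hN _; rewrite /h; case: ifP => _; last first.
    have : 0 <= g ^+ (N - l) by rewrite exprn_ge0 // ltW.
    lra.
  have : g ^+ (l.+1 - N) <= 1 by rewrite exprn_ile1 // ltW.
  lra.
elim: N => [|N IH].
  by rewrite big_ord0 mulr0 /h leq0n exprn_ge0 // ltW.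
rewrite big_ord_recr /= mulrDr; apply: le_trans (lerD IH (lexx _)) _.
rewrite /h /ndist; case: (ltngtP N l) => Nl.
- have -> : (l.+1 - N = (l - N).+1)%N by lia.
  have -> : (N - l + (l - N) = l - N)%N by lia.
  by rewrite subSS exprS; lra.
- have -> : (N.+1 - l = (N - l).+1)%N by lia.
  have -> : (N - l + (l - N) = N - l)%N by lia.
  by rewrite exprS; lra.
rewrite Nl subnn subSn // subnn expr1 expr0; lra.
Qed.

(** * Rounding to blocks of length 1 / n *)

Section Blocks.
Context {R : realType}.
Variable n : nat.
Hypothesis n_gt0 : (0 < n)%N.

Let n0 : 0 < n%:R :> R. Proof. by rewrite ltr0n. Qed.

Definition block (k : nat) : set R := `[k%:R / n%:R, k.+1%:R / n%:R[%classic.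

Definition block_index (z : R) : nat := Num.truncn (n%:R * z).

Lemma blockP (k : nat) (z : R) :
  block k z <-> k%:R <= n%:R * z < k.+1%:R.
Proof.
by rewrite /block /= in_itv /= ler_pdivrMr // ltr_pdivlMr // [z * _]mulrC.
Qed.

Lemma block_index_in (z : R) : 0 <= z -> block (block_index z) z.
Proof. by move=> z0; apply/blockP/truncn_itv; rewrite mulr_ge0. Qed.

Lemma block_index_lt (z : R) : 0 <= z <= 1 -> (block_index z < n.+1)%N.
Proof.
move=> /andP[z0 z1]; rewrite /block_index truncn_lt_nat ?mulr_ge0 //.
apply: (@le_lt_trans _ _ (n%:R * 1)); first by rewrite ler_pM2l.
by rewrite mulr1 ltr_nat.
Qed.

Lemma measurable_block k : measurable (block k).
Proof. exact: measurable_itv. Qed.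

Lemma trivIset_block : trivIset setT block.
Proof.
move=> k l _ _ [z [/blockP/andP[k1 k2] /blockP/andP[l1 l2]]].
have := le_lt_trans k1 l2; have := le_lt_trans l1 k2; rewrite !ltr_nat; lia.
Qed.

Lemma block_measure_le k :
  (lebesgue_measure (block k `&` `[0%R, 1%R]) <= (n%:R^-1)%:E :> \bar R)%E.
Proof.
have -> : (n%:R^-1)%:E = lebesgue_measure (block k) :> \bar R.
  rewrite /block lebesgue_measure_itv /= lte_fin ltr_pM2r ?invr_gt0 // ltr_nat ltnSn.
  by rewrite -EFinB -mulrBl -natrB // subSnn mul1r.
apply: le_measure; rewrite ?inE; last exact: subIsetl.
  by apply: measurableI; [exact: measurable_block|exact: measurable_itv].
exact: measurable_block.
Qed.

(** Blocks are half-open, so the point 1 needs a block of index [n]; hence [n + 1] indices per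
    coordinate. *)
Definition cell (x : 'I_n.+1 * 'I_n.+1) : set (R * R) := block x.1 `*` block x.2.

Definition cell_index (z : R * R) : 'I_n.+1 * 'I_n.+1 :=
  (inord (block_index z.1), inord (block_index z.2)).

Lemma cell_index_in z : square z -> cell (cell_index z) z.
Proof.
move=> [z1 z2]; move: z1 z2; rewrite /= !in_itv /= => z1 z2.
split; rewrite /= inordK ?block_index_lt //; apply: block_index_in.
  by case/andP: z1.
by case/andP: z2.
Qed.

Lemma measurable_cell x : measurable (cell x).
Proof. by apply: measurableX; exact: measurable_block. Qed.

End Blocks.

Section GoodEvent.
Context {R : realType} {d : measure_display} {T : measurableType d}.
Context {P : probability T R} {Lam V : R -> R} {p : R} {n : nat}.
Variable W : partial_matching P Lam V p n.
Hypothesis n_gt0 : (0 < n)%N.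
Hypothesis p01 : 0 < p < 1.
Variable rho : R.
Hypothesis strip_le : forall A : set R, measurable A ->
  (\int[lebesgue_measure \x lebesgue_measure]_(z in (A `*` setT) `&` @square R)
     (pn Lam V n z.1 z.2)%:E <= rho%:E * lebesgue_measure (A `&` `[0%R, 1%R]))%E.
Hypothesis square_le :
  (\int[lebesgue_measure \x lebesgue_measure]_(z in @square R)
     (pn Lam V n z.1 z.2)%:E = 1)%E.
Hypothesis Zn_pos : 0 < Zn Lam V n.
Hypothesis rho_ge0 : 0 <= rho.

Local Notation cell_type := ('I_n.+1 * 'I_n.+1)%type.

Definition cell_prob (x : cell_type) : R :=
  fine (P (pairs W 0 @^-1` cell x)).

Lemma measurable_pairs i (A : set (R * R)) :
  measurable A -> measurable (pairs W i @^-1` A).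
Proof. by move=> mA; apply: measurable_funPTI. Qed.

Lemma pairs_prob i j (A : set (R * R)) : measurable A ->
  P (pairs W i @^-1` A) = P (pairs W j @^-1` A).
Proof. by move=> mA; rewrite !pairs_law. Qed.

Lemma cell_probE i (x : cell_type) :
  P (pairs W i @^-1` cell x) = (cell_prob x)%:E.
Proof.
rewrite (pairs_prob i 0); last exact: measurable_cell.
rewrite /cell_prob fineK //; apply: fin_num_measure.
by apply: measurable_pairs; exact: measurable_cell.
Qed.

Lemma cell_prob_ge0 x : 0 <= cell_prob x.
Proof. by rewrite -lee_fin -(cell_probE 0) measure_ge0. Qed.

Lemma sum_row_le_prob (k : 'I_n.+1) :
  ((\sum_(l < n.+1) cell_prob (k, l))%:E <=
   P (pairs W 0 @^-1` (block n k `*` setT)))%E.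
Proof.
rewrite -sumEFin.
rewrite (eq_bigr (fun l : 'I_n.+1 =>
  P (pairs W 0 @^-1` (block n k `*` block n l)))); last first.
  by move=> l _; rewrite -(cell_probE 0).
apply: (@sum_probability_le _ _ _ P (fun l => pairs W 0 @^-1` (block n k `*` block n l))).
- by move=> l; apply: measurable_pairs; apply: measurableX; exact: measurable_block.
- move=> l l' _ _ [w [/= [_ h1] [_ h2]]].
  by apply: (@trivIset_block R n n_gt0 l l') => //; exists (pairs W 0 w).2.
- by apply: measurable_pairs; apply: measurableX; [exact: measurable_block|].
by move=> l w [].
Qed.

Lemma sum_row_le (k : 'I_n.+1) : \sum_(l < n.+1) cell_prob (k, l) <= rho / n%:R.
Proof.
rewrite -lee_fin; apply: le_trans (sum_row_le_prob k) _.
rewrite pairs_law; last by apply: measurableX; [exact: measurable_block|].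
apply: le_trans (strip_le (measurable_block n k)) _.
rewrite EFinM lee_wpmul2l ?lee_fin //; exact: block_measure_le.
Qed.

Lemma sum_cell_prob_le1 : \sum_x cell_prob x <= 1.
Proof.
rewrite -(pair_bigA _ (fun k l => cell_prob (k, l))) /= -lee_fin -sumEFin.
apply: (@le_trans _ _ (\sum_(k < n.+1) P (pairs W 0 @^-1` (block n k `*` setT)))%E).
  by apply: lee_sum => k _; exact: sum_row_le_prob.
apply: (@le_trans _ _ (P setT)); last by rewrite probability_setT.
apply: (@sum_probability_le _ _ _ P (fun k => pairs W 0 @^-1` (block n k `*` setT))) => //.
- by move=> k; apply: measurable_pairs; apply: measurableX; [exact: measurable_block|].
move=> k k' _ _ [w [/= [h1 _] [h2 _]]].
by apply: (@trivIset_block R n n_gt0 k k') => //; exists (pairs W 0 w).1.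
Qed.

Lemma pairs_indep (m : nat) (v : seq cell_type) x0 : size v = m ->
  P [set w | forall i, (i < m)%N -> (pairs W i @^-1` cell (nth x0 v i)) w] =
  (\prod_(x <- v) cell_prob x)%:E.
Proof.
move=> sv.
rewrite (independent_prod (S := Pair) (g := fun s => if s is Pair i then i else 0%N)
  (B := fun i => pairs W i @^-1` cell (nth x0 v i)) m (@sources_indep _ _ _ _ _ _ _ _ W)) //.
  rewrite (eq_bigr (fun i => (cell_prob (nth x0 v i))%:E)); last first.
    by move=> i _; rewrite cell_probE.
  by rewrite prodEFin (big_nth x0) sv.
move=> i; exists (cell (nth x0 v i)); last by rewrite setTI.
exact: measurable_cell.
Qed.

Lemma measurable_obsX i b : measurable (obsX W i @^-1` [set b]).
Proof. by apply: measurable_funPTI. Qed.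

Lemma obsX_indep (m : nat) (v : seq bool) x0 : size v = m ->
  P [set w | forall i, (i < m)%N -> (obsX W i @^-1` [set nth x0 v i]) w] =
  (\prod_(x <- v) (if x then p else 1 - p))%:E.
Proof.
move=> sv.
rewrite (independent_prod (S := ObsX) (g := fun s => if s is ObsX i then i else 0%N)
  (B := fun i => obsX W i @^-1` [set nth x0 v i]) m (@sources_indep _ _ _ _ _ _ _ _ W)) //.
  rewrite (eq_bigr (fun i => (if nth x0 v i then p else 1 - p)%:E)); last first.
    move=> i _; case: (nth x0 v i); first exact: obsX_law.
    have -> : obsX W i @^-1` [set false] = ~` (obsX W i @^-1` [set true]).
      by apply/seteqP; split => w /=; case: (obsX W i w).
    by rewrite probability_setC ?obsX_law //; exact: measurable_obsX.
  by rewrite prodEFin (big_nth x0) sv.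
by move=> i; exists [set nth x0 v i]; rewrite ?setTI.
Qed.

Let lam := (1 - p) ^- 2 * (Zn Lam V n)^-1.

Let lam_gt0 : 0 < lam.
Proof. by rewrite mulr_gt0 ?invr_gt0 ?exprn_gt0 //; case/andP: p01 => _ ?; lra. Qed.

Lemma measurable_npairs A : measurable (npairs W @^-1` A).
Proof. by apply: measurable_funPTI. Qed.

Lemma npairs_prob (m : nat) :
  P [set w | (npairs W w < m)%N] = (\sum_(0 <= k < m) poisson_pmf lam k)%:E.
Proof.
have -> : [set w | (npairs W w < m)%N] =
    \big[setU/set0]_(k < m) (npairs W @^-1` [set nat_of_ord k]).
  apply/seteqP; split => [w hw|w].
    apply: (@bigsetU_sup T _ xpredT (fun k : 'I_m => npairs W @^-1` [set nat_of_ord k])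
      (Ordinal hw)) => //.
  by rewrite -(bigcup_mkord m (fun k => npairs W @^-1` [set k])) => -[k /= km ->].
rewrite (measure_bigsetU P (F := fun k => npairs W @^-1` [set k])); last 2 first.
- by move=> k; exact: measurable_npairs.
- by move=> k l _ _ [w [/= <-]].
rewrite big_mkord -sumEFin; apply: eq_bigr => k _; exact: npairs_law.
Qed.

(** Observations are counted among the first [m0] pairs, positions and crowding among the first
    [m1]. As [m0 <= npairs < m1] on the event, this controls the pairs actually drawn, and a union
    bound replaces conditioning on their number. The error terms are, in order: too few pairs, too
    many pairs, too few observations, too many crowded pairs. *)
Lemma good_event_exists (q m0 m1 : nat) (eta : R) : (2 <= q)%N ->
  let psi (x y : cell_type) : R := expR (- ((ndist x.1 y.1)%:R / (q ^ 4)%:R)) +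
    expR (- ((ndist x.1 y.2)%:R / (q ^ 4)%:R)) in
  let cp : R := p * (1 - expR (- 1)) / 2 in
  m1%:R * (rho / n%:R * (8 * q%:R ^+ 4)) / (q%:R ^+ 5 / 4) <= eta ->
  exists E : set T, [/\ measurable E,
    ((1 - (expR (m0%:R - (1 - expR (- 1)) * lam) + expR ((expR 1 - 1) * lam - m1%:R)
        + expR (- (cp * m0%:R)) + 2 * expR (- (eta * m1%:R))))%:E <= P E)%E &
    forall w, E w -> [/\ (m0 <= npairs W w < m1)%N,
      cp * m0%:R <= (count (fun i => obsX W i w) (iota 0 m0))%:R,
      (forall i, (i < m1)%N -> square (pairs W i w)) &
      (crowd_number psi (q%:R ^+ 5) (ord0, ord0)
         (mkseq (fun i => cell_index n (pairs W i w)) m1))%:R <=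
        2 * (expR 1 * eta * m1%:R)]].
Proof.
move=> q2 psi cp heta.
have q0 : 2 <= q%:R :> R by rewrite ler_nat.
have q4 : 0 < (q ^ 4)%:R :> R by rewrite ltr0n expn_gt0; lia.
have psi0 x y : 0 <= psi x y by rewrite addr_ge0 ?expR_ge0.
have psi2 x y : psi x y <= 2.
  have e1 k l : expR (- ((ndist k l)%:R / (q ^ 4)%:R)) <= 1 :> R.
    by rewrite expR_le1 oppr_le0 divr_ge0 // ltW.
  have h1 := e1 x.1 y.1; have h2 := e1 x.1 y.2; rewrite /psi; lra.
have q5 : 32 <= q%:R ^+ 5 :> R.
  have -> : 32 = (2 ^ 5)%:R :> R by [].
  by rewrite -natrX ler_nat leq_exp2r.
(* The one-sided threshold is [q^5 / 4]: twice this plus the self-term, at most 2, stays below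
   [q^5]. *)
have A0 : 0 < q%:R ^+ 5 / 4 :> R by lra.
have Bge x : 2 * (q%:R ^+ 5 / 4) + psi x x <= q%:R ^+ 5.
  by have := psi2 x x; lra.
have rn0 : 0 <= rho / n%:R by rewrite divr_ge0.
have q41 : 1 <= q%:R ^+ 4 :> R by rewrite exprn_ege1 //; lra.
(* Each row has mass at most [rho / n], and each of the two kernels sums to at most
   [2 (q^4 + 1) <= 4 q^4]. *)
have psum y : \sum_x cell_prob x * psi x y <= rho / n%:R * (8 * q%:R ^+ 4).
  rewrite -(pair_bigA _ (fun k l => cell_prob (k, l) * psi (k, l) y)) /=.
  apply: (@le_trans _ _ (\sum_(k < n.+1) rho / n%:R * psi (k, ord0) y)).
    apply: ler_sum => k _; rewrite (eq_bigr (fun l => cell_prob (k, l) * psi (k, ord0) y)) //.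
    by rewrite -mulr_suml ler_wpM2r ?sum_row_le.
  rewrite -mulr_sumr ler_wpM2l // /psi big_split /=.
  have h1 := @sum_kernel_le R n.+1 y.1 _ q4.
  have h2 := @sum_kernel_le R n.+1 y.2 _ q4.
  rewrite natrX in h1 h2 *.
  by lra.
have crowdT := crowd_number_tail (ord0, ord0) cell_prob_ge0 sum_cell_prob_le1
  psi0 A0 Bge psum heta.
have [B4 [mB4 PB4 hB4]] := @bad_labels_event _ _ _ P _ (fun i x => pairs W i @^-1` cell x)
  cell_prob m1 (fun v => 2 * (expR 1 * eta * m1%:R) <
     (crowd_number psi (q%:R ^+ 5) (ord0, ord0) v)%:R) (ord0, ord0)
  (fun i x => measurable_pairs i (measurable_cell x))
  (fun v sv => pairs_indep (ord0, ord0) sv).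
have p01' : 0 <= p <= 1 by case/andP: p01 => *; apply/andP; split; exact: ltW.
have bernT := bernoulli_tail m0 p01'.
have [B3 [mB3 PB3 hB3]] := @bad_labels_event _ _ _ P _ (fun i b => obsX W i @^-1` [set b])
  (fun b => if b then p else 1 - p) m0 (fun v => (count id v)%:R < cp * m0%:R) false
  measurable_obsX (fun v sv => obsX_indep false sv).
pose B1 := [set w | (npairs W w < m0)%N].
pose B2 := ~` [set w | (npairs W w < m1)%N].
have mlt m : measurable [set w | (npairs W w < m)%N].
  by have := measurable_npairs [set k | (k < m)%N].
have mB1 : measurable B1 by exact: mlt.
have mB2 : measurable B2 by apply: measurableC; exact: mlt.
have PB1 : (P B1 <= (expR (m0%:R - (1 - expR (- 1)) * lam))%:E)%E.
  by rewrite /B1 npairs_prob lee_fin poisson_lower_tail.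
have PB2 : (P B2 <= (expR ((expR 1 - 1) * lam - m1%:R))%:E)%E.
  rewrite /B2 probability_setC // npairs_prob -EFinB lee_fin.
  by have := poisson_upper_tail m1 lam_gt0; lra.
(* A null event, since the density has total mass 1 on the square; removing it makes the bounds on
   [[0, 1]] available at every sample. *)
pose B5 := \big[setU/set0]_(i < m1) (pairs W i @^-1` ~` @square R).
have msq : measurable (@square R) by exact: square_measurable.
have mB5i (i : 'I_m1) : measurable (pairs W i @^-1` ~` @square R).
  by apply: measurable_pairs; exact: measurableC.
have mB5 : measurable B5 by apply: bigsetU_measurable.
have PB5 : (P B5 <= 0)%E.
  apply: le_trans (probability_bigsetU_le P _ mB5i) _.
  rewrite big1 // => i _; rewrite -preimage_setC probability_setC; last first.
    exact: measurable_pairs.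
  by rewrite pairs_law // setIid square_le subee.
pose B := B1 `|` B2 `|` B3 `|` B4 `|` B5.
have mB12 : measurable (B1 `|` B2) by exact: measurableU.
have mB123 : measurable (B1 `|` B2 `|` B3) by exact: measurableU.
have mB1234 : measurable (B1 `|` B2 `|` B3 `|` B4) by exact: measurableU.
have mB : measurable B by exact: measurableU.
exists (~` B); split; first exact: measurableC.
  rewrite probability_setC // EFinB leeB //.
  rewrite !EFinD -[leRHS]adde0.
  apply: le_trans (measureU2 _ mB1234 mB5) _; apply: leeD PB5.
  apply: le_trans (measureU2 _ mB123 mB4) _; apply: leeD; last first.
    by apply: le_trans PB4 _; rewrite lee_fin.
  apply: le_trans (measureU2 _ mB12 mB3) _; apply: leeD; last first.
    by apply: le_trans PB3 _; rewrite lee_fin.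
  by apply: le_trans (measureU2 _ mB1 mB2) _; exact: leeD.
move=> w nB.
have nB1 : ~ B1 w by move=> h; apply: nB; do 4!left.
have nB2 : ~ B2 w by move=> h; apply: nB; do 3!left; right.
have nB3 : ~ B3 w by move=> h; apply: nB; do 2!left; right.
have nB4 : ~ B4 w by move=> h; apply: nB; left; right.
have nB5 : ~ B5 w by move=> h; apply: nB; right.
have sq i : (i < m1)%N -> square (pairs W i w).
  move=> im; apply: contrapT => nsq; apply: nB5.
  by apply: (@bigsetU_sup T _ xpredT (fun i : 'I_m1 => pairs W i @^-1` ~` @square R)
    (Ordinal im)).
split => //.
- apply/andP; split; first by rewrite leqNgt; apply/negP.
  by apply: contrapT => h; apply: nB2.
- have := hB3 (fun i => obsX W i w) w (fun i _ => erefl) nB3.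
  rewrite -leNgt /mkseq count_map => h; apply: le_trans h _.
  by rewrite ler_nat; apply/eq_leq/eq_count.
have := hB4 (fun i => cell_index n (pairs W i w)) w _ nB4.
rewrite -leNgt; apply => i im; exact/cell_index_in/sq.
Qed.

End GoodEvent.

(** * Conclusion *)

(** Passes from listed samples to pairs: the labels of a shuffled list are distinct, so a sum of
    non-negative terms over them is at most the sum over all pairs. Neither the order nor the
    selection of the samples matters then. *)
Lemma sum_injective_label_le (R : realType) (a m : nat) (lab : 'I_a -> nat)
    (f : nat -> R) : injective lab -> (forall i, (lab i < m)%N) ->
  (forall l, 0 <= f l) -> \sum_(i < a) f (lab i) <= \sum_(l < m) f l.
Proof.
move=> inj lt f0; pose h i := Ordinal (lt i).
have hinj : injective h by move=> i j /(congr1 val) /inj.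
rewrite (bigID (mem [set h i | i in 'I_a]%SET)) /= -[leLHS]addr0 lerD ?sumr_ge0 //.
by rewrite big_imset /= => [|i j _ _ /hinj].
Qed.

Section Observation.
Context {d : measure_display} {T : measurableType d} {R : realType}.
Context {P : probability T R} {Lam V : R -> R} {p : R} {n : nat}.
Variables (W : partial_matching P Lam V p n) (w : T).

Lemma labelX_inj : injective (labelX (W := W) (w := w)).
Proof.
move=> i j /eqP; rewrite /labelX nth_uniq // ?filter_uniq ?iota_uniq //.
by move=> /eqP /val_inj /perm_inj.
Qed.

Lemma labelY_inj : injective (labelY (W := W) (w := w)).
Proof.
move=> i j /eqP; rewrite /labelY nth_uniq // ?filter_uniq ?iota_uniq //.
by move=> /eqP /val_inj /perm_inj.
Qed.

Lemma labelX_lt (i : 'I_(NX W w)) : (labelX i < npairs W w)%N.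
Proof.
have : labelX i \in observedX W w by apply: mem_nth.
by rewrite mem_filter mem_iota => /andP[].
Qed.

Lemma labelY_lt (j : 'I_(NY W w)) : (labelY j < npairs W w)%N.
Proof.
have : labelY j \in observedY W w by apply: mem_nth.
by rewrite mem_filter mem_iota => /andP[].
Qed.

Lemma NX_ge (m : nat) : (m <= npairs W w)%N ->
  (count (fun i => obsX W i w) (iota 0 m) <= NX W w)%N.
Proof.
move=> mN; rewrite /NX /observedX size_filter.
by rewrite -(subnKC mN) iotaD count_cat leq_addr.
Qed.

End Observation.

Section Samples.
Context {R : realType}.
Variables (Lam V : R -> R) (n : nat) (c1 u : R).
Hypothesis n_gt0 : (0 < n)%N.
Hypothesis V_ge : forall t, - V t <= c1 - `|t|.
Hypothesis Un_ge : forall x : R, 0 <= x <= 1 -> u <= Un Lam V n x.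

Let n0 : 0 < n%:R :> R. Proof. by rewrite ltr0n. Qed.

Lemma ndist_block_index (x y : R) : 0 <= x -> 0 <= y ->
  (ndist (block_index n x) (block_index n y))%:R <= `|n%:R * (x - y)| + 1.
Proof.
move=> x0 y0; rewrite mulrBr.
have /andP[x1 x2] := truncn_itv (mulr_ge0 (ltW n0) x0).
have /andP[y1 y2] := truncn_itv (mulr_ge0 (ltW n0) y0).
rewrite /block_index; move: x1 x2 y1 y2.
move: (Num.truncn _) (Num.truncn _) => k l x1 x2 y1 y2.
have h1 := ler_norm (n%:R * x - n%:R * y).
have h2 := ler_norm (- (n%:R * x - n%:R * y)); rewrite normrN in h2.
rewrite -natr1 in x2; rewrite -natr1 in y2.
rewrite /ndist natrD; case: (leqP k l) => kl.
  have -> : (k - l = 0)%N by apply/eqP; rewrite subn_eq0.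
  by rewrite (natrB _ kl); lra.
have -> : (l - k = 0)%N by apply/eqP; rewrite subn_eq0 ltnW.
by rewrite (natrB _ (ltnW kl)); lra.
Qed.

Context {a b : nat}.
Variables (x : 'I_a -> R) (y : 'I_b -> R).
Hypothesis x01 : forall i, 0 <= x i <= 1.
Hypothesis y01 : forall j, 0 <= y j <= 1.

(** In the constant, 1 pays for rounding positions to blocks and [- 2 * u] for the potentials of the
    two ends. *)
Lemma edge_weight_le_exp i j : edge_weight Lam V n x y i j <=
  expR (c1 + 1 - 2 * u) *
    expR (- (ndist (block_index n (x i)) (block_index n (y j)))%:R).
Proof.
rewrite /edge_weight -expRD ler_expR.
have /andP[x0 _] := x01 i; have /andP[y0 _] := y01 j.
have h1 := V_ge (n%:R * (x i - y j)); have h2 := Un_ge (x01 i).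
have h3 := Un_ge (y01 j); have h4 := ndist_block_index x0 y0; lra.
Qed.

Lemma window_contains (z z' M : R) (m : nat) : 0 <= z <= 1 -> 0 <= z' <= 1 ->
  m%:R + 1 <= M -> (ndist (block_index n z) (block_index n z') <= m)%N ->
  Num.max 0 (((Num.floor (n%:R * z))%:~R - M) / n%:R) <= z' <=
  Num.min 1 (((Num.floor (n%:R * z))%:~R + M) / n%:R).
Proof.
move=> /andP[z0 z1] /andP[z'0 z'1] mM hm.
have /andP[k1 k2] := truncn_itv (mulr_ge0 (ltW n0) z0).
have /andP[l1 l2] := truncn_itv (mulr_ge0 (ltW n0) z'0).
have f1 : (Num.floor (n%:R * z))%:~R <= n%:R * z by exact: floor_le.
have f2 : (Num.truncn (n%:R * z))%:R <= (Num.floor (n%:R * z))%:~R :> R.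
  by rewrite [leLHS]pmulrn ler_int floor_ge_int -pmulrn.
have [h1 h2] : (Num.truncn (n%:R * z))%:R <= (Num.truncn (n%:R * z'))%:R + m%:R :> R /\
    (Num.truncn (n%:R * z'))%:R <= (Num.truncn (n%:R * z))%:R + m%:R :> R.
  by rewrite -!natrD !ler_nat; move: hm; rewrite /ndist /block_index; clear; lia.
(* The fractional parts of [n z] and [n z'] are below 1; this is what the extra 1 in [m + 1 <= M]
   absorbs. *)
rewrite -natr1 in k2; rewrite -natr1 in l2.
rewrite ge_max le_min z'0 z'1 /=; apply/andP; split.
  by rewrite ler_pdivrMr // [z' * _]mulrC; lra.
by rewrite ler_pdivlMr // [z' * _]mulrC; lra.
Qed.

Lemma TV_local_le (M : R) (q : nat) (i : 'I_a) : (2 <= q)%N ->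
  (q ^ 4)%:R + 1 <= M ->
  \sum_k expR (- ((ndist (block_index n (x i)) (block_index n (x k)))%:R / (q ^ 4)%:R)) +
  \sum_j expR (- ((ndist (block_index n (x i)) (block_index n (y j)))%:R / (q ^ 4)%:R))
    <= q%:R ^+ 5 :> R ->
  TV (posterior Lam V n x y i) (local_posterior Lam V n x y M i) <=
  (expR (2 * discrepancy_bound (expR (c1 + 1 - 2 * u)) q) - 1) +
  expR (c1 + 1 - 2 * u) * (expR 1 * q%:R ^+ 5) * expR (- (q%:R / 2)).
Proof.
move=> q2 qM crowd.
apply: (TV_window_le edge_weight_le_exp (expR_ge0 _) q2 crowd) => k hk.
  by rewrite inE /xminus /xplus; exact: window_contains hk.
by rewrite inE /xminus /xplus; exact: window_contains hk.
Qed.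

End Samples.

Section SumTV.
Context {d : measure_display} {T : measurableType d} {R : realType}.
Context {P : probability T R} {Lam V : R -> R} {p : R} {n : nat}.
Variables (W : partial_matching P Lam V p n) (w : T).
Variables (c1 u M C1 : R) (q m1 : nat).
Hypothesis n_gt0 : (0 < n)%N.
Hypothesis V_ge : forall t, - V t <= c1 - `|t|.
Hypothesis Un_ge : forall x : R, 0 <= x <= 1 -> u <= Un Lam V n x.
Hypothesis q_ge2 : (2 <= q)%N.
Hypothesis qM : (q ^ 4)%:R + 1 <= M.
Hypothesis C1_gt0 : 0 < C1.
Hypothesis local_error : forall t : R, t <= 1 ->
  t <= (expR (2 * discrepancy_bound (expR (c1 + 1 - 2 * u)) q) - 1) +
      expR (c1 + 1 - 2 * u) * (expR 1 * q%:R ^+ 5) * expR (- (q%:R / 2)) ->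
  t <= C1 / q%:R.
Hypothesis N_lt : (npairs W w < m1)%N.
Hypothesis in_sq : forall i, (i < m1)%N -> square (pairs W i w).

Let psi (x y : 'I_n.+1 * 'I_n.+1) : R :=
  expR (- ((ndist x.1 y.1)%:R / (q ^ 4)%:R)) +
  expR (- ((ndist x.1 y.2)%:R / (q ^ 4)%:R)).

Let cells := mkseq (fun i => cell_index n (pairs W i w)) m1.

(** An uncrowded sample costs [C1 / q], a crowded one at most 1. Crowding is tested against both
    coordinates of all the first [m1] pairs, which dominates the crowding by observed values
    alone. *)
Lemma sum_TV_le :
  \sum_(i < NX W w) TV (posterior Lam V n (sampleX W w) (sampleY W w) i)
      (local_posterior Lam V n (sampleX W w) (sampleY W w) M i) <=
  (NX W w)%:R * (C1 / q%:R) + (crowd_number psi (q%:R ^+ 5) (ord0, ord0) cells)%:R.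
Proof.
have sq l : (l < m1)%N -> 0 <= (pairs W l w).1 <= 1 /\ 0 <= (pairs W l w).2 <= 1.
  by move=> /in_sq /in_square.
have ltX i : (labelX (W := W) (w := w) i < m1)%N by apply: ltn_trans N_lt; exact: labelX_lt.
have ltY j : (labelY (W := W) (w := w) j < m1)%N by apply: ltn_trans N_lt; exact: labelY_lt.
have x01 i : 0 <= sampleX W w i <= 1 by have [] := sq _ (ltX i).
have y01 j : 0 <= sampleY W w j <= 1 by have [] := sq _ (ltY j).
pose kx l := block_index n (pairs W l w).1.
pose ky l := block_index n (pairs W l w).2.
have cell1 l : (l < m1)%N -> (cell_index n (pairs W l w)).1 = kx l :> nat.
  by move=> lm; rewrite /= inordK // block_index_lt // (sq _ lm).1.
have cell2 l : (l < m1)%N -> (cell_index n (pairs W l w)).2 = ky l :> nat.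
  by move=> lm; rewrite /= inordK // block_index_lt // (sq _ lm).2.
pose bad (l : nat) : bool :=
  q%:R ^+ 5 < \sum_(y <- cells) psi (nth (ord0, ord0) cells l) y.
have TVi i : TV (posterior Lam V n (sampleX W w) (sampleY W w) i)
      (local_posterior Lam V n (sampleX W w) (sampleY W w) M i) <=
      C1 / q%:R + (bad (labelX i))%:R.
  have TV1 := TV_local_posterior_le1 Lam V n (sampleX W w) (sampleY W w) M i.
  case hb : (bad (labelX i)).
    by apply: le_trans TV1 _; rewrite lerDr divr_ge0 // ltW.
  rewrite addr0; apply: local_error => //.
  apply: (TV_local_le n_gt0 V_ge Un_ge x01 y01 q_ge2 qM).
  move/negbT: hb; rewrite /bad -leNgt; apply: le_trans.
  rewrite nth_mkseq // /cells big_map.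
  have -> : iota 0 m1 = index_iota 0 m1 by rewrite /index_iota subn0.
  rewrite big_mkord.
  pose f l := expR (- ((ndist (kx (labelX i)) (kx l))%:R / (q ^ 4)%:R)) : R.
  pose g l := expR (- ((ndist (kx (labelX i)) (ky l))%:R / (q ^ 4)%:R)) : R.
  rewrite [leRHS](eq_bigr (fun l : 'I_m1 => f l + g l)); last first.
    by move=> l _; rewrite /psi !cell1 // cell2.
  rewrite big_split /=; apply: lerD.
    apply: (sum_injective_label_le (f := f) (@labelX_inj _ _ _ _ _ _ _ _ W w) ltX).
    by move=> l; exact: expR_ge0.
  apply: (sum_injective_label_le (f := g) (@labelY_inj _ _ _ _ _ _ _ _ W w) ltY).
  by move=> l; exact: expR_ge0.
apply: le_trans (ler_sum _ (fun i _ => TVi i)) _.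
rewrite big_split /= sumr_const card_ord mulr_natl lerD2l.
have -> : (crowd_number psi (q%:R ^+ 5) (ord0, ord0) cells)%:R = \sum_(l < m1) (bad l)%:R :> R.
  by rewrite /crowd_number size_mkseq natr_sum.
by apply: (sum_injective_label_le (f := fun l => (bad l)%:R)
  (@labelX_inj _ _ _ _ _ _ _ _ W w) ltX).
Qed.

End SumTV.

(** * Choice of scales and constants *)

Lemma ln_power_eventually (R : realType) (s kappa : R) : 0 < s -> 0 < kappa ->
  exists n0 : nat, forall n, (n0 <= n)%N ->
    5 * expR (- (s * n%:R)) <= expR (- (ln n%:R) `^ kappa).
Proof.
move=> s0 k0; set G : R := (2 * kappa) `^ kappa.
have G0 : 0 <= G by exact: powR_ge0.
exists (Num.truncn (((G + 5) / s) ^+ 2)).+1 => n hn.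
have n1 : 1 <= n%:R :> R by rewrite ler1n; apply: leq_trans hn.
have n0 : 0 < n%:R :> R by apply: lt_le_trans n1.
have sq_ge : (G + 5) / s <= Num.sqrt n%:R.
  have c0 : 0 <= (G + 5) / s by rewrite divr_ge0 ?(ltW s0) //; lra.
  rewrite -[leLHS](ger0_norm c0) -sqrtr_sqr ler_sqrt ?(ltW n0) //.
  have /andP[_ h] := truncn_itv (sqr_ge0 ((G + 5) / s)).
  by apply: le_trans (ltW h) _; rewrite ler_nat.
have sqn : Num.sqrt n%:R * Num.sqrt n%:R = n%:R :> R.
  by rewrite -expr2 sqr_sqrtr // ltW.
have sq1 : 1 <= Num.sqrt n%:R :> R.
  by rewrite -[leLHS]sqrtr1 ler_sqrt // ltW.
have ln0 : 0 <= ln n%:R :> R by rewrite ln_ge0.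
have lnk : (ln n%:R) `^ kappa <= G * Num.sqrt n%:R.
  (* [ln t < t] at [t = n^(1 / (2 kappa))]; the power [kappa] of this bound leaves [G] times the
     square root of [n]. *)
  have h : ln n%:R <= 2 * kappa * n%:R `^ (2 * kappa)^-1 :> R.
    have p0 : 0 < n%:R `^ (2 * kappa)^-1 :> R by exact: powR_gt0.
    have := ltW (ln_sublinear p0); rewrite ln_powR => hh.
    have kk : 0 <= 2 * kappa by rewrite mulr_ge0 // ltW.
    have := ler_wpM2l kk hh; rewrite mulrA divff ?mul1r //.
    by rewrite mulf_neq0 // gt_eqF.
  have h2 : (ln n%:R) `^ kappa <= (2 * kappa * n%:R `^ (2 * kappa)^-1) `^ kappa.
    apply: ge0_ler_powR; rewrite ?nnegrE ?(ltW k0) //.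
    by rewrite !mulr_ge0 ?powR_ge0 // ltW.
  apply: le_trans h2 _; rewrite powRM ?powR_ge0 ?mulr_ge0 ?(ltW k0) //.
  rewrite -powRrM -/G.
  have -> : (2 * kappa)^-1 * kappa = 2^-1 by field; rewrite gt_eqF.
  by rewrite powR12_sqrt // ltW.
have five : 5 <= expR 5 :> R by apply: le_trans (expR_ge1Dx 5); lra.
apply: le_trans (ler_wpM2r (expR_ge0 _) five) _.
rewrite -expRD ler_expR.
have : (G + 5) * Num.sqrt n%:R <= s * n%:R.
  have := ler_wpM2l (ltW s0) (ler_wpM2r (sqrtr_ge0 n%:R) sq_ge).
  have -> : s * ((G + 5) / s * Num.sqrt n%:R) = (G + 5) * Num.sqrt n%:R.
    by field; rewrite gt_eqF.
  by rewrite sqn.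
lra.
Qed.

Lemma natr_eventually (R : realType) (x : R) :
  exists n0 : nat, forall n, (n0 <= n)%N -> x <= n%:R.
Proof.
exists (Num.truncn `|x|).+1 => n hn.
have /andP[_ h] := truncn_itv (normr_ge0 x).
apply: (le_trans (ler_norm x)); apply: le_trans (ltW h) _.
by rewrite ler_nat.
Qed.

Lemma ln2_bounds (R : realType) : 2^-1 <= ln (2 : R) <= 1.
Proof.
have h1 : 1 + 1 <= expR 1 :> R := expR_ge1Dx 1.
have h2 : 1 - 2^-1 <= expR (- 2^-1) :> R by exact: expR_ge1Dx.
have e2 : expR (- 2^-1) * expR 2^-1 = 1 :> R by rewrite -expRD addNr expR0.
have e0 : 0 < expR 2^-1 :> R by exact: expR_gt0.
have h3 : expR 2^-1 <= 2 :> R.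
  have : 2^-1 * expR 2^-1 <= expR (- 2^-1) * expR 2^-1 :> R.
    by rewrite ler_wpM2r ?(ltW e0) //; lra.
  by rewrite e2; lra.
apply/andP; split.
  by rewrite -[leLHS]expRK ler_ln ?posrE.
by rewrite -[leRHS]expRK ler_ln ?posrE ?expR_gt0.
Qed.

(** For [L < 2], [L^(- delta / 2)] is at least [exp(- delta / 2)], which [C] compensates. In the
    other case put [e = exp(- C L ln L)]: then [e <= 1/2] gives [1 - e >= exp(- 2 e)], and
    [e K <= 1] gives [(1 - e)^(K / 3) >= exp(- 2/3) >= 1/3], which [C >= 3] compensates. *)
Lemma error_ge1 (R : realType) (delta C K L : R) :
  0 < delta -> 3 <= C -> expR (delta / 2) <= C -> 0 < K -> 1 <= L ->
  L < 2 \/ K <= expR (C * L * ln L) /\ 1 <= C * L * ln L ->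
  1 <= C * L `^ (- delta / 2) +
       C * (1 - expR (- (C * L * ln L))) `^ (K / 3).
Proof.
move=> d0 C3 Cd K0 L1 cases.
have L0 : 0 < L by lra.
have C0 : 0 <= C by lra.
have ln0 : 0 <= ln L by rewrite ln_ge0.
have a0 : 0 <= C * L `^ (- delta / 2) by rewrite mulr_ge0 ?powR_ge0.
have b0 : 0 <= C * (1 - expR (- (C * L * ln L))) `^ (K / 3).
  by rewrite mulr_ge0 ?powR_ge0.
case: cases => [L2|[KX X1]].
  suff : 1 <= C * L `^ (- delta / 2) by lra.
  have l1 : ln L <= 1.
    have /andP[_ h] := ln2_bounds R; apply: le_trans h.
    by rewrite ler_ln ?posrE // ltW.
  have hL : expR (- (delta / 2)) <= L `^ (- delta / 2).
    rewrite -[L in leRHS]lnK ?posrE // -expRM ler_expR.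
    have : delta / 2 * ln L <= delta / 2 * 1 by rewrite ler_wpM2l //; lra.
    lra.
  have h1 := ler_wpM2l C0 hL; apply: le_trans h1.
  have h2 := ler_wpM2r (expR_ge0 (- (delta / 2))) Cd; apply: le_trans h2.
  by rewrite -expRD subrr expR0.
suff : 1 <= C * (1 - expR (- (C * L * ln L))) `^ (K / 3) by lra.
set X := C * L * ln L in KX X1 *; set e := expR (- X).
have e0 : 0 < e by exact: expR_gt0.
have eX : e * expR X = 1 by rewrite -expRD addNr expR0.
have eK : e * K <= 1 by rewrite -eX ler_wpM2l // ltW.
have e2 : e <= 2^-1.
  have h : 2 <= expR X by apply: le_trans (expR_ge1Dx X); lra.
  have := ler_wpM2l (ltW e0) h; rewrite eX; lra.
have h1 : expR (- (2 * e)) <= 1 - e.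
  have h := expR_ge1Dx (2 * e); have p0 := expR_gt0 (- (2 * e)).
  have pp : expR (- (2 * e)) * expR (2 * e) = 1 by rewrite -expRD addNr expR0.
  have q1 : expR (- (2 * e)) * (1 + 2 * e) <= 1.
    by apply: le_trans (ler_wpM2l (ltW p0) h) _; rewrite pp.
  have q2 : 1 <= (1 - e) * (1 + 2 * e).
    have : 0 <= e * (2^-1 - e) by rewrite mulr_ge0 ?subr_ge0 // ltW.
    lra.
  have q3 : 0 < 1 + 2 * e by lra.
  by rewrite -(ler_pM2r q3); lra.
have h2 : expR (- (2 * e)) `^ (K / 3) <= (1 - e) `^ (K / 3).
  apply: ge0_ler_powR; rewrite ?nnegrE ?expR_ge0 //; lra.
rewrite -expRM in h2.
have h3 : 3^-1 <= expR (- (2 * e) * (K / 3)).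
  apply: le_trans (expR_ge1Dx _); lra.
have h4 : 3^-1 <= (1 - e) `^ (K / 3) by lra.
have h5 := ler_wpM2l C0 h4.
by apply: le_trans h5; rewrite ler_pdivlMr //; lra.
Qed.

(** With [X = C L ln L] and [q] the integer part of [exp(X / 8)], [q^4] is at most [exp(X / 2)]. The
    condition [4 * delta <= C] makes [X / 8] at least [(delta / 2) ln L], and [2 * C' <= C] pays for
    the truncation, which at most halves [exp(X / 8)]. *)
Lemma scale_exists (R : realType) (delta C C' L : R) :
  0 < delta -> 8 <= C -> 4 * delta <= C -> 2 * C' <= C -> 0 <= C' -> 2 <= L ->
  exists q : nat, [/\ (2 <= q)%N, (q ^ 4)%:R + 1 <= expR (C * L * ln L) &
    C' / q%:R <= C * L `^ (- delta / 2)].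
Proof.
move=> d0 C8 Cd CC' C'0 L2.
have L0 : 0 < L by lra.
have /andP[l2 _] := ln2_bounds R.
have lnL : 2^-1 <= ln L by apply: le_trans l2 _; rewrite ler_ln ?posrE.
have CL : 16 <= C * L.
  have : 8 * 2 <= C * L by rewrite ler_pM //; lra.
  by lra.
set X := C * L * ln L.
have X8 : 8 <= X.
  have : 16 * 2^-1 <= C * L * ln L by rewrite ler_pM //; lra.
  by rewrite /X; lra.
pose q := Num.truncn (expR (X / 8)).
have /andP[q1 q2] := truncn_itv (expR_ge0 (X / 8)); rewrite -/q in q1 q2.
have eX2 : 2 <= expR (X / 8) by apply: le_trans (expR_ge1Dx _); lra.
have q22 : (2 <= q)%N by rewrite /q truncn_ge_nat // expR_ge0.
exists q; split => //.
- have h : (q ^ 4)%:R <= expR (X / 2).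
    have -> : X / 2 = 4%:R * (X / 8) by field.
    by rewrite natrX expRM_natl lerXn2r ?nnegrE ?expR_ge0.
  have e2 : 2 <= expR (X / 2) by apply: le_trans (expR_ge1Dx _); lra.
  have -> : expR X = expR (X / 2) * expR (X / 2) by rewrite -expRD; congr expR; field.
  have : expR (X / 2) * 2 <= expR (X / 2) * expR (X / 2) by rewrite ler_wpM2l ?expR_ge0.
  lra.
have q0 : 0 < q%:R :> R by rewrite ltr0n; apply: leq_trans q22.
have q3 : expR (X / 8) <= 2 * q%:R.
  have : 1 <= q%:R :> R by rewrite ler1n; apply: leq_trans q22.
  by move: q2; rewrite -natr1; lra.
have e8 := expR_gt0 (X / 8).
have qi : q%:R^-1 <= 2 * expR (- (X / 8)).
  rewrite expRN -ler_pdivrMl // -invfM lef_pV2 ?posrE ?mulr_gt0 // mulrC //.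
have hL : expR (- (X / 8)) <= L `^ (- delta / 2).
  rewrite -[L in leRHS]lnK ?posrE // -expRM ler_expR.
  have : delta / 2 * ln L <= C * L / 8 * ln L.
    have CL1 : C * 1 <= C * L by rewrite ler_wpM2l; lra.
    by rewrite ler_wpM2r; lra.
  by rewrite /X; lra.
apply: le_trans (ler_wpM2l C'0 qi) _.
have -> : C' * (2 * expR (- (X / 8))) = 2 * C' * expR (- (X / 8)) by ring.
by rewrite ler_pM // ?expR_ge0 //; lra.
Qed.

(** The point is the order of quantifiers: the constants are fixed before [n]. *)
Lemma density_constants (R : realType) (Lam V : R -> R) (delta : R) :
  assumptionA Lam V delta ->
  exists klow khigh c1 u : R, [/\ 0 < klow, 0 < khigh,
    (forall t, - V t <= c1 - `|t|) &
    forall n : nat, (0 < n)%N ->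
    [/\ klow / n%:R <= Zn Lam V n, Zn Lam V n <= khigh / n%:R,
       (forall x : R, 0 <= x <= 1 -> u <= Un Lam V n x),
       (forall A : set R, measurable A ->
         (\int[lebesgue_measure \x lebesgue_measure]_(z in (A `*` setT) `&` @square R)
           (pn Lam V n z.1 z.2)%:E <=
          (khigh / klow)%:E * lebesgue_measure (A `&` `[0%R, 1%R]))%E) &
       (\int[lebesgue_measure \x lebesgue_measure]_(z in @square R)
         (pn Lam V n z.1 z.2)%:E = 1)%E]].
Proof.
move=> hA; have [[c1 Vge] [v1 Vle]] := growth_le hA.
case: hA => [[Lc _ [Lmin [Lmax [Lmin0 Lb]]]] [Vm _ _ _]].
exists (Lmin * expR (- v1) / 2), (2 * Lmax * expR c1 * pi), c1.
exists (ln (Lmin * expR (- v1) / 2 / (2 * Lmax * expR c1 * pi) / Num.sqrt Lmax)).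
have Lmax0 : 0 < Lmax.
  have /Lb/andP[h1 h2] : 0 <= (0 : R) <= 1 by rewrite lexx ler01.
  by apply: lt_le_trans h2; apply: lt_le_trans h1.
split => //.
- by rewrite divr_gt0 // mulr_gt0 // expR_gt0.
- by rewrite !mulr_gt0 ?expR_gt0 // pi_gt0.
move=> n n0; split.
- exact: (Zn_ge Lc Vm Lmin0 Lb Vge Vle n0).
- exact: (Zn_le Lc Vm Lmin0 Lb Vge n0).
- by move=> x; exact: (Un_ge Lc Vm Lmin0 Lb Vge Vle n0).
- by move=> A; exact: (strip_prob_le Lc Vm Lmin0 Lb Vge Vle n0).
exact: (square_prob Lc Vm Lmin0 Lb Vge Vle n0).
Qed.

(** [m0] is at most [lam / 4], below [(1 - 1/e) lam >= lam / 2], and [m1] is at least [e lam], above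
    [(e - 1) lam], so every exponent is linear in [x]. Three tails count once and the crowding tail
    twice, whence 5. *)
Lemma tail_sum_le (R : realType) (a1 a2 cp eta s lam x m0 m1 : R) :
  0 <= x -> 0 <= cp -> 0 <= eta -> 0 <= a1 -> 0 <= a2 ->
  [/\ s <= a1 / 4, s <= a2, s <= cp * a1 / 8 & s <= eta * a2] ->
  a1 * x <= lam <= a2 * x -> a1 * x / 8 <= m0 <= a1 * x / 4 ->
  expR 1 * a2 * x <= m1 ->
  expR (m0 - (1 - expR (- 1)) * lam) + expR ((expR 1 - 1) * lam - m1) +
    expR (- (cp * m0)) + 2 * expR (- (eta * m1)) <= 5 * expR (- (s * x)).
Proof.
move=> x0 cp0 eta0 a10 a20 [sa sb sc sd] /andP[l1 l2] /andP[h0 h0'] h1.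
have E12 : 1 + 1 <= expR 1 :> R := expR_ge1Dx 1.
have Em : expR (- 1) <= 2^-1 :> R by rewrite expRN lef_pV2 ?posrE ?expR_gt0.
have ax0 : 0 <= a1 * x by rewrite mulr_ge0.
have bx0 : 0 <= a2 * x by rewrite mulr_ge0.
have t1 : expR (m0 - (1 - expR (- 1)) * lam) <= expR (- (s * x)).
  rewrite ler_expR; have := ler_wpM2r x0 sa.
  have : 2^-1 * (a1 * x) <= (1 - expR (- 1)) * lam by apply: ler_pM; lra.
  lra.
have t2 : expR ((expR 1 - 1) * lam - m1) <= expR (- (s * x)).
  rewrite ler_expR; have := ler_wpM2r x0 sb.
  have : (expR 1 - 1) * lam <= (expR 1 - 1) * (a2 * x) by apply: ler_wpM2l; lra.
  lra.
have t3 : expR (- (cp * m0)) <= expR (- (s * x)).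
  by rewrite ler_expR; have := ler_wpM2r x0 sc; have := ler_wpM2l cp0 h0; lra.
have t4 : expR (- (eta * m1)) <= expR (- (s * x)).
  rewrite ler_expR; have := ler_wpM2r x0 sd.
  have h2 : a2 * x <= m1.
    have : 1 * (a2 * x) <= expR 1 * (a2 * x) by apply: ler_wpM2r; lra.
    lra.
  by have := ler_wpM2l eta0 h2; lra.
lra.
Qed.

Lemma average_TV_event (R : realType) (p : R) (Lam V : R -> R) (delta : R) :
  0 < p < 1 -> assumptionA Lam V delta ->
  exists2 C : R, 0 < C & forall (q : nat) (kappa : R), (2 <= q)%N -> 0 < kappa ->
  exists n0 : nat, forall n : nat, (n0 <= n)%N -> forall M : R,
    (q ^ 4)%:R + 1 <= M ->
    forall (d : measure_display) (T : measurableType d) (P : probability T R)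
      (W : partial_matching P Lam V p n),
    exists E : set T, [/\ measurable E,
      ((1 - expR (- (ln n%:R) `^ kappa))%:E <= P E)%E &
      forall w, E w -> (NX W w)%:R^-1 *
        \sum_(i < NX W w)
          TV (posterior Lam V n (sampleX W w) (sampleY W w) i)
             (local_posterior Lam V n (sampleX W w) (sampleY W w) M i) <= C / q%:R].
Proof.
move=> p01 /density_constants[kl [kh [c1 [u [kl0 kh0 Vge dens]]]]].
have [C1 C10 hC1] := local_error_le (expR_ge0 (c1 + 1 - 2 * u)).
have /andP[p0 p1] := p01.
set E1 : R := expR 1.
have E12 : 2 <= E1 by apply: le_trans (expR_ge1Dx 1).
have Em : expR (- 1) <= 2^-1 :> R by rewrite expRN lef_pV2 ?posrE ?expR_gt0.
set cp : R := p * (1 - expR (- 1)) / 2.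
have cp0 : 0 < cp by rewrite divr_gt0 // mulr_gt0 //; lra.
set s1 : R := (1 - p) ^- 2.
have s10 : 0 < s1 by rewrite invr_gt0 exprn_gt0 //; lra.
set rho : R := kh / kl in dens.
have rho0 : 0 < rho by rewrite divr_gt0.
pose a1 := s1 / kh; pose a2 := s1 / kl.
have a10 : 0 < a1 by rewrite divr_gt0.
have a20 : 0 < a2 by rewrite divr_gt0.
(* The crowd bound [2 e eta m1] with [m1 <= 2 e a2 n], divided by the lower bound [cp a1 n / 8] on
   [NX]; the power of 2 is [4 * 64 * 8]. *)
pose C2 := 2 ^+ 11 * E1 ^+ 3 * a2 ^+ 2 * rho / (cp * a1).
have E10 : 0 < E1 by lra.
have C20 : 0 < C2.
  apply: divr_gt0; last exact: mulr_gt0.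
  apply: mulr_gt0 rho0; apply: mulr_gt0; last exact: exprn_gt0.
  by apply: mulr_gt0; exact: exprn_gt0.
exists (C1 + C2); first by rewrite addr_gt0.
move=> q kappa q2 k0.
have q0 : 0 < q%:R :> R by rewrite ltr0n (ltn_trans _ q2).
(* The bound [m1 * 32 rho / (n q)] on the conditional crowding probability, at [m1 = 2 e a2 n]. It
   depends on [q], and so do [s] and the threshold on [n]. *)
pose eta := 64 * E1 * a2 * rho / q%:R.
have eta0 : 0 < eta.
  by apply: divr_gt0 q0; apply: mulr_gt0 rho0; apply: mulr_gt0 a20; exact: mulr_gt0.
pose s := Num.min (Num.min (a1 / 4) a2) (Num.min (cp * a1 / 8) (eta * a2)).
have ca0 : 0 < cp * a1 by exact: mulr_gt0.
have s0 : 0 < s.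
  have a14 : 0 < a1 / 4 by exact: divr_gt0.
  have c8 : 0 < cp * a1 / 8 by exact: divr_gt0.
  by rewrite /s !lt_min a14 a20 c8 mulr_gt0.
have s_le : [/\ s <= a1 / 4, s <= a2, s <= cp * a1 / 8 & s <= eta * a2].
  by split; rewrite /s !ge_min !lexx ?orbT.
have [na hna] := natr_eventually (8 / a1).
have [nb hnb] := natr_eventually (E1 * a2)^-1.
have [nc hnc] := ln_power_eventually s0 k0.
exists (maxn (maxn na nb) (maxn nc 1)) => n; rewrite !geq_max.
move=> /andP[/andP[/hna {}hna /hnb {}hnb] /andP[/hnc {}hnc n1]] M qM d T P W.
have n0 : 0 < n%:R :> R by rewrite ltr0n.
have [Zl Zh Unb strip sq1] := dens n n1.
have Z0 : 0 < Zn Lam V n by apply: lt_le_trans Zl; rewrite divr_gt0.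
set lam : R := s1 / Zn Lam V n.
have lam_ge : a1 * n%:R <= lam.
  have -> : a1 * n%:R = s1 * (kh / n%:R)^-1 by rewrite /a1; field; rewrite !gt_eqF.
  by rewrite ler_pM2l // lef_pV2 ?posrE // divr_gt0.
have lam_le : lam <= a2 * n%:R.
  have -> : a2 * n%:R = s1 * (kl / n%:R)^-1 by rewrite /a2; field; rewrite !gt_eqF.
  by rewrite ler_pM2l // lef_pV2 ?posrE // divr_gt0.
have an8 : 8 <= a1 * n%:R by rewrite mulrC -ler_pdivrMr.
(* Rounding up to [m1] then at most doubles [e a2 n]. *)
have en1 : 1 <= E1 * a2 * n%:R.
  have ea2 : 0 < E1 * a2 by exact: mulr_gt0.
  by have := ler_wpM2l (ltW ea2) hnb; rewrite divff ?gt_eqF.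
pose m0 := Num.truncn (a1 * n%:R / 4).
have m00 : 0 <= a1 * n%:R / 4 by lra.
have /andP[m0l m0h] := truncn_itv m00; rewrite -/m0 -[m0.+1%:R]natr1 in m0l m0h.
have m0g : a1 * n%:R / 8 <= m0%:R by lra.
pose m1 := (Num.truncn (E1 * a2 * n%:R)).+1.
have m10 : 0 <= E1 * a2 * n%:R by lra.
have /andP[m1l m1h] := truncn_itv m10; rewrite -/m1 in m1l m1h.
have m1e : m1%:R <= 2 * (E1 * a2 * n%:R) by rewrite /m1 -natr1; lra.
have heta : m1%:R * (rho / n%:R * (8 * q%:R ^+ 4)) / (q%:R ^+ 5 / 4) <= eta.
  have -> : m1%:R * (rho / n%:R * (8 * q%:R ^+ 4)) / (q%:R ^+ 5 / 4) =
      m1%:R * (32 * rho / (n%:R * q%:R)) by field; rewrite !gt_eqF.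
  have -> : eta = 2 * (E1 * a2 * n%:R) * (32 * rho / (n%:R * q%:R)).
    by rewrite /eta; field; rewrite !gt_eqF.
  have w0 : 0 <= 32 * rho / (n%:R * q%:R).
    by apply/ltW/divr_gt0; exact: mulr_gt0.
  exact: ler_wpM2r.
have [E [mE PE hE]] :=
  good_event_exists W n1 p01 strip sq1 Z0 (ltW rho0) m0 q2 heta.
exists E; split => //.
  apply: le_trans PE; rewrite lee_fin lerD2l lerN2.
  apply: le_trans hnc; apply: (@tail_sum_le _ a1 a2 cp eta s) => //; try exact: ltW.
  - by rewrite lam_ge lam_le.
  - by rewrite m0l m0g.
move=> w /hE[/andP[m0N Nm1] obs insq crowd].
have S := sum_TV_le n1 Vge Unb q2 qM C10 (fun t => hC1 q t q2) Nm1 insq.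
have NXge : cp * m0%:R <= (NX W w)%:R.
  by apply: le_trans obs _; rewrite ler_nat; exact: NX_ge.
have NXge' : cp * (a1 * n%:R / 8) <= (NX W w)%:R.
  exact: le_trans (ler_wpM2l (ltW cp0) m0g) NXge.
have NX0 : 0 < (NX W w)%:R :> R.
  by apply: lt_le_trans NXge'; apply: mulr_gt0 cp0 _; apply: divr_gt0 => //; exact: mulr_gt0.
rewrite mulrC ler_pdivrMr //; apply: le_trans S _.
apply: le_trans (lerD (lexx _) crowd) _.
have -> : (C1 + C2) / q%:R * (NX W w)%:R =
    (NX W w)%:R * (C1 / q%:R) + C2 / q%:R * (NX W w)%:R by ring.
rewrite lerD2l.
have c2q : 0 <= C2 / q%:R by rewrite divr_ge0 // ltW.
apply: le_trans (ler_wpM2l c2q NXge').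
have -> : C2 / q%:R * (cp * (a1 * n%:R / 8)) =
    2 * (E1 * eta * (2 * (E1 * a2 * n%:R))).
  by rewrite /C2 /eta; field; rewrite !gt_eqF.
by rewrite ler_pM2l // ler_wpM2l // ltW // mulr_gt0.
Qed.

Theorem theorem2p4 (R : realType) (p : R) (hp : 0 < p < 1)
    (Lam V : R -> R) (delta : R) (hA : assumptionA Lam V delta) :
  exists C : R, 0 < C /\
    forall K L kappa : R, 0 < K -> 1 <= L -> 1 < kappa ->
    exists n0 : nat, forall n : nat, (n0 <= n)%N ->
    forall (d : measure_display) (T : measurableType d) (P : probability T R)
      (W : partial_matching P Lam V p n),
    exists E : set T,
      [/\ measurable E,
          ((1 - expR (- (ln n%:R) `^ kappa))%:E <= P E)%E &
          forall w, E w ->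
            (NX W w)%:R^-1 *
              \sum_(i < NX W w)
                TV (posterior Lam V n (sampleX W w) (sampleY W w) i)
                   (local_posterior Lam V n (sampleX W w) (sampleY W w)
                      (K * L) i)
            <= C * L `^ (- delta / 2)
               + C * (1 - expR (- (C * L * ln L))) `^ (K / 3)].
Proof.
have [C' C'0 hC'] := average_TV_event hp hA.
have d0 : 0 < delta by case: hA => _ [_ _ _ [C0 [c0 [? [? [? [[]]]]]]]].
have ed : 0 < expR (delta / 2) by exact: expR_gt0.
(* One summand for each lower bound on the constant in [error_ge1] and [scale_exists]. *)
pose C := 8 + 4 * delta + 2 * C' + expR (delta / 2).
have C8 : 8 <= C by rewrite /C; lra.
have C0 : 0 < C by lra.
exists C; split => // K L kappa K0 L1 kappa1.
have [hcase|hcase] := pselect (L < 2 \/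
    K <= expR (C * L * ln L) /\ 1 <= C * L * ln L).
  (* The right-hand side is at least 1 here, so the whole space serves as the event. *)
  exists 0%N => n _ d T P W; exists setT; split => //.
    by rewrite probability_setT lee_fin gerBl expR_ge0.
  move=> w _; apply: (@le_trans _ _ 1); last first.
    by apply: (@error_ge1 _ delta) => //; rewrite /C; lra.
  apply: (@le_trans _ _ ((NX W w)%:R^-1 * (NX W w)%:R)); last first.
    (* Without observed [X] values the inverse of 0 is 0 and the average vanishes. *)
    by have [->|N0] := eqVneq (NX W w)%:R (0 : R); rewrite ?mulr0 // mulVf.
  rewrite ler_wpM2l ?invr_ge0 //.
  rewrite -[X in _ <= X%:R]card_ord -sum1_card natr_sum.
  by apply: ler_sum => i _; exact: TV_local_posterior_le1.
have L2 : 2 <= L by rewrite leNgt; apply/negP => h; apply: hcase; left.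
have C4 : 4 * delta <= C by rewrite /C; lra.
have C2' : 2 * C' <= C by rewrite /C; lra.
have [q [q2 qX qerr]] := scale_exists d0 C8 C4 C2' (ltW C'0) L2.
have X1 : 1 <= C * L * ln L.
  have /andP[l2 _] := ln2_bounds R.
  have lnL : 2^-1 <= ln L by apply: le_trans l2 _; rewrite ler_ln ?posrE //; lra.
  have CL : 8 * 2 <= C * L by rewrite ler_pM //; lra.
  have : 8 * 2 * 2^-1 <= C * L * ln L by rewrite ler_pM //; lra.
  lra.
have KX : expR (C * L * ln L) <= K.
  by rewrite leNgt; apply/negP => h; apply: hcase; right; split => //; exact: ltW.
(* The scale [q] is chosen from [L] alone; [K] enters only through [exp(C L ln L) <= K], which makes
   the window wide enough. *)
have qM : (q ^ 4)%:R + 1 <= K * L.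
  apply: le_trans qX _; apply: le_trans KX _.
  by rewrite ler_peMr // ltW.
have k0 : 0 < kappa by lra.
have [n0 hn0] := hC' q kappa q2 k0.
exists n0 => n nn0 d T P W.
have [E [mE PE hE]] := hn0 n nn0 _ qM d T P W.
exists E; split => // w Ew.
apply: le_trans (hE w Ew) _; apply: le_trans qerr _.
by rewrite lerDl mulr_ge0 ?powR_ge0 // ltW.
Qed.
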